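(* Consider the $N$-relay Gaussian 1-2-1 network (defined in the context), with relays operating either all in full-duplex (FD) mode or all in half-duplex (HD) mode. Let $\mathsf{C}$ be its capacity, and let $\mathsf{C}_{\rm cs,iid}$ be the quantity defined in the context, computed with link capacities $\ell_{j,i}=\log\left(1+P|h_{ji}|^2\right)$ and with the state set $\mathcal{S}$ of the corresponding mode (FD or HD). Then $$\mathsf{C}_{\rm cs,iid}\le \mathsf{C}\le \mathsf{C}_{\rm cs,iid}+\mathsf{GAP},\qquad \mathsf{GAP}=(N+1)\log e+2\log(N+2)+N\log\big(\mathrm{Card}(S_1)\big),$$ where $\mathrm{Card}(S_1)=(N+1)^2$ if the relays operate in FD and $\mathrm{Card}(S_1)=2N+1$ if the relays operate in HD.
   Context: Logarithms are base 2. Nodes are $[0:N+1]=\{0,1,\dots,N+1\}$: node $0$ is the source, node $N+1$ the destination, nodes $[1:N]$ are relays. Network states: a state $s$ consists of sets $s_{i,t}$ and $s_{i,r}$ for every node $i\in[0:N+1]$ with $s_{i,t}\subseteq[1:N+1]\setminus\{i\}$, $|s_{i,t}|\le 1$, $s_{i,r}\subseteq[0:N]\setminus\{i\}$, $|s_{i,r}|\le1$, and $s_{0,r}=s_{N+1,t}=\emptyset$ ($s_{i,t}$ is the node towards which $i$ beams its transmission, $s_{i,r}$ the node towards which $i$ points its receive beam). In FD mode there is no further constraint; in HD mode additionally $|s_{i,t}|+|s_{i,r}|\le1$ for every $i\in[1:N]$. Let $\mathcal{S}$ denote the finite set of all such states (for the given mode). A link $(i,j)$ (from $i$ to $j$)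 is active in state $s$ if $j\in s_{i,t}$ and $i\in s_{j,r}$. Given nonnegative numbers $\ell_{j,i}$ for $i\in[0:N]$, $j\in[1:N+1]$, $i\neq j$, define $$\mathsf{C}_{\rm cs,iid}=\max_{\lambda}\ \min_{\Omega}\ \sum_{i\in\Omega,\ j\in\Omega^c}\Big(\sum_{s\in\mathcal S:\ (i,j)\text{ active in }s}\lambda_s\Big)\ell_{j,i},$$ where the maximum is over probability vectors $\lambda=(\lambda_s)_{s\in\mathcal S}$ ($\lambda_s\ge0$, $\sum_s\lambda_s=1$), the minimum is over sets $\Omega$ with $0\in\Omega\subseteq[0:N]$, and $\Omega^c=[0:N+1]\setminus\Omega$. Gaussian 1-2-1 network: in each channel use every node $i\in[0:N]$ chooses a state component $S_i=(S_{i,t},S_{i,r})$ (so that the collection forms a state in $\mathcal S$) and a channel input $X_i\in\mathbb{C}$; both may be functions of the node's message (source) or past received signals (relays) and together form the node's channel input. The destination always receives, the source always transmits. The received signal at node $j\in[1:N+1]$ is $$Y_j=Z_j+\sum_{i\in[0:N]\setminus\{j\}}h_{ji}\,\mathbf 1\{i\in S_{j,r},\ j\in S_{i,t}\}X_i,$$ where $h_{ji}\in\mathbb C$ are constant channel gains known to all nodes, $Z_j$ are i.i.d. $\mathcal{CN}(0,1)$ noises independent across nodes and time, and inputs satisfy the power constraint $\mathbb E[|X_k|^2]\le P$ for all $k\in[0:N]$. The capacity $\mathsf C$ is the supremum of rates achievable from source to destination with vanishing error probability under the standard definitions of codes and achievable rates. *)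

(* Defs.v *)
From HB Require Import structures.
From mathcomp Require Import all_boot all_order all_algebra.
From mathcomp Require Import all_classical all_reals all_analysis.
Set Implicit Arguments. Unset Strict Implicit. Unset Printing Implicit Defensive.
Import Order.TTheory GRing.Theory Num.Theory.
Local Open Scope classical_set_scope.
Local Open Scope ring_scope.

Inductive mode := FD | HD.
Definition is_HD (m : mode) : bool := if m is HD then true else false.

Section Network.
Variable R : realType.

Definition log2 (x : R) : R := ln x / ln 2.

Definition cmul (a b : R * R) : R * R := (a.1 * b.1 - a.2 * b.2, a.1 * b.2 + a.2 * b.1).
Definition cnorm2 (a : R * R) : R := a.1 ^+ 2 + a.2 ^+ 2.

Variable N : nat.
Definition node := 'I_N.+2.
Definition src : node := ord0.
Definition dst : node := ord_max.

(** local state component of a node: (s_{i,t}, s_{i,r}) with |.| <= 1 *)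
Definition lstate := (option node * option node)%type.

Definition valid_local (m : mode) (i : node) (a : lstate) : bool :=
  [&& a.1 != Some i, a.2 != Some i,
      a.1 != Some src,
      a.2 != Some dst,
      (i == src) ==> (a.2 == None),
      (i == dst) ==> (a.1 == None) &
      ([&& is_HD m, i != src & i != dst] ==> ~~ ((a.1 != None) && (a.2 != None)))].

Definition state := {ffun node -> lstate}.
Definition valid_state (m : mode) (s : state) : bool :=
  [forall i, valid_local m i (s i)].

Definition active (s : lstate) (s' : lstate) (i j : node) : bool :=
  (s.1 == Some j) && (s'.2 == Some i).
Definition active_in (s : state) (i j : node) : bool := active (s i) (s j) i j.

Definition ell (P : R) (h : node -> node -> R * R) (j i : node) : R :=
  log2 (1 + P * cnorm2 (h j i)).

Definition is_cut (Om : {set node}) : bool := (src \in Om) && (dst \notin Om).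

Definition cut_value (m : mode) (P : R) (h : node -> node -> R * R)
    (lam : state -> R) (Om : {set node}) : R :=
  \sum_(i in Om) \sum_(j in ~: Om)
     (\sum_(s : state | valid_state m s && active_in s i j) lam s) * ell P h j i.

(** min over cuts Omega (the cut {0} is one of them, used as seed) *)
Definition min_cut (m : mode) P h (lam : state -> R) : R :=
  \big[Num.min/cut_value m P h lam [set src]]_(Om : {set node} | is_cut Om)
     cut_value m P h lam Om.

Definition is_state_distr (m : mode) (lam : state -> R) : Prop :=
  [/\ forall s, 0 <= lam s,
      forall s, ~~ valid_state m s -> lam s = 0
    & \sum_(s : state) lam s = 1].

(** C_cs,iid (max over lambda, attained; written as sup of a bounded set) *)
Definition Ccs_iid (m : mode) (P : R) (h : node -> node -> R * R) : R :=
  sup [set x | exists lam, is_state_distr m lam /\ x = min_cut m P h lam].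

Definition card_S1 (m : mode) : nat := if m is FD then N.+1 ^ 2 else N.*2.+1.
Definition GAP (m : mode) : R :=
  N.+1%:R * log2 (expR 1) + 2 * log2 N.+2%:R + N%:R * log2 (card_S1 m)%:R.

(** integration against CN(0,1) on one complex coordinate:
    independent real and imaginary parts, each N(0, 1/2) *)
Definition cgauss_int (g : R * R -> \bar R) : \bar R :=
  (\int[normal_prob 0 (Num.sqrt 2^-1)]_a
     \int[normal_prob 0 (Num.sqrt 2^-1)]_b g (a, b))%E.

Fixpoint Egauss (k : nat) : (k.-tuple (R * R) -> \bar R) -> \bar R :=
  match k with
  | 0 => fun f => f [tuple]
  | k'.+1 => fun f => cgauss_int (fun z => Egauss (fun t => f (cons_tuple z t)))
  end.

(** a code of block length n with M messages:
    - the source chooses its state component and input as functions of the message;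
    - relay i at time t chooses them as functions of its t past received signals;
    - the destination chooses its receive beam from its past received signals
      and decodes from its n received signals. *)
Record code (n M : nat) := Code {
  src_st : 'I_M -> nat -> lstate;
  src_x  : 'I_M -> nat -> R * R;
  rel_st : node -> forall t : nat, t.-tuple (R * R) -> lstate;
  rel_x  : node -> forall t : nat, t.-tuple (R * R) -> R * R;
  dst_st : forall t : nat, t.-tuple (R * R) -> option node;
  decode : n.-tuple (R * R) -> 'I_M }.

Definition is_relay (i : node) : bool := (i != src) && (i != dst).

Section Run.
Variables (h : node -> node -> R * R) (n M : nat) (c : code n M).
Variable w : 'I_M.
Variable z : nat -> node -> R * R.

Definition node_st (t : nat) (hist : node -> t.-tuple (R * R)) (i : node) : lstate :=
  if i == src then src_st c w t
  else if i == dst then (None, dst_st c (hist dst))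
  else rel_st c i (hist i).

Definition node_x (t : nat) (hist : node -> t.-tuple (R * R)) (i : node) : R * R :=
  if i == src then src_x c w t
  else if i == dst then 0
  else rel_x c i (hist i).

Definition recv (t : nat) (hist : node -> t.-tuple (R * R)) (j : node) : R * R :=
  z t j + \sum_(i : node | (i != j) && (i != dst))
     (if active (node_st hist i) (node_st hist j) i j
      then cmul (h j i) (node_x hist i) else 0).

Fixpoint hist (t : nat) : node -> t.-tuple (R * R) :=
  match t with
  | 0 => fun _ => [tuple]
  | t'.+1 => fun j => rcons_tuple (hist t' j) (recv (hist t') j)
  end.

Definition input_at (t : nat) (k : node) : R * R := node_x (hist t) k.
Definition decoded : 'I_M := decode c (hist n dst).
End Run.

Definition noise_dim (n : nat) := #|{: 'I_n * node}|.
Definition noise_of (n : nat) (tup : (noise_dim n).-tuple (R * R)) : nat -> node -> R * R :=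
  fun t j => match (insub t : option 'I_n) with
             | Some t' => tnth tup (enum_rank (t', j))
             | None => 0
             end.

Definition Enoise (n : nat) (f : (nat -> node -> R * R) -> \bar R) : \bar R :=
  Egauss (fun tup : (noise_dim n).-tuple (R * R) => f (noise_of tup)).

Definition Perr (m : mode) h n M (c : code n M) : \bar R :=
  ((M%:R)^-1)%:E * \sum_(w < M)
      Enoise n (fun z => ((decoded h c w z != w)%:R)%:E).

Definition admissible (m : mode) (P : R) h n M (c : code n M) : Prop :=
  [/\ (forall w t, valid_local m src (src_st c w t)) /\
      (forall i t y, is_relay i -> valid_local m i (rel_st c i (t:=t) y)) /\
      (forall t y, valid_local m dst (None, dst_st c (t:=t) y)),
      (forall i t, is_relay i ->
         (forall a, measurable (rel_st c i (t:=t) @^-1` [set a])) /\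
         measurable_fun setT (rel_x c i (t:=t))),
      (forall t a, measurable (dst_st c (t:=t) @^-1` [set a])),
      (forall a, measurable (decode c @^-1` [set a]))
    & (forall (k : node) (t : nat), k != dst -> (t < n)%N ->
         (((M%:R)^-1)%:E * \sum_(w < M)
             Enoise n (fun z => (cnorm2 (input_at h c w z t k))%:E) <= P%:E)%E)].

Definition achievable (m : mode) (P : R) h (r : R) : Prop :=
  forall eps : R, 0 < eps -> forall n0 : nat,
    exists n M (c : code n M),
      [/\ (n0 <= n)%N /\ (0 < n)%N, (0 < M)%N, n%:R * r <= log2 M%:R,
          admissible m P h c & (Perr m h c <= eps%:E)%E].

Definition capacity (m : mode) (P : R) h : \bar R :=
  ereal_sup [set r%:E | r in achievable m P h].

End Network.

(* Main.v *)
Require Import Defs.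
From HB Require Import structures.
From mathcomp Require Import all_boot all_order all_algebra.
From mathcomp Require Import all_classical all_reals all_analysis.
From mathcomp Require Import measurable_realfun ring lra zify.
Set Implicit Arguments. Unset Strict Implicit. Unset Printing Implicit Defensive.
Import Order.TTheory GRing.Theory Num.Theory.
Local Open Scope classical_set_scope.
Local Open Scope ring_scope.

(* Upper bound.  For a cut Om, compare the run of a code with the run in which the
   nodes of Om follow a prescribed state sequence and send nothing.  The latter does
   not depend on the message, so a change of measure, with a union bound over the
   |S|^n state sequences, gives a Fano-type inequality with information density
   ln (1 + P |h|^2) + |z|^2 - |y|^2 / (1 + P |h|^2) at every output y that listens
   across the cut.  Its mean is at most ln (1 + P |h|^2) plus one nat per node and
   channel use, and the empirical state distribution of the code is a lambda.  Since
   |S| <= (N+2)^2 Card(S_1)^N, this is where the three terms of GAP come from.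

   Lower bound.  Time-share the states according to lambda and cut every active link
   into edges of equal rate.  By Menger's theorem there are edge-disjoint paths from
   the source to the destination, in number close to the min-cut.  Every edge runs a
   Gaussian random code with threshold decoding and the relays decode and forward,
   frame after frame.  Each node is active on one link at a time, so there is no
   interference, and the union bound over the finitely many jobs is harmless because
   their number does not depend on the block length. *)

(** * Gaussian product measures *)

(** The obstacle in the upper bound is that states and inputs are adaptive: the beams of the nodes
    in [Om] depend on the message and on past noise, so they carry information themselves, and a
    node can save its power for the moments when a link is on. Summing over all state sequences pays
    for the former, at [ln |S|] per channel use. The latter is the origin of the [N + 1] nats: the
    signal energy on an active link is not bounded through the time that the link is on, only
    through the full power of its transmitter, and a cut has at most [N + 1] nodes on the source
    side. Neither entropies nor conditional laws appear; conditioning on the past is done by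
    resampling one coordinate of the noise.

    In the lower bound the power constraint holds at every node and every time, on average over
    messages and noise. So a random codebook must have small average power at each of its letters,
    and a relay that decoded wrongly may send a codeword of unusual power. The codes therefore keep
    a margin [Pd < P] and a peak bound, both fixed before the error probability is chosen. *)

Section product_probability.
Context (R : realType).

Definition pprod d1 d2 (T1 : measurableType d1) (T2 : measurableType d2)
  (P1 : probability T1 R) (P2 : probability T2 R) : set (T1 * T2) -> \bar R :=
  (P1 \x P2)%E.

HB.instance Definition _ d1 d2 T1 T2 P1 P2 :=
  Measure.on (@pprod d1 d2 T1 T2 P1 P2).

Lemma pprod_setT d1 d2 T1 T2 P1 P2 : (@pprod d1 d2 T1 T2 P1 P2) setT = 1%E.
Proof.
by rewrite /pprod -setXTT product_measure1E// -[RHS]mule1; congr (_ * _)%E;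
  exact: probability_setT.
Qed.

HB.instance Definition _ d1 d2 T1 T2 P1 P2 :=
  @Measure_isProbability.Build _ _ R (@pprod d1 d2 T1 T2 P1 P2)
    (@pprod_setT d1 d2 T1 T2 P1 P2).

Lemma integral_prob_cst d (T : measurableType d) (P : probability T R) (c : \bar R) :
  (0 <= c)%E -> (\int[P]_x c = c)%E.
Proof.
move=> c0; rewrite -[RHS]mule1 -(probability_setT P) -(integral_cst _ measurableT).
by apply: eq_integral.
Qed.

End product_probability.

Lemma measurable_tnth_comp d d' (X : measurableType d') (T : measurableType d)
    k (g : X -> k.-tuple T) (i : 'I_k) :
  measurable_fun setT g -> measurable_fun setT (fun x => tnth (g x) i).
Proof.
move=> mg; apply: (@measurableT_comp _ _ _ _ _ _ (fun x : k.-tuple T => tnth x i)) => //.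
exact: measurable_tnth.
Qed.

Section tuple_probability.
Context (R : realType) d (T : measurableType d) (P : probability T R).

Definition cons_pair k (p : T * k.-tuple T) : k.+1.-tuple T :=
  cons_tuple p.1 p.2.

Lemma measurable_cons_pair k : measurable_fun setT (@cons_pair k).
Proof. exact: measurable_cons. Qed.

HB.instance Definition _ k :=
  isMeasurableFun.Build _ _ _ _ (@cons_pair k) (@measurable_cons_pair k).

Fixpoint tprob k : probability (k.-tuple T) R :=
  match k with
  | 0 => @dirac _ (0.-tuple T) [tuple] R
  | k.+1 => distribution (pprod P (tprob k)) (@cons_pair k)
  end.

Lemma measurable_consr k x :
  measurable_fun setT (fun t : k.-tuple T => cons_tuple x t).
Proof. exact: measurable_cons. Qed.

Lemma measurable_consl k (t : k.-tuple T) :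
  measurable_fun setT (fun x => cons_tuple x t).
Proof. exact: measurable_cons. Qed.

Local Open Scope ereal_scope.

Lemma tprob0_int (F : 0.-tuple T -> \bar R) :
  measurable_fun setT F -> \int[tprob 0]_t F t = F [tuple].
Proof. by move=> mF; rewrite integral_dirac// diracT mul1e. Qed.

Section fubini.
Variables (k : nat) (F : k.+1.-tuple T -> \bar R).
Hypotheses (mF : measurable_fun setT F) (F0 : forall t, 0 <= F t).

Let mFc : measurable_fun setT (F \o @cons_pair k).
Proof. exact: measurableT_comp. Qed.

Lemma tprobS_int :
  \int[tprob k.+1]_t F t = \int[P]_x \int[tprob k]_t F (cons_tuple x t).
Proof.
rewrite /= /distribution ge0_integral_pushforward//=.
by rewrite preimage_setT [LHS](fubini_tonelli1 (m1 := P) (m2 := tprob k)).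
Qed.

Lemma tprobS_intr :
  \int[tprob k.+1]_t F t = \int[tprob k]_t \int[P]_x F (cons_tuple x t).
Proof.
rewrite tprobS_int.
by apply: (fubini_tonelli (m1 := P) (m2 := tprob k) (F \o @cons_pair k));
  [exact: mFc|move=> t; exact: F0].
Qed.

Lemma measurable_int_consl :
  measurable_fun setT (fun x => \int[tprob k]_t F (cons_tuple x t)).
Proof.
by apply: (measurable_fun_fubini_tonelli_F (m2 := tprob k) (F \o @cons_pair k));
  [exact: mFc|move=> t; exact: F0].
Qed.

Lemma measurable_int_consr :
  measurable_fun setT (fun t => \int[P]_x F (cons_tuple x t)).
Proof.
by apply: (measurable_fun_fubini_tonelli_G (m1 := P) (F \o @cons_pair k));
  [exact: mFc|move=> t; exact: F0].
Qed.

End fubini.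

Definition tset k (z : k.-tuple T) (i : 'I_k) (u : T) : k.-tuple T :=
  [tuple if j == i then u else tnth z j | j < k].

Lemma tnth_tset k (z : k.-tuple T) i u j :
  tnth (tset z i u) j = if j == i then u else tnth z j.
Proof. by rewrite tnth_mktuple. Qed.

Lemma measurable_tset k (i : 'I_k) :
  measurable_fun setT (fun p : k.-tuple T * T => tset p.1 i p.2).
Proof.
apply/measurable_fun_tnthP => j.
rewrite (_ : _ \o _ = fun p => if j == i then p.2 else tnth p.1 j); last first.
  by apply/funext => p /=; rewrite tnth_tset.
by case: eqP => _; [exact: measurable_snd|exact: measurable_tnth_comp].
Qed.

Lemma tset_cons0 k x (t : k.-tuple T) u :
  tset (cons_tuple x t) ord0 u = cons_tuple u t.
Proof.
apply/eq_from_tnth => j; rewrite tnth_tset; by case: (unliftP ord0 j) => [j'|] ->//=; rewrite ?tnthS.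
Qed.

Lemma tset_consS k x (t : k.-tuple T) i u :
  tset (cons_tuple x t) (lift ord0 i) u = cons_tuple x (tset t i u).
Proof.
apply/eq_from_tnth => j; rewrite tnth_tset; by case: (unliftP ord0 j) => [j'|] ->//=; rewrite ?tnthS ?tnth_tset ?(inj_eq lift_inj).
Qed.

Lemma measurable_int_tset k (i : 'I_k) (F : k.-tuple T -> \bar R) :
  measurable_fun setT F -> (forall t, 0 <= F t) ->
  measurable_fun setT (fun z => \int[P]_u F (tset z i u)).
Proof.
move=> mF F0.
apply: (measurable_fun_fubini_tonelli_F (m2 := P) (fun p => F (tset p.1 i p.2))) => //.
exact: measurableT_comp mF (@measurable_tset k i).
Qed.

(** Coordinate [i] is independent of the others, so an independent copy may replace it. This plays
    the role of conditioning on all the other coordinates. *)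
Lemma tprob_resample k (i : 'I_k) (F : k.-tuple T -> \bar R) :
  measurable_fun setT F -> (forall t, 0 <= F t) ->
  \int[tprob k]_z F z = \int[tprob k]_z \int[P]_u F (tset z i u).
Proof.
elim: k i F => [[]//|k IH] i F mF F0.
have mFi := measurable_int_tset i mF F0.
rewrite (tprobS_int mF F0) (tprobS_int mFi) => [|t]; last exact: integral_ge0.
case: (unliftP ord0 i) => [i'|] ->.
  apply: eq_integral => x _; rewrite (IH i') //; last first.
    by apply: measurableT_comp mF _; exact: measurable_consr.
  by apply: eq_integral => t _; apply: eq_integral => u _; rewrite tset_consS.
rewrite -tprobS_int// tprobS_intr//.
under [RHS]eq_integral do under eq_integral do under eq_integral do rewrite tset_cons0.
by rewrite integral_prob_cst//; apply: integral_ge0 => t _; exact: integral_ge0.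
Qed.

Definition tproj K k (io : 'I_k -> 'I_K) (z : K.-tuple T) : k.-tuple T :=
  [tuple tnth z (io j) | j < k].

Lemma measurable_tproj K k (io : 'I_k -> 'I_K) : measurable_fun setT (tproj io).
Proof.
apply/measurable_fun_tnthP => j.
rewrite (_ : _ \o _ = fun z => tnth z (io j)); last first.
  by apply/funext => p /=; rewrite tnth_mktuple.
exact: measurable_tnth.
Qed.

(** Induction on [k]: coordinate [io ord0] is resampled, and by injectivity the remaining selected
    coordinates do not see the change. *)
Lemma tprob_marginal K k (io : 'I_k -> 'I_K) (F : k.-tuple T -> \bar R) :
  injective io -> measurable_fun setT F -> (forall t, 0 <= F t) ->
  \int[tprob K]_z F (tproj io z) = \int[tprob k]_t F t.
Proof.
elim: k io F => [|k IH] io F io_inj mF F0.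
  rewrite tprob0_int// -[RHS](integral_prob_cst (tprob K))//.
  by apply: eq_integral => z _; rewrite tuple0.
rewrite (tprob_resample (io ord0)) //; last first.
  by apply: measurableT_comp mF _; exact: measurable_tproj.
have E z u : tproj io (tset z (io ord0) u) =
    cons_tuple u (tproj (io \o lift ord0) z).
  apply/eq_from_tnth => j; rewrite tnth_mktuple tnth_tset (inj_eq io_inj).
  by case: (unliftP ord0 j) => [j'|] ->//=; rewrite ?tnthS ?tnth_mktuple ?eqxx.
under eq_integral do under eq_integral do rewrite E.
rewrite (IH (io \o lift ord0) (fun t => \int[P]_u F (cons_tuple u t))).
- by rewrite tprobS_intr.
- by move=> a b /io_inj/lift_inj.
- exact: measurable_int_consr.
- by move=> t; exact: integral_ge0.
Qed.

Lemma measurable_prod_tnth k (I : Type) (r : seq I) (Q : pred I)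
    (g : I -> k.-tuple T -> \bar R) :
  (forall i, measurable_fun setT (g i)) ->
  measurable_fun setT (fun t => \prod_(i <- r | Q i) g i t).
Proof.
move=> mg; elim: r => [|a r IH].
  by rewrite (_ : (fun t => _) = cst 1)//; apply/funext => t; rewrite big_nil.
case Qa : (Q a); last first.
  by rewrite (_ : (fun t => _) = fun t => \prod_(i <- r | Q i) g i t)//;
     apply/funext => t; rewrite big_cons Qa.
rewrite (_ : (fun t => _) = fun t => g a t * \prod_(i <- r | Q i) g i t).
  exact: emeasurable_funM.
by apply/funext => t; rewrite big_cons Qa.
Qed.

Lemma tprob_prod k (g : 'I_k -> T -> \bar R) :
  (forall i, measurable_fun setT (g i)) -> (forall i x, 0 <= g i x) ->
  \int[tprob k]_t \prod_(i < k) g i (tnth t i) = \prod_(i < k) \int[P]_x g i x.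
Proof.
elim: k g => [|k IH] g mg g0.
  rewrite big_ord0; under eq_integral do rewrite big_ord0.
  by rewrite integral_prob_cst.
have mG : measurable_fun setT (fun t : k.+1.-tuple T => \prod_(i < k.+1) g i (tnth t i)).
  apply: measurable_prod_tnth => i.
  exact: measurableT_comp (mg i) (measurable_tnth i).
rewrite tprobS_int //; last by move=> t; exact: prode_ge0.
have mH : measurable_fun setT (fun t : k.-tuple T =>
    \prod_(i < k) g (lift ord0 i) (tnth t i)).
  apply: measurable_prod_tnth => i.
  exact: measurableT_comp (mg _) (measurable_tnth i).
have H0 (t : k.-tuple T) : 0 <= \prod_(i < k) g (lift ord0 i) (tnth t i).
  exact: prode_ge0.
transitivity (\int[P]_x (g ord0 x * \int[tprob k]_t
   \prod_(i < k) g (lift ord0 i) (tnth t i))).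
  apply: eq_integral => x _; rewrite -ge0_integralZl//.
  apply: eq_integral => t _; rewrite big_ord_recl/=; congr (_ * _).
  by apply: eq_bigr => i _; rewrite tnthS.
rewrite ge0_integralZr//; last exact: integral_ge0.
by rewrite big_ord_recl/= -(IH (fun i => g (lift ord0 i))).
Qed.

(** A supermartingale: every factor is causal and has conditional mean at most 1. Peeling off the
    first coordinate keeps the form of the statement, since its value [x] becomes a parameter of the
    later factors. *)
Lemma tprob_causal_prod_le1 k (g : 'I_k -> k.-tuple T -> \bar R) :
  (forall i, measurable_fun setT (g i)) -> (forall i x, 0 <= g i x) ->
  (forall (i : 'I_k) (z z' : k.-tuple T),
     (forall j : 'I_k, (j <= i)%N -> tnth z j = tnth z' j) -> g i z = g i z') ->
  (forall (i : 'I_k) (z : k.-tuple T), \int[P]_u g i (tset z i u) <= 1) ->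
  \int[tprob k]_t \prod_(i < k) g i t <= 1.
Proof.
elim: k g => [|k IH] g mg g0 gc g1.
  under eq_integral do rewrite big_ord0.
  by rewrite integral_prob_cst.
have mG : measurable_fun setT (fun t : k.+1.-tuple T => \prod_(i < k.+1) g i t).
  exact: measurable_prod_tnth.
rewrite tprobS_int //; last by move=> t; exact: prode_ge0.
(* By causality the first factor ignores the tail, so any fixed tail turns it into a function of [x]
   alone. *)
pose t0 : k.-tuple T := nseq_tuple k point.
have g0c x t : g ord0 (cons_tuple x t) = g ord0 (cons_tuple x t0).
  by apply: gc => j; rewrite leqn0 => /eqP j0; rewrite (_ : j = ord0)//; exact: val_inj.
have mg0 : measurable_fun setT (fun x => g ord0 (cons_tuple x t0)).
  exact: measurableT_comp (mg _) (measurable_consl t0).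
apply: (@le_trans _ _ (\int[P]_x g ord0 (cons_tuple x t0))); last first.
  have := g1 ord0 (cons_tuple point t0).
  by under eq_integral do rewrite tset_cons0.
apply: ge0_le_integral => //.
- by move=> x _; apply: integral_ge0 => t _; exact: prode_ge0.
- by apply: (measurable_int_consl mG) => t; exact: prode_ge0.
move=> x _.
have mH : measurable_fun setT (fun t : k.-tuple T =>
    \prod_(i < k) g (lift ord0 i) (cons_tuple x t)).
  apply: measurable_prod_tnth => i.
  exact: measurableT_comp (mg _) (measurable_consr x).
have H0 (t : k.-tuple T) : 0 <= \prod_(i < k) g (lift ord0 i) (cons_tuple x t).
  exact: prode_ge0.
rewrite (_ : \int[_]_t _ = g ord0 (cons_tuple x t0) * \int[tprob k]_t
   \prod_(i < k) g (lift ord0 i) (cons_tuple x t)); last first.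
  rewrite -ge0_integralZl//.
  by apply: eq_integral => t _; rewrite big_ord_recl/= g0c.
rewrite -[leRHS]mule1 lee_wpmul2l//.
apply: (IH (fun i t => g (lift ord0 i) (cons_tuple x t))) => //.
- by move=> i; exact: measurableT_comp (mg _) (measurable_consr x).
- move=> i z z' zz'; apply: gc => j; case: (unliftP ord0 j) => [j'|] ->//=.
  by rewrite /bump/= !add1n ltnS !tnthS; exact: zz'.
- by move=> i z; under eq_integral do rewrite -tset_consS.
Qed.

End tuple_probability.

(** * Gaussian integrals on the line and in the complex plane *)

Section real_gaussian.
Context {R : realType}.
Notation mu := (@lebesgue_measure R).
Local Open Scope ereal_scope.

Definition id_borel : measurableTypeR R -> R := idfun.

Lemma measurable_id_borel : measurable_fun setT id_borel.
Proof. by move=> _ A mA; rewrite setTI. Qed.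

HB.instance Definition _ :=
  isMeasurableFun.Build _ _ _ _ id_borel measurable_id_borel.

Definition gauss1 : probability (measurableTypeR R) R :=
  normal_prob 0 (Num.sqrt 2^-1).

(* Copy of [gauss1] on the canonical measurable structure of [R], the one that
   products such as [R * R] are built on. *)
Definition gauss1R : probability R R := distribution gauss1 id_borel.

Lemma integral_gauss1R (g : R -> \bar R) : measurable_fun setT g ->
  (forall x, 0 <= g x) ->
  \int[gauss1R]_x g x = \int[normal_prob 0 (Num.sqrt 2^-1)]_x g x.
Proof. by move=> mg g0; rewrite /= /distribution ge0_integral_pushforward. Qed.

Let sg0 : (Num.sqrt 2^-1 : R) != 0%R.
Proof. by rewrite gt_eqF// sqrtr_gt0 invr_gt0. Qed.

Lemma normal_pdf_half (x : R) : normal_pdf 0 (Num.sqrt 2^-1) x =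
  ((Num.sqrt pi)^-1 * expR (- x ^+ 2))%R.
Proof.
rewrite normal_pdfE// /normal_peak /normal_fun subr0 sqr_sqrtr ?invr_ge0//.
rewrite -mulrnAr -[(pi *+ 2)%R]mulr_natl mulrA mulVf// mul1r.
by rewrite -mulr_natl divff// divr1.
Qed.

(** The Radon-Nikodym derivative of [normal_prob] agrees almost everywhere with [normal_pdf],
    because both have the same integral over every measurable set. *)
Lemma integral_normal_prob (m s : R) (f : R -> \bar R) :
  measurable_fun setT f -> (forall x, 0 <= f x) ->
  \int[normal_prob m s]_x f x = \int[mu]_x (f x * (normal_pdf m s x)%:E).
Proof.
move=> mf f0.
have dom := normal_prob_dominates m s.
rewrite -(Radon_Nikodym_SigmaFinite.change_of_variables dom)//.
apply: ae_eq_integral => //=.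
- apply: emeasurable_funM => //; apply: (measurable_int mu).
  exact: Radon_Nikodym_SigmaFinite.f_integrable.
- apply: emeasurable_funM => //; apply/measurable_EFinP.
  exact: measurable_normal_pdf.
- apply: ae_eqe_mul2l => /=.
  apply: integral_ae_eq => //=.
  + exact: Radon_Nikodym_SigmaFinite.f_integrable.
  + by apply/measurable_EFinP; exact: measurable_normal_pdf.
  + by move=> E _ mE; rewrite -Radon_Nikodym_SigmaFinite.f_integral.
Qed.

Lemma lebesgue_shift (c : R) (f : R -> \bar R) :
  measurable_fun setT f -> (forall x, 0 <= f x) ->
  \int[mu]_x f (x + c)%R = \int[mu]_x f x.
Proof.
move=> mf f0.
pose sh : measurableTypeR R -> measurableTypeR R := fun x => (x + c)%R.
have msh : measurable_fun setT sh by apply: measurable_funD.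
have E A : measurable A -> pushforward mu sh A = mu A.
  pose shi := isMeasurableFun.Build _ _ _ _ sh msh.
  pose shm : {mfun _ >-> _} := HB.pack sh shi.
  move=> mA; apply/esym.
  apply: (@lebesgue_measure_unique R (pushforward mu shm)) => //= _ [[a b]] _ <-.
  rewrite /pushforward (_ : _ @^-1` _ = `](a - c)%R, (b - c)%R]%classic); last first.
    apply/seteqP; split=> x/=; rewrite !in_itv/= /sh => /andP[u v];
      apply/andP; split; lra.
  rewrite !lebesgue_measure_itv/= !lte_fin ltrD2r.
  by case: ifP => // _; rewrite -!EFinD; congr (_%:E); lra.
transitivity (\int[pushforward mu sh]_x f x).
  by rewrite ge0_integral_pushforward//= .
by apply: eq_measure_integral => A mA _; exact: E.
Qed.

(** The density is proportional to [expR (- x ^+ 2)], so the weight is the ratio of its values at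
    [x + c] and at [x]; what remains is the translation invariance of Lebesgue measure. *)
Lemma gauss1_girsanov (c : R) (f : R -> \bar R) :
  measurable_fun setT f -> (forall x, 0 <= f x) ->
  \int[gauss1R]_x ((expR (x ^+ 2 - (x + c) ^+ 2))%:E * f (x + c)%R) =
  \int[gauss1R]_x f x.
Proof.
move=> mf f0.
have mexp : measurable_fun setT (fun x : R => (expR (x ^+ 2 - (x + c) ^+ 2))%:E).
  apply/measurable_EFinP; apply: measurableT_comp => //.
  apply: measurable_funB; apply: measurable_funX => //.
  exact: measurable_funD.
have mfc : measurable_fun setT (fun x : R => f (x + c)%R).
  by apply: measurableT_comp => //; exact: measurable_funD.
rewrite !integral_gauss1R//; last 2 first.
  exact: emeasurable_funM.
  by move=> x; rewrite mule_ge0// lee_fin expR_ge0.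
rewrite !integral_normal_prob//; last 2 first.
  exact: emeasurable_funM.
  by move=> x; rewrite mule_ge0// lee_fin expR_ge0.
rewrite -(lebesgue_shift c (f := fun x => f x * _)).
- apply: eq_integral => x _; rewrite !normal_pdf_half.
  rewrite muleAC -EFinM muleC; congr (_ * _%:E).
  by rewrite mulrCA -expRD; congr (_ * expR _)%R; ring.
- apply: emeasurable_funM => //; apply/measurable_EFinP.
  exact: measurable_normal_pdf.
- by move=> x; rewrite mule_ge0// lee_fin normal_pdf_ge0.
Qed.

(* Complete the square: x^2 + t (g x + z)^2 = a (x + t g z / a)^2 + t z^2 / a
   with a = 1 + t g^2. *)
Lemma gauss1_expR (t g z : R) : (0 < 1 + t * g ^+ 2)%R ->
  \int[gauss1R]_x (expR (- t * (g * x + z) ^+ 2))%:E =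
  ((Num.sqrt (1 + t * g ^+ 2))^-1 *
    expR (- t * z ^+ 2 / (1 + t * g ^+ 2)))%:E.
Proof.
set a := (1 + _)%R => a0.
have mexp : measurable_fun setT (fun x : R => (expR (- t * (g * x + z) ^+ 2))%:E).
  apply/measurable_EFinP; apply: measurableT_comp => //.
  apply: measurable_funM => //; apply: measurable_funX.
  by apply: measurable_funD => //; exact: measurable_funM.
rewrite integral_gauss1R// integral_normal_prob//.
pose s : R := Num.sqrt ((a *+ 2)^-1).
have s2 : (s ^+ 2 = (a *+ 2)^-1)%R.
  by rewrite sqr_sqrtr// invr_ge0 mulrn_wge0// ltW.
have s0 : (s != 0)%R by rewrite gt_eqF// sqrtr_gt0 invr_gt0 pmulrn_lgt0.
pose m : R := (- (t * g * z / a))%R.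
have a_neq0 : a != 0%R by rewrite gt_eqF.
rewrite (_ : integral _ _ _ =
  \int[mu]_x (((Num.sqrt a)^-1 * expR (- t * z ^+ 2 / a))%:E * (normal_pdf m s x)%:E)).
  rewrite ge0_integralZl//; last 2 first.
  - by apply/measurable_EFinP; exact: measurable_normal_pdf.
  - by move=> x _; rewrite lee_fin normal_pdf_ge0.
  by rewrite integral_normal_pdf mule1.
apply: eq_integral => x _; rewrite -!EFinM normal_pdf_half; congr (_%:E).
rewrite normal_pdfE// /normal_peak /normal_fun s2.
have -> : ((a *+ 2)^-1 * pi *+ 2 = pi / a)%R.
  by rewrite -mulr_natl -(mulr_natl a); field.
rewrite sqrtrM ?pi_ge0// sqrtrV ?ltW//.
have sa0 : Num.sqrt a != 0%R by rewrite gt_eqF// sqrtr_gt0.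
have sp0 : Num.sqrt (pi : R) != 0%R by rewrite gt_eqF// sqrtr_gt0 pi_gt0.
transitivity ((Num.sqrt pi)^-1 * (expR (- t * (g * x + z) ^+ 2) * expR (- x ^+ 2)))%R.
  by ring.
rewrite -expRD.
transitivity ((Num.sqrt pi)^-1 * (expR (- t * z ^+ 2 / a) *
   expR (- (x - m) ^+ 2 / ((a *+ 2)^-1 *+ 2))))%R; last first.
  by field; rewrite sa0 sp0.
rewrite -expRD; congr (_ * expR _)%R; rewrite /m /a.
rewrite -/a (_ : ((a *+ 2)^-1 *+ 2 = a^-1)%R); last first.
  by rewrite !mulr2n; field; rewrite a_neq0/= gt_eqF// addr_gt0.
transitivity (- t * z ^+ 2 / a - a * (x + t * g * z / a) ^+ 2)%R; last by field.
by rewrite /a; field; rewrite -/a a_neq0.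
Qed.

End real_gaussian.

Section complex_gaussian.
Context {R : realType}.
Local Notation C := (R * R)%type.
Local Open Scope ereal_scope.

Definition gam : probability C R := pprod gauss1R gauss1R.

Lemma gam_int (g : C -> \bar R) : measurable_fun setT g ->
  (forall x, 0 <= g x) ->
  \int[gam]_z g z = \int[gauss1R]_a \int[gauss1R]_b g (a, b).
Proof.
by move=> mg g0; rewrite [LHS](fubini_tonelli1 (m1 := gauss1R) (m2 := gauss1R)).
Qed.

Lemma cgauss_intE (g : C -> \bar R) : measurable_fun setT g ->
  (forall x, 0 <= g x) -> cgauss_int g = \int[gam]_z g z.
Proof.
move=> mg g0; rewrite /cgauss_int gam_int// integral_gauss1R.
- apply: eq_integral => x _; rewrite integral_gauss1R//.
  exact: measurableT_comp.
- exact: (measurable_fun_fubini_tonelli_F (m2 := gauss1R)).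
- by move=> x; exact: integral_ge0.
Qed.

Lemma Egauss_tprob k (f : k.-tuple C -> \bar R) : measurable_fun setT f ->
  (forall x, 0 <= f x) -> Egauss f = \int[tprob gam k]_t f t.
Proof.
elim: k f => [|k IH] f mf f0; first by rewrite tprob0_int.
rewrite tprobS_int//=; under eq_fun => z.
  rewrite IH//; last by apply: measurableT_comp mf _; exact: measurable_consr.
  over.
apply: cgauss_intE; first exact: measurable_int_consl.
by move=> z; exact: integral_ge0.
Qed.

Lemma gam_prod (f g : R -> \bar R) :
  measurable_fun setT f -> measurable_fun setT g ->
  (forall x, 0 <= f x) -> (forall x, 0 <= g x) ->
  \int[gam]_z (f z.1 * g z.2) = \int[gauss1R]_x f x * \int[gauss1R]_x g x.
Proof.
move=> mf mg f0 g0; rewrite gam_int; last 2 first.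
- by apply: emeasurable_funM; exact: measurableT_comp.
- by move=> z; exact: mule_ge0.
rewrite -ge0_integralZr//; last exact: integral_ge0.
by apply: eq_integral => a _; rewrite /= ge0_integralZl.
Qed.

Lemma measurable_cnorm2 : measurable_fun setT (@cnorm2 R).
Proof. by apply: measurable_funD; apply: measurable_funX. Qed.

Lemma measurable_caddr (c : C) : measurable_fun setT (fun z : C => (z + c)%R).
Proof. by apply: measurable_fun_pair; apply: measurable_funD. Qed.

Lemma measurable_expR_norm (X : C -> R) : measurable_fun setT X ->
  measurable_fun setT (fun z => (expR (X z))%:E).
Proof. by move=> mX; apply/measurable_EFinP; exact: measurableT_comp. Qed.

Lemma gam_girsanov (c : C) (f : C -> \bar R) :
  measurable_fun setT f -> (forall x, 0 <= f x) ->
  \int[gam]_z ((expR (cnorm2 z - cnorm2 (z + c)))%:E * f (z + c)%R) =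
  \int[gam]_z f z.
Proof.
move=> mf f0.
have mfc : measurable_fun setT (fun z : C => f (z + c)%R).
  by apply: measurableT_comp mf _; exact: measurable_caddr.
rewrite gam_int; last 2 first.
- apply: emeasurable_funM => //; apply: measurable_expR_norm.
  apply: measurable_funB; first exact: measurable_cnorm2.
  by apply: measurableT_comp; [exact: measurable_cnorm2|exact: measurable_caddr].
- by move=> z; rewrite mule_ge0// lee_fin expR_ge0.
pose G a := \int[gauss1R]_b f (a, b).
have mG : measurable_fun setT G.
  exact: (measurable_fun_fubini_tonelli_F (m2 := gauss1R)).
rewrite gam_int//.
transitivity (\int[gauss1R]_a ((expR (a ^+ 2 - (a + c.1) ^+ 2))%:E * G (a + c.1)%R)).
  apply: eq_integral => a _.
  have mfa : measurable_fun setT (fun b : R => f ((a + c.1)%R, b)).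
    exact: measurableT_comp.
  rewrite /G -(gauss1_girsanov c.2 (f := fun b => f ((a + c.1)%R, b)))//.
  have mfac : measurable_fun setT (fun b : R => f ((a + c.1)%R, (b + c.2)%R)).
    by apply: (measurableT_comp mfa); exact: measurable_funD.
  rewrite -ge0_integralZl//; last 2 first.
  - apply: emeasurable_funM => //.
    apply/measurable_EFinP; apply: measurableT_comp => //.
    apply: measurable_funB; apply: measurable_funX => //.
    exact: measurable_funD.
  - by move=> x _; rewrite mule_ge0// lee_fin expR_ge0.
  apply: eq_integral => b _; rewrite muleA -EFinM -expRD /cnorm2/=.
  by congr ((expR _)%:E * _); ring.
rewrite gauss1_girsanov// => x; exact: integral_ge0.
Qed.

Lemma cmul_realE (g : R) (x : C) : cmul (g, 0%R) x = (g * x.1, g * x.2)%R.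
Proof. by rewrite /cmul/= !mul0r subr0 addr0. Qed.

Lemma measurable_caff (g : R) (z : C) :
  measurable_fun setT (fun x : C => cmul (g, 0%R) x + z)%R.
Proof.
under eq_fun do rewrite cmul_realE.
by apply: measurable_fun_pair; apply: measurable_funD => //; apply: measurable_funM.
Qed.

(** The two coordinates contribute one square root each. The sign of [t] is free as long as the
    integral converges: positive [t] gives a Laplace transform, negative [t] an exponential moment
    of the squared modulus. *)
Lemma gam_expR (t g : R) (z : C) : (0 < 1 + t * g ^+ 2)%R ->
  \int[gam]_x (expR (- t * cnorm2 (cmul (g, 0%R) x + z)))%:E =
  ((1 + t * g ^+ 2)^-1 * expR (- t * cnorm2 z / (1 + t * g ^+ 2)))%:E.
Proof.
move=> a0.
have m1 (w : R) : measurable_fun setT (fun x : R => (expR (- t * (g * x + w) ^+ 2))%:E).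
  apply/measurable_EFinP; apply: measurableT_comp => //.
  apply: measurable_funM => //; apply: measurable_funX.
  by apply: measurable_funD => //; exact: measurable_funM.
transitivity (\int[gam]_x ((expR (- t * (g * x.1 + z.1) ^+ 2))%:E *
   (expR (- t * (g * x.2 + z.2) ^+ 2))%:E)).
  apply: eq_integral => x _; rewrite -EFinM -expRD cmul_realE /cnorm2/=.
  by congr ((expR _)%:E); ring.
rewrite (@gam_prod (fun a => (expR (- t * (g * a + z.1) ^+ 2))%:E)
  (fun a => (expR (- t * (g * a + z.2) ^+ 2))%:E))//.
rewrite !gauss1_expR// -EFinM; congr (_%:E).
set a := (1 + _)%R in a0 *.
rewrite mulrACA -invfM -expr2 sqr_sqrtr ?ltW// -expRD /cnorm2.
by congr (_ * expR _)%R; field; rewrite gt_eqF.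
Qed.

Lemma cnorm2_ge0 (z : C) : (0 <= cnorm2 z)%R.
Proof. by rewrite addr_ge0// sqr_ge0. Qed.

Lemma cmul1 (z : C) : cmul (1%R, 0%R) z = z.
Proof. by rewrite cmul_realE !mul1r; case: z. Qed.

(** The second moment is read off the exponential moment: integrating
    [1 + s * |y|^2 <= expR (s * |y|^2)] gives [s * I + 1 <= (1 - s * K)^-1] for all small [s > 0],
    which forces [I <= K]. The same estimate shows that [I] is finite. *)
Lemma gam_norm_le (m : C) :
  \int[gam]_z (cnorm2 (z + m))%:E <= (1 + cnorm2 m)%:E.
Proof.
set K := (1 + _)%R.
have K1 : (1 <= K)%R by rewrite lerDl cnorm2_ge0.
have mn : measurable_fun setT (fun z : C => cnorm2 (z + m)%R).
  by apply: measurableT_comp; [exact: measurable_cnorm2|exact: measurable_caddr].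
have mE : measurable_fun setT (fun z : C => (cnorm2 (z + m))%:E).
  exact/measurable_EFinP.
set I := \int[gam]_z _.
have I0 : 0 <= I by apply: integral_ge0 => z _; rewrite lee_fin cnorm2_ge0.
have key (s : R) : (0 < s)%R -> (s * K < 1)%R ->
    s%:E * I + 1 <= ((1 - s * K)^-1)%:E.
  move=> s0 sK.
  have s1 : (s < 1)%R by apply: le_lt_trans sK; rewrite ler_peMr// ltW.
  have D0 : (0 < 1 + - s * 1 ^+ 2)%R by rewrite expr1n mulr1 subr_gt0.
  have := gam_expR m D0; under eq_integral do rewrite cmul1 opprK.
  move=> E.
  apply: (@le_trans _ _ (\int[gam]_x (expR (s * cnorm2 (x + m)))%:E)).
    rewrite -[X in X + 1]ge0_integralZl//; last 2 first.
    - by move=> z _; rewrite lee_fin cnorm2_ge0.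
    - by rewrite lee_fin ltW.
    rewrite -[X in _ + X](integral_prob_cst gam)// -ge0_integralD//; last 2 first.
    - by move=> z _; rewrite -EFinM lee_fin mulr_ge0 ?cnorm2_ge0// ltW.
    - apply: emeasurable_funM => //.
    apply: ge0_le_integral => //.
    - by move=> z _; rewrite adde_ge0// -EFinM lee_fin mulr_ge0 ?cnorm2_ge0// ltW.
    - by apply: emeasurable_funD => //; exact: emeasurable_funM.
    - apply: measurable_expR_norm; exact: measurable_funM.
    - by move=> z _; rewrite -EFinM -EFinD lee_fin addrC expR_ge1Dx.
  rewrite E lee_fin expr1n !mulr1 opprK -ler_pdivlMl ?invr_gt0 ?subr_gt0// invrK.
  (* [expR u <= (1 - u)^-1], and [(1 - s) * (1 - u) = 1 - s * K]. *)
  set u := (s * cnorm2 m / (1 - s))%R.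
  have u1 : (u < 1)%R.
    rewrite ltr_pdivrMr ?subr_gt0// mul1r; move: sK; rewrite /K; lra.
  have -> : ((1 - s) * (1 - s * K)^-1 = (1 - u)^-1)%R.
    rewrite /u /K; field; move: sK; rewrite /K => sK.
    by apply/andP; split; apply/eqP; lra.
  rewrite -[expR u]invrK lef_pV2 ?posrE ?invr_gt0 ?expR_gt0 ?subr_gt0//.
  by rewrite -expRN; apply: le_trans (expR_ge1Dx _); lra.
have Ifin : I \is a fin_num.
  rewrite ge0_fin_numE//.
  pose s := ((2 * K)^-1)%R.
  have s0 : (0 < s)%R by rewrite invr_gt0; lra.
  have sK : (s * K < 1)%R.
    rewrite /s invfM -mulrA mulVf ?mulr1; last by apply/eqP; lra.
    lra.
  have := key s s0 sK; case: (I) I0 => [r r0 _|_|//]; first exact: ltry.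
  by rewrite gt0_muley ?lte_fin.
move: key I0; rewrite -(fineK Ifin); set e := fine I => key e0.
rewrite lee_fin leNgt; apply/negP => Ke.
(* The estimate at [s] reduces to [e - K <= s * e * K], and this [s] makes the right-hand side
   [(e - K) / 2], which is absurd when [K < e]. *)
pose s := ((e - K) / (2 * e * K))%R.
have epos : (0 < e)%R by lra.
have Kpos : (0 < K)%R by lra.
have s0 : (0 < s)%R by rewrite divr_gt0 ?mulr_gt0// subr_gt0.
have sKE : (s * K = (e - K) / (2 * e))%R.
  by rewrite /s; field; apply/andP; split; apply/eqP; lra.
have sK : (s * K < 1)%R by rewrite sKE ltr_pdivrMr ?mulr_gt0//; lra.
have := key s s0 sK; rewrite -EFinM -EFinD lee_fin.
have D0 : (0 < 1 - s * K)%R by lra.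
rewrite -[X in (_ <= X)%R -> _]div1r ler_pdivlMr// => H.
have : (e * (s * K) = (e - K) / 2)%R by rewrite sKE; field; apply/eqP; lra.
nra.
Qed.

(** As for [gam_norm_le], now with [expR (- s * |z|^2) >= 1 - s * |z|^2] for small [s]. *)
Lemma gam_norm_ge : 1 <= \int[gam]_z (cnorm2 z)%:E.
Proof.
have mE : measurable_fun setT (fun z : C => (cnorm2 z)%:E).
  by apply/measurable_EFinP; exact: measurable_cnorm2.
set I := \int[gam]_z _.
have I0 : 0 <= I by apply: integral_ge0 => z _; rewrite lee_fin cnorm2_ge0.
have key (s : R) : (0 < s)%R -> 1 <= s%:E * I + ((1 + s)^-1)%:E.
  move=> s0.
  have D0 : (0 < 1 + s * 1 ^+ 2)%R by rewrite expr1n mulr1; lra.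
  have := gam_expR 0%R D0; under eq_integral do rewrite cmul1 addr0.
  rewrite {2}/cnorm2/= expr0n/= addr0 mulr0 mul0r expR0 mulr1 expr1n mulr1 => <-.
  have me : measurable_fun setT (fun z : C => (expR (- s * cnorm2 z))%:E).
    apply: measurable_expR_norm; apply: measurable_funM => //.
    exact: measurable_cnorm2.
  rewrite -[X in X + _]ge0_integralZl//; last 2 first.
  - by move=> z _; rewrite lee_fin cnorm2_ge0.
  - by rewrite lee_fin ltW.
  rewrite -ge0_integralD//; last 2 first.
  - by move=> z _; rewrite -EFinM lee_fin mulr_ge0 ?cnorm2_ge0// ltW.
  - exact: emeasurable_funM.
  rewrite -[leLHS](integral_prob_cst gam)//.
  apply: ge0_le_integral => //.
  - by apply: emeasurable_funD => //; exact: emeasurable_funM.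
  - move=> z _; rewrite -EFinM -EFinD lee_fin.
    by have := expR_ge1Dx (- s * cnorm2 z); lra.
have [Ifin|] := boolP (I \is a fin_num); last first.
  by rewrite ge0_fin_numE// -leNgt leye_eq => /eqP ->; rewrite leey.
move: key I0; rewrite -(fineK Ifin); set e := fine I => key e0.
rewrite lee_fin leNgt; apply/negP => e1.
rewrite lee_fin in e0.
pose s := ((1 - e) / 2)%R.
have s0 : (0 < s)%R by rewrite /s; lra.
have := key s s0; rewrite -EFinM -EFinD lee_fin.
have D0 : (0 < 1 + s)%R by lra.
rewrite -(ler_pM2r D0) mul1r mulrDl mulVf ?gt_eqF//.
have es : (e * (1 + s) < 1)%R by rewrite /s; nra.
have : (s * (e * (1 + s)) < s)%R by rewrite gtr_pMr.
lra.
Qed.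

End complex_gaussian.

(** * Change of measure for causal shifts of Gaussian noise *)

Section girsanov.
Context {R : realType}.
Local Notation C := (R * R)%type.
Local Open Scope ereal_scope.

Lemma measurable_cadd d (X : measurableType d) (f g : X -> C) :
  measurable_fun setT f -> measurable_fun setT g ->
  measurable_fun setT (fun x => f x + g x)%R.
Proof.
move=> mf mg; apply: measurable_fun_pair; apply: measurable_funD.
- exact: (measurableT_comp measurable_fst mf).
- exact: (measurableT_comp measurable_fst mg).
- exact: (measurableT_comp measurable_snd mf).
- exact: (measurableT_comp measurable_snd mg).
Qed.

Definition tshift K (dl : 'I_K -> K.-tuple C -> C) (z : K.-tuple C) : K.-tuple C :=
  [tuple tnth z k + dl k z | k < K]%R.

Lemma measurable_tshift K (dl : 'I_K -> K.-tuple C -> C) :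
  (forall k, measurable_fun setT (dl k)) -> measurable_fun setT (tshift dl).
Proof.
move=> mdl; apply/measurable_fun_tnthP => j.
rewrite (_ : _ \o _ = fun z => tnth z j + dl j z)%R; last first.
  by apply/funext => z /=; rewrite tnth_mktuple.
by apply: measurable_cadd => //; exact: measurable_tnth.
Qed.

(** Girsanov's formula in discrete time. Given the earlier coordinates, the shift of a coordinate is
    a constant, so [gam_girsanov] applies to one coordinate at a time. The first shift is a constant
    [c] outright, and the first value then becomes a parameter of the later shifts. *)
Lemma tprob_girsanov K (dl : 'I_K -> K.-tuple C -> C) (F : K.-tuple C -> \bar R) :
  (forall k, measurable_fun setT (dl k)) ->
  (forall (k : 'I_K) (z z' : K.-tuple C),
     (forall j : 'I_K, (j < k)%N -> tnth z j = tnth z' j) -> dl k z = dl k z') ->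
  measurable_fun setT F -> (forall z, 0 <= F z) ->
  \int[tprob gam K]_z
    ((expR (\sum_(k < K) (cnorm2 (tnth z k) - cnorm2 (tnth (tshift dl z) k))))%:E
      * F (tshift dl z)) =
  \int[tprob gam K]_z F z.
Proof.
elim: K dl F => [|K IH] dl F mdl dlc mF F0.
  apply: eq_integral => z _; rewrite big_ord0 expR0 mul1e; congr F.
  by rewrite [LHS]tuple0 [RHS]tuple0.
have mV := measurable_tshift mdl.
have mH : measurable_fun setT (fun z => (expR (\sum_(k < K.+1)
    (cnorm2 (tnth z k) - cnorm2 (tnth (tshift dl z) k))))%:E * F (tshift dl z)).
  apply: emeasurable_funM; last exact: measurableT_comp.
  apply/measurable_EFinP; apply: measurableT_comp => //.
  apply: measurable_sum => k; apply: measurable_funB.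
    by apply: measurableT_comp (measurable_tnth k); exact: measurable_cnorm2.
  apply: measurableT_comp; first exact: measurable_cnorm2.
  exact: measurable_tnth_comp.
have H0 z : 0 <= (expR (\sum_(k < K.+1)
    (cnorm2 (tnth z k) - cnorm2 (tnth (tshift dl z) k))))%:E * F (tshift dl z).
  by rewrite mule_ge0// lee_fin expR_ge0.
rewrite (tprobS_int _ mH H0) (tprobS_int _ mF F0).
pose t0 : K.-tuple C := nseq_tuple K 0%R.
pose c := dl ord0 (cons_tuple 0%R t0).
have cE x t : dl ord0 (cons_tuple x t) = c by exact: dlc.
pose dl' x (k : 'I_K) t := dl (lift ord0 k) (cons_tuple x t).
have mdl' x k : measurable_fun setT (dl' x k).
  exact: measurableT_comp (mdl _) (measurable_consr x).
have dlc' x (k : 'I_K) (z z' : K.-tuple C) :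
    (forall j : 'I_K, (j < k)%N -> tnth z j = tnth z' j) -> dl' x k z = dl' x k z'.
  move=> zz'; apply: dlc => j; case: (unliftP ord0 j) => [j'|] ->//=.
  by rewrite /bump/= !add1n ltnS !tnthS; exact: zz'.
have tsE x t : tshift dl (cons_tuple x t) = cons_tuple (x + c)%R (tshift (dl' x) t).
  apply/eq_from_tnth => j; rewrite tnth_mktuple.
  case: (unliftP ord0 j) => [j'|] ->; first by rewrite !tnthS tnth_mktuple.
  by rewrite cE.
pose G x := \int[tprob gam K]_t F (cons_tuple x t).
have mG : measurable_fun setT G by exact: measurable_int_consl.
have G0 x : 0 <= G x by exact: integral_ge0.
rewrite -[RHS](@gam_girsanov _ c G)//.
apply: eq_integral => x _.
have mFx : measurable_fun setT (fun t => F (cons_tuple (x + c)%R t)).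
  exact: measurableT_comp mF (measurable_consr _).
rewrite /G -(IH (dl' x) (fun t => F (cons_tuple (x + c)%R t)))//.
rewrite -ge0_integralZl//; last 2 first.
- apply: emeasurable_funM; last first.
    by apply: (measurableT_comp mFx); exact: measurable_tshift.
  apply/measurable_EFinP; apply: measurableT_comp => //.
  apply: measurable_sum => k; apply: measurable_funB.
    by apply: measurableT_comp (measurable_tnth k); exact: measurable_cnorm2.
  apply: measurableT_comp; first exact: measurable_cnorm2.
  by apply: measurable_tnth_comp; exact: measurable_tshift.
- by move=> t _; rewrite mule_ge0// lee_fin expR_ge0.
apply: eq_integral => t _; rewrite muleA -EFinM -expRD tsE; congr ((expR _)%:E * _).
rewrite big_ord_recl/=; congr (_ + _)%R.
by apply: eq_bigr => k _; rewrite !tnthS.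
exact: dlc'.
Qed.

End girsanov.

(** * Runs of a code *)

Section measurable_fibers.
Context d (X : measurableType d).

(* Measurability for maps into a set that carries no sigma-algebra. *)
Definition mfib (I : Type) (f : X -> I) := forall a, measurable (f @^-1` [set a]).

Lemma mfib_preimage (I : finType) (f : X -> I) (A : set I) :
  mfib f -> measurable (f @^-1` A).
Proof.
move=> mf; rewrite (_ : _ @^-1` _ = \bigcup_(i in A) f @^-1` [set i]); last first.
  by apply/seteqP; split=> [x Ax|x [i Ai /= ->]//]; exists (f x).
by apply: fin_bigcup_measurable => [|i _]; [exact: finite_finset|exact: mf].
Qed.

Lemma mfib_comp (I : finType) (J : Type) (f : X -> I) (g : I -> J) :
  mfib f -> mfib (fun x => g (f x)).
Proof. by move=> mf b; exact: (mfib_preimage (g @^-1` [set b]) mf). Qed.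

Lemma mfib_measurable (I : finType) d' (Y : measurableType d') (f : X -> I)
  (g : I -> Y) : mfib f -> measurable_fun setT (fun x => g (f x)).
Proof.
by move=> mf _ B mB; rewrite setTI; exact: (mfib_preimage (g @^-1` B) mf).
Qed.

Lemma mfib_cst (I : Type) (a : I) : mfib (fun _ : X => a).
Proof.
move=> b; have [->|ab] := pselect (a = b).
  by rewrite (_ : _ @^-1` _ = setT)//; apply/seteqP; split.
by rewrite (_ : _ @^-1` _ = set0)//; apply/seteqP; split.
Qed.

Lemma mfib_pair (I J : Type) (f : X -> I) (g : X -> J) :
  mfib f -> mfib g -> mfib (fun x => (f x, g x)).
Proof.
move=> mf mg [a b].
rewrite (_ : _ @^-1` _ = f @^-1` [set a] `&` g @^-1` [set b]); last first.
  by apply/seteqP; split=> x /=; [case=> -> ->|case=> -> ->].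
exact: measurableI.
Qed.

Lemma mfib_ffun (J : finType) (I : Type) (f : X -> J -> I) :
  (forall j, mfib (fun x => f x j)) -> mfib (fun x => [ffun j => f x j]).
Proof.
move=> mf F.
rewrite (_ : _ @^-1` _ = \bigcap_(j in setT) ((fun x => f x j) @^-1` [set F j])).
  by apply: fin_bigcap_measurable => [|j _]; [exact: finite_finset|exact: mf].
apply/seteqP; split=> x /= => [<- j _ /=|H]; first by rewrite ffunE.
by apply/ffunP => j; rewrite ffunE; exact: H.
Qed.

Lemma mfib_bool (b : X -> bool) : measurable_fun setT b -> mfib b.
Proof. by move=> mb a; rewrite -[X in measurable X]setTI; exact: mb. Qed.

End measurable_fibers.

Lemma mfib_meas_comp d d' (X : measurableType d) (Y : measurableType d')
    (I : Type) (f : X -> Y) (g : Y -> I) :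
  measurable_fun setT f -> mfib g -> mfib (fun x => g (f x)).
Proof.
by move=> mf mg a; rewrite -[X in measurable X]setTI; exact: (mf measurableT _ (mg a)).
Qed.

Section complex_measurability.
Context {R : realType} d (X : measurableType d).
Local Notation C := (R * R)%type.

Lemma measurable_cmul (a : C) (f : X -> C) :
  measurable_fun setT f -> measurable_fun setT (fun x => cmul a (f x)).
Proof.
move=> mf.
have m1 : measurable_fun setT (fun x => (f x).1).
  exact: (measurableT_comp measurable_fst mf).
have m2 : measurable_fun setT (fun x => (f x).2).
  exact: (measurableT_comp measurable_snd mf).
by apply: measurable_fun_pair; [apply: measurable_funB|apply: measurable_funD];
  exact: measurable_funM.
Qed.

Lemma measurable_csum (I : Type) (r : seq I) (Q : pred I) (f : I -> X -> C) :
  (forall i, Q i -> measurable_fun setT (f i)) ->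
  measurable_fun setT (fun x => \sum_(i <- r | Q i) f i x).
Proof.
move=> mf; elim: r => [|a r IH].
  rewrite (_ : (fun _ => _) = cst 0)//.
  by apply/funext => x; rewrite big_nil.
case Qa : (Q a); last first.
  rewrite (_ : (fun _ => _) = fun x => \sum_(i <- r | Q i) f i x)//.
  by apply/funext => x; rewrite big_cons Qa.
rewrite (_ : (fun _ => _) = fun x => f a x + \sum_(i <- r | Q i) f i x)//.
  by apply: measurable_cadd => //; exact: mf.
by apply/funext => x; rewrite big_cons Qa.
Qed.

End complex_measurability.

Section run.
Context {R : realType} {N : nat}.
Local Notation C := (R * R)%type.
Local Notation node := (node N).
Variables (h : node -> node -> C) (n M : nat) (c : Defs.code R N n M).

Definition measurable_code :=
  [/\ forall i t, is_relay i -> mfib (rel_st c i (t := t)),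
      forall i t, is_relay i -> measurable_fun setT (rel_x c i (t := t)),
      forall t, mfib (dst_st c (t := t)) & mfib (Defs.decode c)].

Lemma admissible_measurable m P : admissible m P h c -> measurable_code.
Proof.
by case=> _ A1 A2 A3 _; split => // i t r; have [] := A1 i t r.
Qed.

Variable w : 'I_M.

Lemma hist_dep t (z z' : nat -> node -> C) :
  (forall s j, (s < t)%N -> z s j = z' s j) -> hist h c w z t = hist h c w z' t.
Proof.
elim: t => //= t IH zz'; rewrite IH => [|s j st]; last first.
  by apply: zz'; exact: ltnW.
by apply/funext => j; congr rcons_tuple; rewrite /recv zz'.
Qed.

Hypothesis mc : measurable_code.
Local Notation K := (noise_dim N n).

Lemma measurable_noise_of t j :
  measurable_fun setT (fun z : K.-tuple C => noise_of z t j).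
Proof.
rewrite /noise_of; case: insub => [t'|]; last exact: measurable_cst.
exact: measurable_tnth.
Qed.

Lemma tnth_rcons_tuple (T : Type) t (s : t.-tuple T) x i :
  tnth (rcons_tuple s x) i = if unlift ord_max i is Some i' then tnth s i' else x.
Proof.
case: unliftP => [i'|] ->.
  rewrite !(tnth_nth x)/= nth_rcons size_tuple.
  by rewrite (_ : bump t i' = i') ?ltn_ord//; exact: (lift_max i').
by rewrite (tnth_nth x)/= nth_rcons size_tuple ltnn eqxx.
Qed.

Lemma mfib_node_st_of t (H : K.-tuple C -> node -> t.-tuple C) i :
  (forall j, measurable_fun setT (H ^~ j)) ->
  mfib (fun z => node_st c w (H z) i).
Proof.
move=> mH; have [mr _ md _] := mc; rewrite /node_st.
have [i0|i0] := eqVneq i (src N); first exact: mfib_cst.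
have [i1|i1] := eqVneq i (dst N).
  by apply: mfib_pair; [exact: mfib_cst|exact: (mfib_meas_comp (mH _) (md t))].
apply: (mfib_meas_comp (mH i) (mr _ _ _)).
by rewrite /is_relay i0 i1.
Qed.

Lemma measurable_node_x_of t (H : K.-tuple C -> node -> t.-tuple C) i :
  (forall j, measurable_fun setT (H ^~ j)) ->
  measurable_fun setT (fun z => node_x c w (H z) i).
Proof.
move=> mH; have [_ mr _ _] := mc; rewrite /node_x.
have [i0|i0] := eqVneq i (src N); first exact: measurable_cst.
have [i1|i1] := eqVneq i (dst N); first exact: measurable_cst.
apply: (measurableT_comp (mr _ _ _) (mH i)).
by rewrite /is_relay i0 i1.
Qed.

Lemma mfib_if d (X : measurableType d) d' (Y : measurableType d') (b : X -> bool)
    (f g : X -> Y) : mfib b -> measurable_fun setT f -> measurable_fun setT g ->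
  measurable_fun setT (fun x => if b x then f x else g x).
Proof.
move=> mb mf mg; apply: measurable_fun_ifT => //.
by apply: (measurable_fun_bool true); rewrite setTI; exact: mb.
Qed.

Lemma measurable_recv_of t (H : K.-tuple C -> node -> t.-tuple C) j :
  (forall j, measurable_fun setT (H ^~ j)) ->
  measurable_fun setT (fun z => recv h c w (noise_of z) (H z) j).
Proof.
move=> mH; rewrite /recv; apply: measurable_cadd; first exact: measurable_noise_of.
apply: measurable_csum => i _.
apply: mfib_if; last exact: measurable_cst.
- apply: (mfib_comp (f := fun z => (node_st c w (H z) i, node_st c w (H z) j))
    (fun p => active p.1 p.2 i j)).
  by apply: mfib_pair; exact: mfib_node_st_of.
- by apply: measurable_cmul; exact: measurable_node_x_of.
Qed.

Lemma measurable_hist t j :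
  measurable_fun setT (fun z : K.-tuple C => hist h c w (noise_of z) t j).
Proof.
elim: t j => [|t IH] j; first exact: measurable_cst.
apply/measurable_fun_tnthP => i /=.
rewrite (_ : _ \o _ = fun z => if unlift ord_max i is Some i'
    then tnth (hist h c w (noise_of z) t j) i'
    else recv h c w (noise_of z) (hist h c w (noise_of z) t) j); last first.
  by apply/funext => z /=; rewrite tnth_rcons_tuple.
case: unlift => [i'|]; first exact: measurable_tnth_comp.
exact: measurable_recv_of.
Qed.

Definition run_st t (z : nat -> node -> C) (i : node) : lstate N :=
  node_st c w (hist h c w z t) i.

Lemma mfib_run_st t i : mfib (fun z : K.-tuple C => run_st t (noise_of z) i).
Proof. by apply: mfib_node_st_of => j; exact: measurable_hist. Qed.

Lemma measurable_input_at t i :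
  measurable_fun setT (fun z : K.-tuple C => input_at h c w (noise_of z) t i).
Proof. by apply: measurable_node_x_of => j; exact: measurable_hist. Qed.

Lemma mfib_decoded : mfib (fun z : K.-tuple C => decoded h c w (noise_of z)).
Proof.
have [_ _ _ md] := mc.
exact: (@mfib_meas_comp _ _ _ _ _ (fun z : K.-tuple C =>
  hist h c w (noise_of z) n (dst N)) _ (@measurable_hist n (dst N)) md).
Qed.

Lemma noise_of_dep t (z z' : K.-tuple C) :
  (forall (s : 'I_n) j, (s < t)%N ->
     tnth z (enum_rank (s, j)) = tnth z' (enum_rank (s, j))) ->
  hist h c w (noise_of z) t = hist h c w (noise_of z') t.
Proof.
move=> zz'; apply: hist_dep => s j st; rewrite /noise_of.
by case: insubP => // s' _ s'E; apply: zz'; rewrite s'E.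
Qed.

End run.

Lemma index_allpairs (S T : eqType) (s : seq S) (t : seq T) x y :
  x \in s -> y \in t ->
  index (x, y) [seq (a, b) | a <- s, b <- t] =
    (index x s * size t + index y t)%N.
Proof.
elim: s => //= a s IH; rewrite inE => xs yt.
rewrite index_cat.
have -> : ((x, y) \in [seq (a, b) | b <- t]) = (x == a).
  apply/mapP/eqP => [[b _ [-> _]]//|->]; by exists y.
rewrite eq_sym; case: eqVneq xs => [-> _|ax /= xs].
  by rewrite mul0n add0n index_map// => ? ? [].
by rewrite IH// size_map mulSn addnA.
Qed.

Section noise_order.
Context {R : realType} {N : nat}.
Local Notation C := (R * R)%type.
Local Notation node := (node N).

(** The enumeration of ['I_n * node] is lexicographic with time in front. Hence causality in time
    becomes dependence on smaller indices, the form in which the lemmas on tuples express it. *)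
Lemma enum_rank_ltn (n : nat) (s t : 'I_n) (i j : node) :
  (s < t)%N -> (enum_rank (s, i) < enum_rank (t, j))%N.
Proof.
have E : enum {: 'I_n * node} =
    [seq (s, i) | s <- enum 'I_n, i <- enum node].
  by rewrite enumT unlock /= /prod_enum.
have rE (s' : 'I_n) (i' : node) : enum_rank (s', i') = (s' * size (enum node) + index i' (enum node))%N :> nat.
  transitivity (index (s', i') (enum {: 'I_n * node})).
    by rewrite -[in RHS](nth_enum_rank (s', i') (s', i')) index_uniq ?enum_uniq// -cardE.
  by rewrite E index_allpairs ?mem_enum// index_enum_ord.
move=> st; rewrite !rE.
have : (index i (enum node) < size (enum node))%N by rewrite index_mem mem_enum.
move=> ii; apply: (@leq_trans (s.+1 * size (enum node))).
  by rewrite mulSn addnC ltn_add2r.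
by apply: leq_trans (leq_addr _ _); rewrite leq_mul2r st orbT.
Qed.

Lemma Enoise_tprob n (f : (nat -> node -> C) -> \bar R) :
  measurable_fun setT (fun z : (noise_dim N n).-tuple C => f (noise_of z)) ->
  (forall z, 0 <= f z)%E ->
  Enoise n f = (\int[tprob gam (noise_dim N n)]_z f (noise_of z))%E.
Proof. by move=> mf f0; rewrite /Enoise Egauss_tprob. Qed.

End noise_order.

(** * Upper bound *)

Section reference.
Context {R : realType} {N : nat}.
Local Notation C := (R * R)%type.
Local Notation node := (node N).
Variables (P : R) (h : node -> node -> C) (n M : nat) (c : Defs.code R N n M).
Variable Om : {set node}.
Hypotheses (P0 : 0 <= P) (Omcut : is_cut Om).
Local Notation K := (noise_dim N n).

Definition gain (j i : node) : R := 1 + P * cnorm2 (h j i).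

Lemma gain_ge1 j i : 1 <= gain j i.
Proof. by rewrite lerDl mulr_ge0// cnorm2_ge0. Qed.

Lemma gain_gt0 j i : 0 < gain j i.
Proof. exact: lt_le_trans ltr01 (gain_ge1 j i). Qed.

(** The receive beam of [j] points to at most one node, so at most one signal from [Om] reaches [j];
    the [option] records its sender. *)
Definition cross (st : node -> lstate N) (j : node) : option node :=
  if (st j).2 is Some i then
    if (i \in Om) && ((st i).1 == Some j) then Some i else None
  else None.

Lemma cross_sum (V : nmodType) st j (F : node -> V) :
  \sum_(i in Om) (if active (st i) (st j) i j then F i else 0) =
  oapp F 0 (cross st j).
Proof.
rewrite /cross /active; case: (st j).2 => [i|]; last first.
  by rewrite big1// => i _; rewrite andbF.
have [iOm|iOm]/= := boolP (i \in Om); last first.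
  rewrite big1// => i' i'Om; case: ifP => // /andP[_ /eqP[ii']].
  by rewrite -ii' (negbTE iOm) in i'Om *.
rewrite (bigD1 i)//= eqxx andbT big1 ?addr0; first by case: ifP.
move=> i' /andP[_ i'i]; case: ifP => // /andP[_ /eqP[ii']].
by rewrite ii' eqxx in i'i.
Qed.

(* The density of CN(0, gain) with respect to CN(0, 1), at the outputs that
   listen across the cut. *)
Definition wgt (st : node -> lstate N) (j : node) (u : C) : R :=
  if j \in Om then 1 else
  oapp (fun i => (gain j i)^-1 * expR ((1 - (gain j i)^-1) * cnorm2 u)) 1
    (cross st j).

Lemma wgt_ge0 st j u : 0 <= wgt st j u.
Proof.
rewrite /wgt; case: ifP => // _; case: cross => //= i.
by rewrite mulr_ge0 ?expR_ge0// invr_ge0 ltW// gain_gt0.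
Qed.

Lemma measurable_wgt d (X : measurableType d) (st : X -> node -> lstate N) j
    (u : X -> C) : (forall i, mfib (fun x => st x i)) -> measurable_fun setT u ->
  measurable_fun setT (fun x => wgt (st x) j (u x)).
Proof.
move=> mst mu; rewrite /wgt; case: (j \in Om); first exact: measurable_cst.
have mcr : mfib (fun x => cross (st x) j).
  have := @mfib_ffun _ _ node _ st mst.
  move=> /(mfib_comp (fun f : {ffun node -> lstate N} => cross f j)).
  rewrite (_ : (fun x => _) = (fun x => cross (st x) j))//.
  by apply/funext => x; congr cross; apply/funext => i; rewrite ffunE.
pose F (o : option node) x : R := oapp (fun i => (gain j i)^-1 *
  expR ((1 - (gain j i)^-1) * cnorm2 (u x))) 1 o.
have mF o : measurable_fun setT (F o).
  case: o => [i|]; last exact: measurable_cst.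
  apply: measurable_funM => //; apply: measurableT_comp => //.
  apply: measurable_funM => //; apply: measurableT_comp => //.
  exact: measurable_cnorm2.
rewrite (_ : (fun x => _) = fun x => \sum_(o : option node)
   (if cross (st x) j == o then F o x else 0)).
  apply: measurable_sum => o; apply: mfib_if => //.
  exact: (mfib_comp (fun o' => o' == o) mcr).
apply/funext => x; rewrite (bigD1 (cross (st x) j))//= eqxx big1 ?addr0//.
by move=> o; rewrite eq_sym => /negbTE ->.
Qed.

(** The integral is in fact 1; for an output that listens across the cut this is [gam_expR] at
    [(gain j i)^-1 - 1], which is at most 0. *)
Lemma wgt_int st j : (\int[gam]_u (wgt st j u)%:E <= 1)%E.
Proof.
rewrite /wgt; case: (j \in Om); first by rewrite integral_prob_cst.
case: cross => [i|] /=; last by rewrite integral_prob_cst.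
have D0 : 0 < 1 + - (1 - (gain j i)^-1) * 1 ^+ 2.
  by rewrite expr1n mulr1 opprB addrC subrK invr_gt0 gain_gt0.
have := gam_expR (0 : C) D0; under eq_integral do rewrite cmul1 addr0 opprK.
rewrite {2}/cnorm2/= expr0n/= addr0 mulr0 mul0r expR0 mulr1 expr1n mulr1.
rewrite (_ : 1 + - (1 - (gain j i)^-1) = (gain j i)^-1) ?invrK => [E|]; last by ring.
under eq_integral do rewrite EFinM.
rewrite ge0_integralZl//.
- by rewrite E -EFinM mulVf// gt_eqF// gain_gt0.
- apply: measurable_expR_norm; apply: measurable_funM => //.
  exact: measurable_cnorm2.
- by rewrite lee_fin invr_ge0 ltW// gain_gt0.
Qed.

Definition seq_state (sq : {ffun 'I_n -> state N}) (t : nat) : state N :=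
  if (insub t : option 'I_n) is Some t' then sq t' else [ffun=> (None, None)].

(* With the states in [Om] prescribed, a run no longer depends on the message, so
   that a change of measure towards it decouples the decoder from the message. *)
Definition refc (sq : {ffun 'I_n -> state N}) : Defs.code R N n M :=
  Code (fun _ t => seq_state sq t (src N)) (fun _ _ => 0)
    (fun i t y => if i \in Om then seq_state sq t i else rel_st c i y)
    (fun i t y => if i \in Om then 0 else rel_x c i y)
    (fun t => @dst_st _ _ _ _ c t) (Defs.decode c).

Hypothesis mc : measurable_code c.

Lemma measurable_refc sq : measurable_code (refc sq).
Proof.
have [m1 m2 m3 m4] := mc; split => // i t ir /=.
- by case: (i \in Om); [exact: mfib_cst|exact: m1].
- by case: (i \in Om); [exact: measurable_cst|exact: m2].
Qed.

(** Here [z] stands for the noise to which the signals across the cut have been added, and [rho]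
    reweights its law so that the outputs listening across the cut become [CN(0, gain)]. The total
    mass stays at most 1 because the state that selects the variance of a coordinate depends on
    earlier coordinates only. *)
Definition rho sq (w : 'I_M) (z : K.-tuple C) : R :=
  \prod_(k < K) wgt (run_st h (refc sq) w (enum_val k).1 (noise_of z))
    (enum_val k).2 (tnth z k).

Lemma rho_ge0 sq w z : 0 <= rho sq w z.
Proof. by apply: prodr_ge0 => k _; exact: wgt_ge0. Qed.

Lemma measurable_rho sq w : measurable_fun setT (rho sq w).
Proof.
apply: measurable_prod => k _; apply: measurable_wgt; last exact: measurable_tnth.
by move=> i; apply: mfib_run_st; exact: measurable_refc.
Qed.

Lemma enum_rank_ltn_val (k : 'I_K) (s : 'I_n) (j : node) :
  (s < (enum_val k).1)%N -> (enum_rank (s, j) < k)%N.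
Proof.
move=> sk; apply: leq_trans (enum_rank_ltn j (enum_val k).2 sk) _.
by rewrite -surjective_pairing enum_valK.
Qed.

Lemma run_st_dep (c' : Defs.code R N n M) w (k : 'I_K) (z z' : K.-tuple C) :
  (forall j : 'I_K, (j < k)%N -> tnth z j = tnth z' j) ->
  run_st h c' w (enum_val k).1 (noise_of z) = run_st h c' w (enum_val k).1 (noise_of z').
Proof.
move=> zz'; apply/funext => i; rewrite /run_st; congr node_st.
apply: noise_of_dep => s j sk; apply: zz'.
exact: enum_rank_ltn_val.
Qed.

Lemma rho_int sq w : (\int[tprob gam K]_z (rho sq w z)%:E <= 1)%E.
Proof.
under eq_integral do rewrite /rho -prodEFin.
apply: tprob_causal_prod_le1.
- move=> k; apply/measurable_EFinP; apply: measurable_wgt; last exact: measurable_tnth.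
  by move=> i; apply: mfib_run_st; exact: measurable_refc.
- by move=> k z; rewrite lee_fin wgt_ge0.
- move=> k z z' zz'; rewrite (zz' k)//; congr (wgt _ _ _)%:E.
  by apply: run_st_dep => j /ltnW; exact: zz'.
- move=> k z.
  rewrite (eq_integral (fun u => (wgt (run_st h (refc sq) w (enum_val k).1
     (noise_of z)) (enum_val k).2 u)%:E)); first exact: wgt_int.
  move=> u _; rewrite tnth_tset eqxx; congr (wgt _ _ _)%:E.
  by apply: run_st_dep => j jk; rewrite tnth_tset -val_eqE ltn_eqF.
Qed.

End reference.

(** * Comparison of a run with its reference run *)

Section change_of_measure.
Context {R : realType} {N : nat}.
Local Notation C := (R * R)%type.
Local Notation node := (node N).
Variables (m : mode) (P : R) (h : node -> node -> C) (n M : nat).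
Variables (c : Defs.code R N n M) (Om : {set node}) (w : 'I_M).
Hypotheses (P0 : 0 <= P) (Omcut : is_cut Om).
Hypothesis mc : measurable_code c.
Local Notation K := (noise_dim N n).

Let crossk (z : K.-tuple C) (k : 'I_K) : option node :=
  if (enum_val k).2 \in Om then None else
  cross Om (run_st h c w (enum_val k).1 (noise_of z)) (enum_val k).2.

(** What [Om] contributes to the output with index [k], taken as 0 when the receiver lies in [Om].
    It depends on strictly earlier noise, so adding it to the noise is a causal shift. *)
Definition drift (k : 'I_K) (z : K.-tuple C) : C :=
  oapp (fun i => cmul (h (enum_val k).2 i)
    (input_at h c w (noise_of z) (enum_val k).1 i)) 0 (crossk z k).

(* [infoB - infoA] is the logarithm of [wgt * expR (|z|^2 - |z + drift|^2)], kept as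
   two nonnegative terms. *)
Definition infoA (z : K.-tuple C) (k : 'I_K) : R :=
  oapp (fun i => ln (gain P h (enum_val k).2 i) +
    cnorm2 (tnth z k + drift k z) / gain P h (enum_val k).2 i) 0 (crossk z k).

Definition infoB (z : K.-tuple C) (k : 'I_K) : R :=
  oapp (fun=> cnorm2 (tnth z k)) 0 (crossk z k).

Lemma mfib_crossk k : mfib (crossk ^~ k).
Proof.
rewrite /crossk; case: (_ \in Om); first exact: mfib_cst.
have := @mfib_ffun _ _ node _ _ (fun i => mfib_run_st h w mc (enum_val k).1 i).
move=> /(mfib_comp (fun f : {ffun node -> lstate N} => cross Om f (enum_val k).2)).
rewrite (_ : (fun x => _) = (fun z => cross Om
  (run_st h c w (enum_val k).1 (noise_of z)) (enum_val k).2))//.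
by apply/funext => x; congr cross; apply/funext => i; rewrite ffunE.
Qed.

Lemma measurable_oapp d (X : measurableType d) d' (Y : measurableType d')
    (o : X -> option node) (F : node -> X -> Y) (y : Y) :
  mfib o -> (forall i, measurable_fun setT (F i)) ->
  measurable_fun setT (fun x => oapp (F ^~ x) y (o x)).
Proof.
move=> mo mF.
have mo' A : measurable (o @^-1` A) by exact: mfib_preimage.
move=> _ B mB; rewrite setTI.
rewrite (_ : _ @^-1` _ = \bigcup_(a in setT)
   (o @^-1` [set a] `&` (oapp F (cst y) a) @^-1` B)).
  apply: fin_bigcup_measurable; first exact: finite_finset.
  move=> a _; apply: measurableI => //; rewrite -[X in measurable X]setTI.
  by case: a => [i|]; [exact: mF|exact: measurable_cst].
apply/seteqP; split=> [x /= xB|x [a _ [/= <-]]].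
  by exists (o x) => //; split => //=; case: (o x) xB.
by case: (o x).
Qed.

Lemma measurable_drift k : measurable_fun setT (drift k).
Proof.
apply: (measurable_oapp (F := fun i z => cmul (h (enum_val k).2 i)
    (input_at h c w (noise_of z) (enum_val k).1 i))); first exact: mfib_crossk.
by move=> i; apply: measurable_cmul; exact: measurable_input_at.
Qed.

Lemma measurable_infoA k : measurable_fun setT (infoA ^~ k).
Proof.
apply: (@measurable_oapp _ _ _ R (crossk ^~ k) (fun i z => ln (gain P h (enum_val k).2 i) +
    cnorm2 (tnth z k + drift k z) / gain P h (enum_val k).2 i) 0); first exact: mfib_crossk.
move=> i; apply: measurable_funD => //; apply: measurable_funM => //.
apply: measurableT_comp; first exact: measurable_cnorm2.
by apply: measurable_cadd; [exact: measurable_tnth|exact: measurable_drift].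
Qed.

Lemma measurable_infoB k : measurable_fun setT (infoB ^~ k).
Proof.
apply: (@measurable_oapp _ _ _ R (crossk ^~ k) (fun=> fun z => cnorm2 (tnth z k)) 0);
  first exact: mfib_crossk.
move=> i; apply: measurableT_comp; first exact: measurable_cnorm2.
exact: measurable_tnth.
Qed.

Lemma infoA_ge0 z k : 0 <= infoA z k.
Proof.
rewrite /infoA; case: crossk => //= i; apply: addr_ge0.
  by apply: ln_ge0; exact: gain_ge1.
by apply: divr_ge0; [exact: cnorm2_ge0|apply: ltW; exact: gain_gt0].
Qed.

Lemma infoB_ge0 z k : 0 <= infoB z k.
Proof. by rewrite /infoB; case: crossk => //= i; exact: cnorm2_ge0. Qed.

Lemma drift_dep (k : 'I_K) (z z' : K.-tuple C) :
  (forall j : 'I_K, (j < k)%N -> tnth z j = tnth z' j) -> drift k z = drift k z'.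
Proof.
move=> zz'; rewrite /drift /crossk (run_st_dep h c w zz').
case: ifP => // _; case: cross => //= i; congr cmul; rewrite /input_at.
congr node_x; apply: noise_of_dep => s j sk; apply: zz'.
exact: enum_rank_ltn_val.
Qed.

Definition run_states (z : K.-tuple C) : {ffun 'I_n -> state N} :=
  [ffun t : 'I_n => [ffun i => run_st h c w t (noise_of z) i]].

Lemma noise_ofE (z : K.-tuple C) (t : 'I_n) j :
  noise_of z t j = tnth z (enum_rank (t, j)).
Proof. by rewrite /noise_of valK. Qed.

Lemma node_st_ref z w0 t (H : node -> t.-tuple C) i : (t < n)%N ->
  (forall i, i \notin Om -> H i = hist h c w (noise_of z) t i) ->
  node_st (refc c Om (run_states z)) w0 H i =
  node_st c w (hist h c w (noise_of z) t) i.
Proof.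
have /andP[srcOm dstOm] := Omcut => tn HE.
rewrite /node_st/= /seq_state (insubT (fun x => x < n)%N tn)/= !ffunE/= /run_st.
case: eqP => [_|/eqP isrc]; first by rewrite /node_st eqxx.
case: eqP => [_|/eqP idst]; first by rewrite HE.
have [iOm|iOm] := boolP (i \in Om); last by rewrite HE.
by rewrite /node_st (negbTE isrc) (negbTE idst).
Qed.

Lemma cmul0r (a : C) : cmul a 0 = 0.
Proof. by rewrite /cmul/= !mulr0 subr0 addr0. Qed.

Lemma node_x_ref_in sq w0 t (H : node -> t.-tuple C) i : i \in Om ->
  node_x (refc c Om sq) w0 H i = 0.
Proof. by move=> iOm; rewrite /node_x/= iOm !if_same. Qed.

Lemma node_x_ref_out sq w0 t (H H' : node -> t.-tuple C) i : i \notin Om ->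
  H i = H' i -> node_x (refc c Om sq) w0 H i = node_x c w H' i.
Proof.
have /andP[srcOm dstOm] := Omcut => iOm HH.
rewrite /node_x/= (negbTE iOm) HH.
by have -> : i == src N = false by apply: contraNF iOm => /eqP ->.
Qed.

(** The shift adds to the noise of each node outside [Om] exactly what the silenced nodes of [Om]
    would have sent to it, and the prescribed states are those of the actual run. By induction on
    time the nodes outside [Om] see the same outputs in both runs. Histories inside [Om] may differ,
    but [refc] ignores them, and it ignores the message [w0] as well. *)
Lemma hist_ref w0 z t j : (t <= n)%N -> j \notin Om ->
  hist h (refc c Om (run_states z)) w0 (noise_of (tshift drift z)) t j =
  hist h c w (noise_of z) t j.
Proof.
have /andP[srcOm dstOm] := Omcut.
elim: t j => [|t IH] j tn jOm; first by [].
rewrite /=.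
set Hr := hist h (refc _ _ _) w0 _ t; set Hc := hist h c w _ t.
have HE i : i \notin Om -> Hr i = Hc i by move=> iOm; apply: IH => //; exact: ltnW.
rewrite (HE j jOm); congr rcons_tuple.
have stE i : node_st (refc c Om (run_states z)) w0 Hr i = node_st c w Hc i.
  exact: node_st_ref.
rewrite /recv.
rewrite -[t]/(val (Ordinal tn)) !noise_ofE tnth_mktuple -addrA; congr (_ + _).
rewrite /drift /crossk enum_rankK/= (negbTE jOm) -cross_sum.
under [X in X + _]eq_bigr do rewrite /run_st -/Hc.
rewrite [X in _ + X = _](bigID (mem Om))/= [RHS](bigID (mem Om))/=.
rewrite [X in _ + (X + _)]big1 ?add0r; last first.
  by move=> i /andP[_ iOm]; rewrite node_x_ref_in// cmul0r if_same.
congr (_ + _); last first.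
  by apply: eq_bigr => i /andP[_ iOm]; rewrite !stE (node_x_ref_out _ _ iOm (HE i iOm)).
apply: eq_bigl => i; have [iOm|] := boolP (i \in Om); last by rewrite andbF.
rewrite !andbT; apply/esym/andP; split.
  by apply: contraNneq jOm => <-.
by apply: contraNneq dstOm => <-.
Qed.


End change_of_measure.

Lemma measurable_sum_cond {R : realType} d (X : measurableType d) (I : finType)
    (A : pred I) (f : I -> X -> R) :
  (forall i, A i -> measurable_fun setT (f i)) ->
  measurable_fun setT (fun x => \sum_(i | A i) f i x).
Proof.
move=> mf; under eq_fun do rewrite big_mkcond.
apply: measurable_sum => i; case Ai : (A i); first exact: mf.
exact: measurable_cst.
Qed.

Section integral_helpers.
Context {R : realType} d (X : measurableType d) (Q : probability X R).
Local Open Scope ereal_scope.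

Lemma ge0_int_sum (I : finType) (A : pred I) (f : I -> X -> R) :
  (forall i, A i -> measurable_fun setT (f i)) ->
  (forall i x, A i -> (0 <= f i x)%R) ->
  \int[Q]_x (\sum_(i | A i) f i x)%:E = \sum_(i | A i) \int[Q]_x (f i x)%:E.
Proof.
move=> mf f0.
transitivity (\int[Q]_x (\sum_(i <- [seq i <- index_enum I | A i])
   (if A i then f i x else 0)%:E)).
  apply: eq_integral => x _; rewrite -sumEFin big_filter.
  by apply: eq_bigr => i ->.
rewrite ge0_integral_sum//.
- rewrite big_filter; apply: eq_bigr => i Ai.
  by apply: eq_integral => x _; rewrite Ai.
- move=> i; apply/measurable_EFinP; case Ai : (A i); first exact: mf.
  exact: measurable_cst.
- by move=> i x _; rewrite lee_fin; case: ifP => // Ai; exact: f0.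
Qed.

Lemma ge0_intZl (f : X -> R) (k : R) : measurable_fun setT f ->
  (forall x, (0 <= f x)%R) -> (0 <= k)%R ->
  \int[Q]_x (k * f x)%:E = k%:E * \int[Q]_x (f x)%:E.
Proof.
move=> mf f0 k0; rewrite -ge0_integralZl//.
- exact/measurable_EFinP.
- by move=> x _; rewrite lee_fin.
Qed.

Lemma ge0_intD (f g : X -> R) : measurable_fun setT f -> measurable_fun setT g ->
  (forall x, (0 <= f x)%R) -> (forall x, (0 <= g x)%R) ->
  \int[Q]_x (f x + g x)%:E = \int[Q]_x (f x)%:E + \int[Q]_x (g x)%:E.
Proof.
move=> mf mg f0 g0; rewrite -ge0_integralD//.
- by move=> x _; rewrite lee_fin.
- exact/measurable_EFinP.
- by move=> x _; rewrite lee_fin.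
- exact/measurable_EFinP.
Qed.

Lemma ge0_int_le (f g : X -> R) : measurable_fun setT f -> measurable_fun setT g ->
  (forall x, (0 <= f x)%R) -> (forall x, (f x <= g x)%R) ->
  \int[Q]_x (f x)%:E <= \int[Q]_x (g x)%:E.
Proof.
move=> mf mg f0 fg; apply: ge0_le_integral => //.
- by move=> x _; rewrite lee_fin.
- exact/measurable_EFinP.
- exact/measurable_EFinP.
- by move=> x _; rewrite lee_fin.
Qed.

End integral_helpers.

Section probability_of_event.
Context {R : realType} d (X : measurableType d) (Q : probability X R).
Local Open Scope ereal_scope.

Definition Pr (b : X -> bool) : R := fine (\int[Q]_x ((b x)%:R)%:E).

Lemma measurable_indicb (b : X -> bool) :
  mfib b -> measurable_fun setT (fun x => ((b x)%:R)%:E : \bar R).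
Proof.
by move=> mb; apply/measurable_EFinP;
  exact: (mfib_measurable (fun a : bool => a%:R : R) mb).
Qed.

Lemma PrE (b : X -> bool) : mfib b -> \int[Q]_x ((b x)%:R)%:E = (Pr b)%:E.
Proof.
move=> mb; rewrite /Pr fineK// ge0_fin_numE; last exact: integral_ge0.
apply: (@le_lt_trans _ _ (\int[Q]_x 1%:E)).
  apply: ge0_le_integral => //; first exact: measurable_indicb.
  by move=> x _; rewrite lee_fin; case: (b x).
by rewrite integral_prob_cst// ltry.
Qed.

Lemma Pr_ge0 b : (0 <= Pr b)%R.
Proof. by rewrite fine_ge0// integral_ge0. Qed.

Lemma Pr_sum (I : finType) (A : {pred I}) (f : I -> X -> bool) (b : X -> bool) :
  mfib b -> (forall i, mfib (f i)) ->
  (forall x, ((b x)%:R = \sum_(i in A) (f i x)%:R :> R)%R) ->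
  (Pr b = \sum_(i in A) Pr (f i))%R.
Proof.
move=> mb mf bE; apply: EFin_inj; rewrite -PrE// -sumEFin.
under [RHS]eq_bigr do rewrite -PrE//.
rewrite -(@ge0_int_sum _ _ _ Q _ (mem A) (fun i x => (f i x)%:R%R))//.
- by apply: eq_integral => x _; rewrite bE.
- by move=> i _; exact: (mfib_measurable (fun a : bool => a%:R%R : R)).
Qed.

End probability_of_event.

Section change_of_measure_bound.
Context {R : realType} {N : nat}.
Local Notation C := (R * R)%type.
Local Notation node := (node N).
Variables (m : mode) (P : R) (h : node -> node -> C) (n M : nat).
Variables (c : Defs.code R N n M) (Om : {set node}).
Hypotheses (P0 : 0 <= P) (Omcut : is_cut Om).
Hypothesis mc : measurable_code c.
Local Notation K := (noise_dim N n).

Definition llr w z : R := \sum_(k < K) (infoB h c Om w z k - infoA P h c Om w z k).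

Lemma measurable_llr w : measurable_fun setT (llr w).
Proof.
apply: measurable_sum => k; apply: measurable_funB.
  exact: measurable_infoB.
exact: measurable_infoA.
Qed.

Lemma expR_llr w z : let v := tshift (drift h c Om w) z in
  expR (llr w z) = (\prod_(k < K) wgt P h Om
     (run_st h c w (enum_val k).1 (noise_of z)) (enum_val k).2 (tnth v k)) *
   expR (\sum_(k < K) (cnorm2 (tnth z k) - cnorm2 (tnth v k))).
Proof.
move=> v; rewrite /llr !expR_sum -big_split/=; apply: eq_bigr => k _.
rewrite /v tnth_mktuple /infoA /infoB /drift /wgt.
case: (_ \in Om) => /=; first by rewrite addr0 subr0 subrr mul1r.
case: cross => [i|] /=; last by rewrite addr0 subr0 subrr mul1r.
set g := gain P h _ i.
have g0 : 0 < g by exact: gain_gt0.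
have -> : g^-1 = expR (- ln g) by rewrite expRN lnK.
by rewrite -!expRD expRN lnK//; congr expR; ring.
Qed.

Definition valid_seqs : {set {ffun 'I_n -> state N}} :=
  [set sq : {ffun 'I_n -> state N} | [forall t, valid_state m (sq t)]]%SET.

Hypothesis valid_run : forall w z, run_states h c w z \in valid_seqs.

Lemma run_st_ref w w0 z (t : 'I_n) :
  run_st h (refc c Om (run_states h c w z)) w0 t
     (noise_of (tshift (drift h c Om w) z)) =
  run_st h c w t (noise_of z).
Proof.
apply/funext => i; apply: node_st_ref => // i' i'Om.
by apply: hist_ref => //; exact: ltnW.
Qed.

Lemma decoded_ref w w0 z :
  decoded h (refc c Om (run_states h c w z)) w0
     (noise_of (tshift (drift h c Om w) z)) =
  decoded h c w (noise_of z).
Proof. by rewrite /decoded hist_ref//; case/andP: Omcut. Qed.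

(** [expR (llr w z)] is [rho] at the shifted noise, for the realised state sequence, times the
    Girsanov weight. That sequence depends on [z]; once it is replaced by a sum over all valid
    sequences, [tprob_girsanov] removes the shift from each term. *)
Lemma int_llr_le (D : pred 'I_M) w w0 :
  (\int[tprob gam K]_z ((D (decoded h c w (noise_of z)))%:R * expR (llr w z))%:E <=
   \sum_(sq in valid_seqs) \int[tprob gam K]_v
     ((D (decoded h (refc c Om sq) w0 (noise_of v)))%:R * rho P h c Om sq w0 v)%:E)%E.
Proof.
pose dr := drift h c Om w.
have mdr k : measurable_fun setT (dr k) by exact: measurable_drift.
pose F sq (v : K.-tuple C) : R :=
  (D (decoded h (refc c Om sq) w0 (noise_of v)))%:R * rho P h c Om sq w0 v.
have F0 sq v : 0 <= F sq v by rewrite mulr_ge0// rho_ge0.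
have mF sq : measurable_fun setT (F sq).
  apply: measurable_funM; last exact: measurable_rho.
  apply: (mfib_measurable (fun i => (D i)%:R : R)).
  by apply: mfib_decoded; exact: measurable_refc.
pose g z := expR (\sum_(k < K) (cnorm2 (tnth z k) - cnorm2 (tnth (tshift dr z) k))).
have mg : measurable_fun setT g.
  apply: (measurableT_comp (@measurable_expR R)); apply: measurable_sum => k.
  apply: measurable_funB.
    by apply: measurableT_comp (measurable_tnth k); exact: measurable_cnorm2.
  apply: measurableT_comp; first exact: measurable_cnorm2.
  by apply: measurable_tnth_comp; exact: measurable_tshift.
have mFs sq : measurable_fun setT (fun z => F sq (tshift dr z)).
  by apply: measurableT_comp => //; exact: measurable_tshift.
rewrite (eq_bigr (fun sq => \int[tprob gam K]_z (g z * F sq (tshift dr z))%:E)%E);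
    last first.
  move=> sq _; rewrite -(tprob_girsanov mdr _ (F := fun v => (F sq v)%:E)).
  - by apply: eq_integral => z _; rewrite -EFinM.
  - by move=> k z z' zz'; exact: drift_dep.
  - exact/measurable_EFinP.
  - by move=> z; rewrite lee_fin.
rewrite -ge0_int_sum; last 2 first.
- by move=> sq _; exact: measurable_funM.
- by move=> sq z _; rewrite mulr_ge0// expR_ge0.
apply: ge0_int_le.
- apply: measurable_funM; last first.
    by apply: measurableT_comp => //; exact: measurable_llr.
  by apply: (mfib_measurable (fun i => (D i)%:R : R)); exact: mfib_decoded.
- by apply: measurable_sum_cond => sq _; exact: measurable_funM.
- by move=> z; rewrite mulr_ge0// expR_ge0.
(* Of the sum over state sequences only the realised one is kept. *)
move=> z; rewrite (bigD1 (run_states h c w z))//=.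
rewrite -[leLHS]addr0 lerD//; last first.
  by apply: sumr_ge0 => sq _; rewrite mulr_ge0// expR_ge0.
have rE : rho P h c Om (run_states h c w z) w0 (tshift dr z) =
    \prod_(k < K) wgt P h Om (run_st h c w (enum_val k).1 (noise_of z))
      (enum_val k).2 (tnth (tshift dr z) k).
  by apply: eq_bigr => k _; rewrite run_st_ref.
rewrite expR_llr /F decoded_ref rE /g -/dr.
by rewrite le_eqVlt; apply/orP; left; apply/eqP; ring.
Qed.

Lemma int_expR_llr_le w :
  (\int[tprob gam K]_z (expR (llr w z))%:E <= (#|valid_seqs|%:R)%:E)%E.
Proof.
have := int_llr_le predT w w; under eq_integral do rewrite mul1r.
move=> /le_trans; apply.
rewrite -sum1_card natr_sum -sumEFin; apply: lee_sum => sq _.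
by under eq_integral do rewrite mul1r; exact: rho_int.
Qed.

(** One [w0] serves for all messages, so under the reference law the events that the decoder outputs
    [w] are disjoint. All [M] messages together thus receive the mass of a single one, and this is
    what limits the rate. *)
Lemma sum_int_expR_llr_le :
  (\sum_(w < M) \int[tprob gam K]_z
     ((decoded h c w (noise_of z) == w)%:R * expR (llr w z))%:E <=
   (#|valid_seqs|%:R)%:E)%E.
Proof.
have [M0|M0] := posnP M.
  rewrite big1 => [|w _]; first by rewrite lee_fin.
  by have := ltn_ord w; rewrite [X in (_ < X)%N]M0.
pose w0 := Ordinal M0.
apply: le_trans.
  apply: lee_sum => w _; exact: (int_llr_le (pred1 w) w w0).
rewrite exchange_big/= -sum1_card natr_sum -sumEFin; apply: lee_sum => sq _.
rewrite -(ge0_int_sum (tprob gam K) (A := xpredT) (f := fun w v =>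
  (decoded h (refc c Om sq) w0 (noise_of v) == w)%:R * rho P h c Om sq w0 v)); last 2 first.
- move=> w _; apply: measurable_funM; last exact: measurable_rho.
  apply: (mfib_measurable (fun i => (i == w)%:R : R)).
  by apply: mfib_decoded; exact: measurable_refc.
- by move=> w v _; rewrite mulr_ge0// rho_ge0.
apply: le_trans (rho_int h Om P0 mc sq w0).
rewrite le_eqVlt; apply/orP; left; apply/eqP; apply: eq_integral => v _.
rewrite -mulr_suml (bigD1 (decoded h (refc c Om sq) w0 (noise_of v)))//= eqxx.
rewrite big1 ?addr0 ?mul1r// => w.
by rewrite eq_sym => /negbTE ->.
Qed.

End change_of_measure_bound.

Section converse_bound.
Context {R : realType} {N : nat}.
Local Notation C := (R * R)%type.
Local Notation node := (node N).
Variables (m : mode) (P : R) (h : node -> node -> C) (n M : nat).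
Variables (c : Defs.code R N n M).
Hypotheses (P0 : 0 <= P).
Hypothesis mc : measurable_code c.
Local Notation K := (noise_dim N n).
Local Notation Q := (tprob gam K).
Hypothesis valid_run : forall w z, run_states h c w z \in valid_seqs m n.
Hypothesis power : forall (i : node) (t : nat), i != dst N -> (t < n)%N ->
  (\sum_(w < M) \int[Q]_z (cnorm2 (input_at h c w (noise_of z) t i))%:E <=
   (M%:R * P)%:E)%E.

Definition link_on w t j i (z : K.-tuple C) : bool :=
  active (run_st h c w t (noise_of z) i) (run_st h c w t (noise_of z) j) i j.

Lemma mfib_link_on w t j i : mfib (link_on w t j i).
Proof.
apply: (@mfib_comp _ _ _ _ (fun z => (run_st h c w t (noise_of z) i,
  run_st h c w t (noise_of z) j)) (fun p => active p.1 p.2 i j)).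
by apply: mfib_pair; exact: mfib_run_st.
Qed.

Lemma input_at_dep w (k : 'I_K) (z z' : K.-tuple C) i :
  (forall j : 'I_K, (j < k)%N -> tnth z j = tnth z' j) ->
  input_at h c w (noise_of z) (enum_val k).1 i =
  input_at h c w (noise_of z') (enum_val k).1 i.
Proof.
move=> zz'; congr node_x; apply: noise_of_dep => s j sk; apply: zz'.
exact: enum_rank_ltn_val.
Qed.

Lemma link_on_dep w (k : 'I_K) (z z' : K.-tuple C) j i :
  (forall j : 'I_K, (j < k)%N -> tnth z j = tnth z' j) ->
  link_on w (enum_val k).1 j i z = link_on w (enum_val k).1 j i z'.
Proof. by move=> zz'; rewrite /link_on (run_st_dep h c w zz'). Qed.

Lemma tset_prefix (k : 'I_K) (z : K.-tuple C) u (j : 'I_K) : (j < k)%N ->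
  tnth (tset z k u) j = tnth z j.
Proof. by move=> jk; rewrite tnth_tset -val_eqE ltn_eqF. Qed.

Let mx w t i : measurable_fun setT (fun z : K.-tuple C => input_at h c w (noise_of z) t i).
Proof. exact: measurable_input_at. Qed.

Let mcx w t i (a : C) : measurable_fun setT
  (fun z : K.-tuple C => cnorm2 (cmul a (input_at h c w (noise_of z) t i))).
Proof.
by apply: measurableT_comp; [exact: measurable_cnorm2|exact: measurable_cmul].
Qed.

Let mx2 w t i : measurable_fun setT
  (fun z : K.-tuple C => cnorm2 (input_at h c w (noise_of z) t i)).
Proof. by apply: measurableT_comp => //; exact: measurable_cnorm2. Qed.

(** State and input at the time of [k] depend on earlier noise, so resampling noise [k] leaves them
    fixed and [gam_norm_le] applies with the signal as the mean. *)
Lemma resample_signal w (k : 'I_K) i (a : C) :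
  (\int[Q]_z (if link_on w (enum_val k).1 (enum_val k).2 i z
     then cnorm2 (tnth z k + cmul a (input_at h c w (noise_of z) (enum_val k).1 i)) else 0)%:E <=
   \int[Q]_z (if link_on w (enum_val k).1 (enum_val k).2 i z
     then 1 + cnorm2 (cmul a (input_at h c w (noise_of z) (enum_val k).1 i)) else 0)%:E)%E.
Proof.
set t := (enum_val k).1; set j := (enum_val k).2.
have mF : measurable_fun setT (fun z : K.-tuple C => if link_on w t j i z
    then cnorm2 (tnth z k + cmul a (input_at h c w (noise_of z) t i)) else 0).
  apply: mfib_if; [exact: mfib_link_on| |exact: measurable_cst].
  apply: measurableT_comp; first exact: measurable_cnorm2.
  by apply: measurable_cadd; [exact: measurable_tnth|exact: measurable_cmul].
have F0 (z : K.-tuple C) : 0 <= if link_on w t j i z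
    then cnorm2 (tnth z k + cmul a (input_at h c w (noise_of z) t i)) else 0.
  by case: ifP => // _; exact: cnorm2_ge0.
have mFE := proj2 (measurable_EFinP _ _) mF.
rewrite (tprob_resample gam k)//.
apply: ge0_le_integral => //.
- by move=> z _; apply: integral_ge0 => u _; rewrite lee_fin.
- by apply: (@measurable_int_tset _ _ _ gam _ k _ mFE) => z; rewrite /= lee_fin.
- apply/measurable_EFinP; apply: mfib_if; [exact: mfib_link_on| |exact: measurable_cst].
  exact: measurable_funD.
move=> z _.
have E u : link_on w t j i (tset z k u) = link_on w t j i z.
  by apply: link_on_dep => j' j'k; exact: tset_prefix.
have E' u : input_at h c w (noise_of (tset z k u)) t i = input_at h c w (noise_of z) t i.
  by apply: input_at_dep => j' j'k; exact: tset_prefix.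
under eq_integral do rewrite E E' tnth_tset eqxx.
by case: (link_on _ _ _ _ _); [exact: gam_norm_le|rewrite integral_prob_cst].
Qed.

(** As for [resample_signal], with [gam_norm_ge]. *)
Lemma resample_noise w (k : 'I_K) i :
  (\int[Q]_z ((link_on w (enum_val k).1 (enum_val k).2 i z)%:R)%:E <=
   \int[Q]_z (if link_on w (enum_val k).1 (enum_val k).2 i z then cnorm2 (tnth z k) else 0)%:E)%E.
Proof.
set t := (enum_val k).1; set j := (enum_val k).2.
have mF : measurable_fun setT (fun z : K.-tuple C => if link_on w t j i z
    then cnorm2 (tnth z k) else 0).
  apply: mfib_if; [exact: mfib_link_on| |exact: measurable_cst].
  apply: measurableT_comp; first exact: measurable_cnorm2.
  exact: measurable_tnth.
have F0 (z : K.-tuple C) : 0 <= if link_on w t j i z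
    then cnorm2 (tnth z k) else 0.
  by case: ifP => // _; exact: cnorm2_ge0.
have mFE := proj2 (measurable_EFinP _ _) mF.
rewrite [leRHS](tprob_resample gam k)//.
apply: ge0_le_integral => //.
- exact: measurable_indicb (mfib_link_on w t j i).
- by apply: (@measurable_int_tset _ _ _ gam _ k _ mFE) => z; rewrite /= lee_fin.
move=> z _.
have E u : link_on w t j i (tset z k u) = link_on w t j i z.
  by apply: link_on_dep => j' j'k; exact: tset_prefix.
under eq_integral do rewrite E tnth_tset eqxx.
by case: (link_on _ _ _ _ _); [exact: gam_norm_ge|rewrite integral_prob_cst].
Qed.

Variable Om : {set node}.
Hypothesis Omcut : is_cut Om.

Lemma infoA_sum w z (k : 'I_K) : let t := (enum_val k).1 in let j := (enum_val k).2 in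
  infoA P h c Om w z k = if j \in Om then 0 else \sum_(i in Om)
    (if link_on w t j i z then ln (gain P h j i) +
       cnorm2 (tnth z k + cmul (h j i) (input_at h c w (noise_of z) t i)) /
         gain P h j i else 0).
Proof.
move=> t j; rewrite /infoA /drift -/t -/j; case: (j \in Om) => //.
rewrite (cross_sum Om (run_st h c w t (noise_of z)) j (fun i => ln (gain P h j i) +
  cnorm2 (tnth z k + cmul (h j i) (input_at h c w (noise_of z) t i)) / gain P h j i)).
by case: cross.
Qed.

Lemma infoB_sum w z (k : 'I_K) : let t := (enum_val k).1 in let j := (enum_val k).2 in
  infoB h c Om w z k = if j \in Om then 0 else \sum_(i in Om)
    (if link_on w t j i z then cnorm2 (tnth z k) else 0).
Proof.
move=> t j; rewrite /infoB -/t -/j; case: (j \in Om) => //.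
by rewrite (cross_sum Om (run_st h c w t (noise_of z)) j (fun i => cnorm2 (tnth z k))).
Qed.

Lemma cnorm2_cmul (a b : C) : cnorm2 (cmul a b) = cnorm2 a * cnorm2 b.
Proof. by rewrite /cnorm2 /cmul/=; ring. Qed.

(* [B] is [P^-1], except that the junk value [0^-1 = 0] does not do for [P = 0]. *)
Lemma gain_slope : exists2 B : R, 0 <= B & B * P <= 1 /\
  forall j i, cnorm2 (h j i) / gain P h j i <= B.
Proof.
have [P_gt0|] := ltP 0 P.
  exists P^-1; first by rewrite invr_ge0.
  split=> [|j i]; first by rewrite mulVf ?gt_eqF.
  rewrite ler_pdivrMr ?gain_gt0// ler_pdivlMl// /gain lerDr//.
rewrite le_eqVlt ltNge P0 orbF => /eqP P00.
exists (\sum_j \sum_i cnorm2 (h j i)).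
  by apply: sumr_ge0 => j _; apply: sumr_ge0 => i _; exact: cnorm2_ge0.
split=> [|j i]; first by rewrite P00 mulr0.
rewrite /gain P00 mul0r addr0 divr1 (bigD1 j)//= (bigD1 i)//= -addrA lerDl.
rewrite addr_ge0//; first by apply: sumr_ge0 => ? _; exact: cnorm2_ge0.
by apply: sumr_ge0 => ? _; apply: sumr_ge0 => ? _; exact: cnorm2_ge0.
Qed.

Lemma sum_enum_val (V : nmodType) (F : 'I_n * node -> V) :
  \sum_(k < K) F (enum_val k) = \sum_(t < n) \sum_j F (t, j).
Proof.
rewrite pair_bigA/= -(big_enum_val F).
by apply: eq_bigr => -[].
Qed.

Definition link_pr w t j i : R := Pr Q (link_on w t j i).

(** A transmit beam points to at most one node, so in each channel use the power of a node is
    charged to a single link. *)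
Lemma link_one w t i z : \sum_(j in ~: Om) (link_on w t j i z)%:R <= 1 :> R.
Proof.
rewrite /link_on /active; case E : (run_st h c w t (noise_of z) i).1 => [j0|]; last first.
  by rewrite big1.
have [j0Om|j0Om] := boolP (j0 \in ~: Om); last first.
  rewrite big1// => j jOm; case: eqP => //= -[jj0].
  by rewrite jj0 jOm in j0Om.
rewrite (bigD1 j0)//= big1 ?addr0; first by rewrite lern1; case: (_ && _).
by move=> j /andP[_ jj0]; case: eqP => //= -[jj0']; rewrite jj0' eqxx in jj0.
Qed.

Let pw w t i : \bar R := (\int[Q]_z (cnorm2 (input_at h c w (noise_of z) t i))%:E)%E.

(** While a link is on, the normalised output energy has mean at most [1 + B * |x|^2]. The 1 is kept
    together with the probability that the link is on; the power term is summed over the receivers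
    by [link_one]. *)
Lemma int_infoA_le B w : 0 <= B ->
  (forall j i, cnorm2 (h j i) / gain P h j i <= B) ->
  (\int[Q]_z (\sum_(k < K) infoA P h c Om w z k)%:E <=
   (\sum_(t < n) \sum_(j in ~: Om) \sum_(i in Om)
      link_pr w t j i * (ln (gain P h j i) + 1))%:E +
    B%:E * \sum_(t < n) \sum_(i in Om) pw w t i)%E.
Proof.
move=> B0 HB.
pose D (p : 'I_n * node) z : R := if p.2 \in Om then 0 else \sum_(i in Om)
  (if link_on w p.1 p.2 i z then ln (gain P h p.2 i) + 1 +
     B * cnorm2 (input_at h c w (noise_of z) p.1 i) else 0).
have lng0 j i : 0 <= ln (gain P h j i) by apply: ln_ge0; exact: gain_ge1.
have D0 p z : 0 <= D p z.
  rewrite /D; case: ifP => // _; apply: sumr_ge0 => i _; case: ifP => // _.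
  by rewrite !addr_ge0// mulr_ge0// cnorm2_ge0.
have mD p : measurable_fun setT (D p).
  rewrite /D; case: (p.2 \in Om); first exact: measurable_cst.
  apply: measurable_sum_cond => i _; apply: mfib_if; last exact: measurable_cst.
    exact: mfib_link_on.
  by apply: measurable_funD => //; apply: measurable_funM.
apply: (@le_trans _ _ (\int[Q]_z (\sum_(k < K) D (enum_val k) z)%:E)%E).
  rewrite ge0_int_sum; last 2 first.
  - by move=> k _; exact: measurable_infoA.
  - by move=> k z _; exact: infoA_ge0.
  rewrite ge0_int_sum//; apply: lee_sum => k _.
  rewrite /D; under eq_integral do rewrite infoA_sum.
  case: (_ \in Om); first exact: lexx.
  set t := (enum_val k).1; set j := (enum_val k).2.
  have g0 i : 0 <= (gain P h j i)^-1 by rewrite invr_ge0 ltW// gain_gt0.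
  rewrite ge0_int_sum; last 2 first.
  - move=> i _; apply: mfib_if; [exact: mfib_link_on| |exact: measurable_cst].
    apply: measurable_funD => //; apply: measurable_funM => //.
    apply: measurableT_comp; first exact: measurable_cnorm2.
    by apply: measurable_cadd; [exact: measurable_tnth|exact: measurable_cmul].
  - move=> i z _; case: ifP => // _; apply: addr_ge0 => //.
    by rewrite mulr_ge0// cnorm2_ge0.
  rewrite ge0_int_sum; last 2 first.
  - move=> i _; apply: mfib_if; [exact: mfib_link_on| |exact: measurable_cst].
    by apply: measurable_funD => //; apply: measurable_funM.
  - move=> i z _; case: ifP => // _; rewrite !addr_ge0// mulr_ge0// cnorm2_ge0//.
  apply: lee_sum => i _.
  pose f1 (z : K.-tuple C) : R := ln (gain P h j i) * (link_on w t j i z)%:R.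
  pose f2 (z : K.-tuple C) : R := if link_on w t j i z
    then cnorm2 (tnth z k + cmul (h j i) (input_at h c w (noise_of z) t i)) else 0.
  pose f3 (z : K.-tuple C) : R := if link_on w t j i z
    then 1 + cnorm2 (cmul (h j i) (input_at h c w (noise_of z) t i)) else 0.
  have mf1 : measurable_fun setT f1.
    apply: measurable_funM => //.
    exact: (mfib_measurable (fun a : bool => a%:R%R : R) (mfib_link_on w t j i)).
  have mf2 : measurable_fun setT f2.
    apply: mfib_if; [exact: mfib_link_on| |exact: measurable_cst].
    apply: measurableT_comp; first exact: measurable_cnorm2.
    by apply: measurable_cadd; [exact: measurable_tnth|exact: measurable_cmul].
  have mf3 : measurable_fun setT f3.
    apply: mfib_if; [exact: mfib_link_on| |exact: measurable_cst].
    exact: measurable_funD.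
  have f10 z : 0 <= f1 z by rewrite mulr_ge0.
  have f20 z : 0 <= f2 z by rewrite /f2; case: ifP => // _; exact: cnorm2_ge0.
  have f30 z : 0 <= f3 z.
    by rewrite /f3; case: ifP => // _; apply: addr_ge0 => //; exact: cnorm2_ge0.
  apply: (@le_trans _ _ (\int[Q]_z (f1 z + (gain P h j i)^-1 * f3 z)%:E)%E).
    apply: (@le_trans _ _ (\int[Q]_z (f1 z + (gain P h j i)^-1 * f2 z)%:E)%E).
      rewrite le_eqVlt; apply/orP; left; apply/eqP; apply: eq_integral => z _.
      rewrite /f1 /f2; case: (link_on _ _ _ _ _); rewrite ?mulr1 ?mulr0 ?addr0//.
      by rewrite [in RHS]mulrC.
    rewrite !ge0_intD//; first last.
    - by move=> z; rewrite mulr_ge0.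
    - exact: measurable_funM.
    - by move=> z; rewrite mulr_ge0.
    - exact: measurable_funM.
    apply: leeD => //; rewrite !ge0_intZl//; apply: lee_wpmul2l; first by rewrite lee_fin.
    exact: resample_signal.
  apply: ge0_int_le.
  - by apply: measurable_funD => //; exact: measurable_funM.
  - apply: mfib_if; [exact: mfib_link_on| |exact: measurable_cst].
    by apply: measurable_funD => //; apply: measurable_funM.
  - by move=> z; rewrite addr_ge0// mulr_ge0.
  - move=> z; rewrite /f1 /f3; case: (link_on _ _ _ _ _); last by rewrite !mulr0 addr0.
    rewrite mulr1 -addrA lerD2l mulrDr mulr1 lerD//.
      by rewrite invf_le1 ?gain_gt0// gain_ge1.
    rewrite cnorm2_cmul mulrA ler_wpM2r ?cnorm2_ge0// mulrC; exact: HB.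
pose E1 (p : 'I_n * node) z : R := if p.2 \in Om then 0 else
   \sum_(i in Om) (ln (gain P h p.2 i) + 1) * (link_on w p.1 p.2 i z)%:R.
have E10 p z : 0 <= E1 p z.
  rewrite /E1; case: ifP => // _; apply: sumr_ge0 => i _.
  by rewrite mulr_ge0// addr_ge0.
have mlink t j i : measurable_fun setT (fun z => (link_on w t j i z)%:R : R).
  exact: (mfib_measurable (fun a : bool => a%:R%R : R) (mfib_link_on w t j i)).
have mE1 p : measurable_fun setT (E1 p).
  rewrite /E1; case: (p.2 \in Om); first exact: measurable_cst.
  by apply: measurable_sum_cond => i _; apply: measurable_funM.
apply: (@le_trans _ _ (\int[Q]_z (\sum_(t < n) \sum_j E1 (t, j) z + B *
   \sum_(t < n) \sum_(i in Om) cnorm2 (input_at h c w (noise_of z) t i))%:E)%E).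
  apply: ge0_int_le.
  - by apply: measurable_sum => k.
  - apply: measurable_funD.
      by apply: measurable_sum => t; apply: measurable_sum => j.
    by apply: measurable_funM => //; apply: measurable_sum => t; exact: measurable_sum_cond.
  - by move=> z; apply: sumr_ge0.
  move=> z; rewrite (sum_enum_val (D ^~ z)) mulr_sumr -big_split/=.
  apply: ler_sum => t _.
  have -> : \sum_j D (t, j) z = \sum_j (E1 (t, j) z + (if j \in Om then 0 else
     \sum_(i in Om) B * cnorm2 (input_at h c w (noise_of z) t i) * (link_on w t j i z)%:R)).
    apply: eq_bigr => j _; rewrite /D /E1/=; case: (j \in Om); first by rewrite addr0.
    rewrite -big_split/=; apply: eq_bigr => i _.
    by case: (link_on _ _ _ _ _); rewrite ?mulr1// !mulr0 addr0.
  rewrite big_split/= lerD2l.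
  rewrite (_ : \sum_j (if _ then _ else _) = \sum_(j in ~: Om) \sum_(i in Om)
      B * cnorm2 (input_at h c w (noise_of z) t i) * (link_on w t j i z)%:R); last first.
    rewrite [RHS]big_mkcond/=; apply: eq_bigr => j _; rewrite inE.
    by case: (j \in Om).
  rewrite exchange_big/= mulr_sumr; apply: ler_sum => i _.
  (* Here the link indicators are given up: an input may concentrate its power on the times at which
     the link is on. *)
  rewrite -mulr_sumr -[leRHS]mulr1 ler_wpM2l//; last exact: link_one.
  by rewrite mulr_ge0// cnorm2_ge0.
rewrite ge0_intD; last 4 first.
- by apply: measurable_sum => t; apply: measurable_sum => j.
- by apply: measurable_funM => //; apply: measurable_sum => t; exact: measurable_sum_cond.
- by move=> z; apply: sumr_ge0 => t _; apply: sumr_ge0.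
- move=> z; rewrite mulr_ge0//; apply: sumr_ge0 => t _; apply: sumr_ge0 => i _.
  exact: cnorm2_ge0.
apply: leeD.
  rewrite ge0_int_sum; last 2 first.
  - by move=> t _; apply: measurable_sum.
  - by move=> t z _; apply: sumr_ge0.
  rewrite -sumEFin; apply: lee_sum => t _.
  rewrite ge0_int_sum// [X in (_ <= X%:E)%E]big_mkcond/= -sumEFin; apply: lee_sum => j _.
  rewrite inE /E1/=; case: (j \in Om) => /=; first by rewrite integral_prob_cst.
  rewrite ge0_int_sum; last 2 first.
  - by move=> i _; apply: measurable_funM.
  - by move=> i z _; rewrite mulr_ge0// addr_ge0.
  rewrite -sumEFin; apply: lee_sum => i _.
  rewrite ge0_intZl//; last by rewrite addr_ge0.
  by rewrite (PrE Q (mfib_link_on w t j i)) -EFinM mulrC.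
rewrite ge0_intZl//; last 2 first.
- by apply: measurable_sum => t; exact: measurable_sum_cond.
- by move=> z; apply: sumr_ge0 => t _; apply: sumr_ge0 => i _; exact: cnorm2_ge0.
rewrite lee_wpmul2l ?lee_fin//.
rewrite ge0_int_sum; last 2 first.
- by move=> t _; exact: measurable_sum_cond.
- by move=> t z _; apply: sumr_ge0 => i _; exact: cnorm2_ge0.
apply: lee_sum => t _; rewrite ge0_int_sum//.
by move=> i z _; exact: cnorm2_ge0.
Qed.

(** Offsets the [+ 1] in [int_infoA_le], so that the noise energy cancels on average. *)
Lemma int_infoB_ge w :
  ((\sum_(t < n) \sum_(j in ~: Om) \sum_(i in Om) link_pr w t j i)%:E <=
   \int[Q]_z (\sum_(k < K) infoB h c Om w z k)%:E)%E.
Proof.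
rewrite ge0_int_sum; last 2 first.
- by move=> k _; exact: measurable_infoB.
- by move=> k z _; exact: infoB_ge0.
pose G (p : 'I_n * node) : R := if p.2 \in Om then 0 else \sum_(i in Om) link_pr w p.1 p.2 i.
rewrite (_ : \sum_(t < n) _ = \sum_(k < K) G (enum_val k)); last first.
  rewrite sum_enum_val; apply: eq_bigr => t _; rewrite big_mkcond/=.
  by apply: eq_bigr => j _; rewrite inE /G/=; case: (j \in Om).
rewrite -sumEFin; apply: lee_sum => k _; rewrite /G.
under eq_integral do rewrite infoB_sum.
case: (_ \in Om); first by rewrite integral_prob_cst.
set t := (enum_val k).1; set j := (enum_val k).2.
rewrite ge0_int_sum; last 2 first.
- move=> i _; apply: mfib_if; [exact: mfib_link_on| |exact: measurable_cst].
  apply: measurableT_comp; first exact: measurable_cnorm2.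
  exact: measurable_tnth.
- by move=> i z _; case: ifP => // _; exact: cnorm2_ge0.
rewrite -sumEFin; apply: lee_sum => i _.
rewrite -(PrE Q (mfib_link_on w t j i)); exact: resample_noise.
Qed.

End converse_bound.

(** * Counting network states *)

Section state_count.
Variable N : nat.
Local Notation node := (node N).

Lemma card_option_node : #|{: option node}| = N.+3.
Proof. by rewrite card_option card_ord. Qed.

Lemma card_setC2 (T : finType) (a b : T) : a != b ->
  #|~: [set a; b]%SET| = (#|T| - 2)%N.
Proof. by move=> ab; rewrite cardsCs finset.setCK cards2 ab. Qed.

Lemma card_valid_src m : (#|[pred a | valid_local m (src N) a]| <= N.+2)%N.
Proof.
apply: (@leq_trans #|finset.setX (finset.setC [set Some (src N)]%SET) [set (None : option node)]%SET|).
  apply: subset_leq_card; apply/fintype.subsetP => -[a b]; rewrite inE /valid_local !inE/= ?eqxx/=.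
  by case/and5P => -> _ _ _ /andP[].
by rewrite cardsX cards1 muln1 cardsC1 card_option_node.
Qed.

Lemma card_valid_dst m : (#|[pred a | valid_local m (dst N) a]| <= N.+2)%N.
Proof.
apply: (@leq_trans #|finset.setX [set (None : option node)]%SET (finset.setC [set Some (dst N)]%SET)|).
  apply: subset_leq_card; apply/fintype.subsetP => -[a b]; rewrite inE /valid_local !inE/= ?eqxx/=.
  by case/and5P => _ -> _ _ /andP[-> _].
by rewrite cardsX cards1 mul1n cardsC1 card_option_node.
Qed.

Lemma card_valid_relay m (i : node) : is_relay i ->
  (#|[pred a | valid_local m i a]| <= card_S1 N m)%N.
Proof.
case/andP=> is_ id_; case: m => /=.
  apply: (@leq_trans #|finset.setX (finset.setC [set Some i; Some (src N)]%SET)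
     (finset.setC [set Some i; Some (dst N)]%SET)|).
    apply: subset_leq_card; apply/fintype.subsetP => -[a b]; rewrite inE /valid_local !inE/=.
    by rewrite !negb_or; case/and5P => -> -> -> -> _.
  rewrite cardsX !card_setC2 ?card_option_node.
  - by rewrite !subSS subn0.
  - by apply: contra id_ => /eqP[->].
  - by apply: contra is_ => /eqP[->].
(* Transmitting or idle gives [N + 1] pairs, receiving gives [N]: [None] is excluded from the second
   set so that the idle pair is counted once. *)
apply: (@leq_trans #|finset.setU (finset.setX (finset.setC [set Some i; Some (src N)]%SET) [set None]%SET)
   (finset.setX [set None]%SET (finset.setC [set None; Some i; Some (dst N)]%SET))|).
  apply: subset_leq_card; apply/fintype.subsetP => -[a b]; rewrite inE /valid_local !inE/= is_ id_/=.
  by rewrite !negb_or; case/and5P => -> -> -> -> /and3P[_ _]; case: a; case: b.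
apply: leq_trans (leq_card_setU _ _) _.
rewrite !cardsX !cards1 muln1 mul1n card_setC2; last first.
  by apply: contra is_ => /eqP[->].
rewrite cardsCs finset.setCK card_option_node -finset.setUA cardsU1 cards2 !inE/=.
rewrite (_ : Some i != Some (dst N)); last by apply: contra id_ => /eqP[->].
by rewrite !subSS !subn0 -addnn addSn.
Qed.

Lemma card_valid_state m :
  (#|[set s : state N | valid_state m s]%SET| <= N.+2 ^ 2 * card_S1 N m ^ N)%N.
Proof.
rewrite (_ : #|_| = #|family (fun i : node => [pred a | valid_local m i a])|); last first.
  by apply: eq_card => s; rewrite inE; apply: eq_forallb => i.
rewrite card_family foldrE big_map big_enum/=.
rewrite big_ord_recl big_ord_recr/=.
have E (a b x y z w : nat) : (a <= x -> b <= w -> y <= z -> x * w * z = x * w * z ->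
   a * (y * b) <= x * w * z)%N.
  by move=> ax bw yz _; rewrite [(y * b)%N]mulnC mulnA; apply: leq_mul => //; exact: leq_mul.
rewrite expnS expn1; apply: E => //.
- exact: card_valid_src.
- exact: card_valid_dst.
rewrite -[X in (_ <= _ ^ X)%N]card_ord -prod_nat_const.
apply: leq_prod => i _; apply: card_valid_relay.
apply/andP; split; first by rewrite eq_sym neq_ltn.
by rewrite -val_eqE /= /bump/= add1n eqSS ltn_eqF.
Qed.

End state_count.

Section converse_cut.
Context {R : realType} {N : nat}.
Local Notation C := (R * R)%type.
Local Notation node := (node N).
Variables (m : mode) (P : R) (h : node -> node -> C) (n M : nat).
Variables (c : Defs.code R N n M).
Hypotheses (P0 : 0 <= P) (M0 : (0 < M)%N).
Hypothesis mc : measurable_code c.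
Local Notation K := (noise_dim N n).
Local Notation Q := (tprob gam K).
Hypothesis valid_run : forall w z, run_states h c w z \in valid_seqs m n.
Hypothesis power : forall (i : node) (t : nat), i != dst N -> (t < n)%N ->
  (\sum_(w < M) \int[Q]_z (cnorm2 (input_at h c w (noise_of z) t i))%:E <=
   (M%:R * P)%:E)%E.
Variable Om : {set node}.
Hypothesis Omcut : is_cut Om.

Definition good w : K.-tuple C -> bool := fun z => decoded h c w (noise_of z) == w.

Lemma mfib_good w : mfib (good w).
Proof. exact: (mfib_comp (fun i => i == w) (mfib_decoded h w mc)). Qed.

Let V : R := #|@valid_seqs N m n|%:R.
Let SA w z := \sum_(k < K) infoA P h c Om w z k.
Let SB w z := \sum_(k < K) infoB h c Om w z k.

Let V0 : 0 < V.
Proof.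
rewrite ltr0n card_gt0; apply/set0Pn.
by exists (run_states h c (Ordinal M0) (nseq_tuple K (0 : C))).
Qed.

Let V1 : 1 <= V.
Proof. by rewrite ler1n -(ltr0n R). Qed.

(* [1 + x <= expR x] at [x = ln (M / V) + llr] if decoding succeeds, and at
   [x = llr - ln V] otherwise. *)
Lemma info_pointwise w z :
  1 + (ln M%:R * (good w z)%:R + SB w z) <=
  M%:R * V^-1 * ((good w z)%:R * expR (llr P h c Om w z)) +
  (V^-1 * expR (llr P h c Om w z) + (ln V + SA w z)).
Proof.
have llrE : llr P h c Om w z = SB w z - SA w z by rewrite /llr sumrB.
have VE : V^-1 = expR (- ln V) by rewrite expRN lnK// posrE.
have ME : M%:R = expR (ln M%:R) :> R by rewrite lnK// posrE ltr0n.
have VL : V^-1 * expR (llr P h c Om w z) = expR (SB w z - SA w z - ln V).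
  by rewrite VE -expRD llrE; congr expR; ring.
case: (good w z); rewrite ?mulr1 ?mulr0 ?mul1r ?mul0r ?mulr0 ?add0r; last first.
  by rewrite VL; have := expR_ge1Dx (SB w z - SA w z - ln V); lra.
rewrite -mulrA VL.
have : M%:R * expR (SB w z - SA w z - ln V) =
    expR (ln M%:R + (SB w z - SA w z - ln V)) by rewrite expRD -ME.
move=> ->; have := expR_ge1Dx (ln M%:R + (SB w z - SA w z - ln V)).
have := expR_ge0 (SB w z - SA w z - ln V); lra.
Qed.

(** [info_pointwise] is integrated and summed over the messages. Each exponential term yields at
    most [M], the first one thanks to the disjointness of the decoding events, and one of the two is
    cancelled by the [1 +] on the left. The power terms yield [M * n * (N + 1)] because
    [B * P <= 1]. *)
Lemma converse_cut :
  ln M%:R * (\sum_(w < M) Pr Q (good w)) <=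
  M%:R * (1 + ln V + n%:R * N.+1%:R) +
  \sum_(w < M) \sum_(t < n) \sum_(j in ~: Om) \sum_(i in Om)
    link_pr h c w t j i * ln (gain P h j i).
Proof.
have lnM0 : 0 <= ln (M%:R : R) by apply: ln_ge0; rewrite ler1n.
have lnV0 : 0 <= ln V by apply: ln_ge0.
have [B B0 [BP HB]] := gain_slope h P0.
have iV0 : 0 <= V^-1 by rewrite invr_ge0 ltW.
pose U w : \bar R := (\int[Q]_z ((good w z)%:R * expR (llr P h c Om w z))%:E)%E.
pose T w : \bar R := (\int[Q]_z (expR (llr P h c Om w z))%:E)%E.
pose al w := \sum_(t < n) \sum_(j in ~: Om) \sum_(i in Om)
    link_pr h c w t j i * ln (gain P h j i).
pose be w := \sum_(t < n) \sum_(j in ~: Om) \sum_(i in Om) link_pr h c w t j i.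
pose pw w : \bar R := (\sum_(t < n) \sum_(i in Om)
  \int[Q]_z (cnorm2 (input_at h c w (noise_of z) t i))%:E)%E.
have mgood w : measurable_fun setT (fun z => (good w z)%:R : R).
  exact: (mfib_measurable (fun a : bool => a%:R%R : R) (mfib_good w)).
have mL w : measurable_fun setT (fun z => expR (llr P h c Om w z)).
  by apply: (measurableT_comp (@measurable_expR R)); exact: measurable_llr.
have mA w : measurable_fun setT (SA w).
  by apply: measurable_sum => k; exact: measurable_infoA.
have mB w : measurable_fun setT (SB w).
  by apply: measurable_sum => k; exact: measurable_infoB.
have A0 w z : 0 <= SA w z by apply: sumr_ge0 => k _; exact: infoA_ge0.
have B00 w z : 0 <= SB w z by apply: sumr_ge0 => k _; exact: infoB_ge0.
have key w : ((1 + ln M%:R * Pr Q (good w) + be w)%:E <=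
    (M%:R * V^-1)%:E * U w + (V^-1%:E * T w +
     (((ln V + (al w + be w)))%:E + B%:E * pw w)))%E.
  apply: (@le_trans _ _ (\int[Q]_z (1 + (ln M%:R * (good w z)%:R + SB w z))%:E)%E).
    rewrite ge0_intD//; last 2 first.
    - by apply: measurable_funD => //; exact: measurable_funM.
    - by move=> z; rewrite addr_ge0// mulr_ge0.
    rewrite ge0_intD//; last 2 first.
    - exact: measurable_funM.
    - by move=> z; rewrite mulr_ge0.
    rewrite ge0_intZl// integral_prob_cst// (PrE Q (mfib_good w)) -EFinM addeA.
    rewrite [leLHS]EFinD; apply: leeD; last exact: int_infoB_ge.
    by rewrite EFinD.
  apply: (@le_trans _ _ (\int[Q]_z (M%:R * V^-1 * ((good w z)%:R *
      expR (llr P h c Om w z)) + (V^-1 * expR (llr P h c Om w z) +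
      (ln V + SA w z)))%:E)%E).
    apply: ge0_int_le.
    - apply: measurable_funD => //; apply: measurable_funD => //.
      exact: measurable_funM.
    - apply: measurable_funD.
        by apply: measurable_funM => //; exact: measurable_funM.
      apply: measurable_funD; first exact: measurable_funM.
      exact: measurable_funD.
    - by move=> z; rewrite addr_ge0// addr_ge0// mulr_ge0.
    - by move=> z; exact: info_pointwise.
  rewrite ge0_intD; last 4 first.
  - by apply: measurable_funM => //; exact: measurable_funM.
  - apply: measurable_funD; first exact: measurable_funM.
    exact: measurable_funD.
  - by move=> z; rewrite !mulr_ge0// expR_ge0.
  - by move=> z; rewrite addr_ge0 ?addr_ge0// mulr_ge0// expR_ge0.
  rewrite ge0_intD; last 4 first.
  - exact: measurable_funM.
  - exact: measurable_funD.
  - by move=> z; rewrite mulr_ge0// expR_ge0.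
  - by move=> z; rewrite addr_ge0.
  rewrite ge0_intD// integral_prob_cst// !ge0_intZl//; last 2 first.
  - exact: measurable_funM.
  - by rewrite mulr_ge0.
  apply: leeD => //; apply: leeD => //; rewrite EFinD -addeA; apply: leeD => //.
  apply: le_trans (@int_infoA_le _ _ _ _ _ _ _ P0 mc Om B w B0 HB) _.
  rewrite (_ : al w + be w = \sum_(t < n) \sum_(j in ~: Om) \sum_(i in Om)
      link_pr h c w t j i * (ln (gain P h j i) + 1))//.
  rewrite /al /be -big_split/=; apply: eq_bigr => t _.
  rewrite -big_split/=; apply: eq_bigr => j _.
  by rewrite -big_split/=; apply: eq_bigr => i _; rewrite mulrDr mulr1.
have : (\sum_(w < M) (1 + ln M%:R * Pr Q (good w) + be w)%:E <=
  \sum_(w < M) ((M%:R * V^-1)%:E * U w + (V^-1%:E * T w +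
     (((ln V + (al w + be w)))%:E + B%:E * pw w))))%E.
  by apply: lee_sum => w _; exact: key.
have U0 w : (0 <= U w)%E.
  by apply: integral_ge0 => z _; rewrite lee_fin mulr_ge0// expR_ge0.
have T0 w : (0 <= T w)%E by apply: integral_ge0 => z _; rewrite lee_fin expR_ge0.
have pw0 w : (0 <= pw w)%E.
  apply: sume_ge0 => t _; apply: sume_ge0 => i _; apply: integral_ge0 => z _.
  by rewrite lee_fin cnorm2_ge0.
rewrite !big_split/= -!ge0_sume_distrr//.
have hU : ((M%:R * V^-1)%:E * \sum_(w < M) U w <= (M%:R)%:E)%E.
  apply: (@le_trans _ _ ((M%:R * V^-1)%:E * V%:E)%E).
    apply: lee_wpmul2l; first by rewrite lee_fin mulr_ge0.
    exact: sum_int_expR_llr_le.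
  by rewrite -EFinM mulfVK// gt_eqF.
have hT : (V^-1%:E * \sum_(w < M) T w <= (M%:R)%:E)%E.
  apply: (@le_trans _ _ (V^-1%:E * (V * M%:R)%:E)%E).
    apply: lee_wpmul2l; first by rewrite lee_fin.
    rewrite mulr_natr -[in leRHS](card_ord M) -sumr_const -sumEFin.
    by apply: lee_sum => w _; exact: int_expR_llr_le.
  by rewrite -EFinM mulKf// gt_eqF.
have hp : (B%:E * \sum_(w < M) pw w <= (M%:R * (n%:R * N.+1%:R))%:E)%E.
  apply: (@le_trans _ _ (B%:E * (n%:R * (N.+1%:R * (M%:R * P)))%:E)%E).
    apply: lee_wpmul2l; first by rewrite lee_fin.
    rewrite exchange_big/=.
    rewrite -[n in n%:R](card_ord n) mulr_natl -sumr_const -sumEFin.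
    apply: lee_sum => t _; rewrite exchange_big/=.
    apply: (@le_trans _ _ (\sum_(i in Om) (M%:R * P)%:E)%E).
      apply: lee_sum => i iOm; apply: power => //.
      by apply: contraTneq iOm => ->; case/andP: Omcut.
    rewrite sumEFin sumr_const lee_fin -[leLHS]mulr_natl ler_wpM2r ?mulr_ge0//.
    (* [Om] misses the destination, so it has at most [N + 1] elements. *)
    rewrite ler_nat -ltnS.
    have := @max_card _ (mem (dst N |: Om)%SET).
    by rewrite cardsU1 card_ord; case/andP: Omcut => _ ->.
  rewrite -EFinM lee_fin; have : 0 <= (M%:R : R) * (n%:R * N.+1%:R) by rewrite !mulr_ge0.
  set X := M%:R * _; rewrite (_ : B * _ = B * P * X); last by rewrite /X; ring.
  by move=> X0; rewrite ler_piMl.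
move=> H; move: (le_trans H (leeD hU (leeD hT (leeD (lexx _) hp)))).
rewrite !sumEFin -!EFinD lee_fin !big_split/= -!mulr_sumr !sumr_const !card_ord.
rewrite -/(be) -(mulr_natl (ln V)); lra.
Qed.

End converse_cut.

(** * From the cut bounds to the upper bound on the capacity *)

Section converse.
Context {R : realType} {N : nat}.
Local Notation C := (R * R)%type.
Local Notation node := (node N).

Lemma ln2_gt0 : 0 < ln (2 : R).
Proof. by rewrite ln_gt0// ltr1n. Qed.

Lemma log2_ge0 (x : R) : 1 <= x -> 0 <= log2 x.
Proof. by move=> x1; apply: divr_ge0; [exact: ln_ge0|exact: ltW ln2_gt0]. Qed.

Lemma ln_log2 (x : R) : ln x = ln 2 * log2 x.
Proof. by rewrite /log2 mulrC divfK// gt_eqF// ln2_gt0. Qed.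

Section rates.
Variables (m : mode) (P : R) (h : node -> node -> C).
Hypothesis P0 : 0 <= P.

Lemma ell_ge0 j i : 0 <= ell P h j i.
Proof. by apply: log2_ge0; exact: gain_ge1. Qed.

Lemma is_cut_src : is_cut [set src N]%SET.
Proof. by rewrite /is_cut !inE eqxx. Qed.

Lemma distr_sum_le1 (lam : state N -> R) (A : pred (state N)) :
  is_state_distr m lam -> \sum_(s | A s) lam s <= 1.
Proof.
case=> l0 _ <-; rewrite [leRHS](bigID A)/= lerDl.
by apply: sumr_ge0.
Qed.

Lemma cut_value_ge0 lam Om : is_state_distr m lam -> 0 <= cut_value m P h lam Om.
Proof.
case=> l0 _ _; apply: sumr_ge0 => i _; apply: sumr_ge0 => j _.
by rewrite mulr_ge0 ?ell_ge0// sumr_ge0.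
Qed.

Lemma min_cut_le lam (Om : {set node}) :
  is_cut Om -> min_cut m P h lam <= cut_value m P h lam Om.
Proof. by move=> cOm; exact: bigmin_le_cond. Qed.

Lemma min_cut_ge lam x :
  (forall Om : {set node}, is_cut Om -> x <= cut_value m P h lam Om) ->
  x <= min_cut m P h lam.
Proof. by move=> H; apply: le_bigmin => [|Om cOm]; apply: H => //; exact: is_cut_src. Qed.

Lemma min_cut_ge0 lam : is_state_distr m lam -> 0 <= min_cut m P h lam.
Proof. by move=> dl; apply: min_cut_ge => Om _; exact: cut_value_ge0. Qed.

Definition idle : state N := [ffun=> (None, None)].

Lemma valid_idle : valid_state m idle.
Proof.
apply/forallP => i; rewrite ffunE /valid_local/=.
by do !(apply/andP; split => //); apply/implyP.
Qed.

Lemma idle_distr : is_state_distr m (fun s => (s == idle)%:R : R).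
Proof.
split=> [//|s|]; first by case: eqP => // ->; rewrite valid_idle.
by rewrite (bigD1 idle)//= eqxx big1 ?addr0// => s /negbTE ->.
Qed.

Lemma has_sup_rates : has_sup [set x | exists lam, is_state_distr m lam /\
  x = min_cut m P h lam].
Proof.
split; first by exists (min_cut m P h (fun s => (s == idle)%:R)); exists (fun s => (s == idle)%:R);
  split => //; exact: idle_distr.
exists (\sum_i \sum_j ell P h j i) => x [lam [dl ->]].
apply: le_trans (min_cut_le _ is_cut_src) _; rewrite /cut_value.
rewrite [leRHS](bigID (mem [set src N]%SET))/= -[leLHS]addr0 lerD//; last first.
  by apply: sumr_ge0 => i _; apply: sumr_ge0 => j _; exact: ell_ge0.
apply: ler_sum => i _.
rewrite [leRHS](bigID (mem (~: [set src N]%SET)))/= -[leLHS]addr0 lerD//; last first.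
  by apply: sumr_ge0 => j _; exact: ell_ge0.
apply: ler_sum => j _; rewrite ler_piMl ?ell_ge0//.
exact: (distr_sum_le1 _ dl).
Qed.

Lemma min_cut_le_Ccs lam : is_state_distr m lam -> min_cut m P h lam <= Ccs_iid m P h.
Proof.
move=> dl; apply: ub_le_sup; first by have [] := has_sup_rates.
by exists lam.
Qed.

Lemma Ccs_ge0 : 0 <= Ccs_iid m P h.
Proof. exact: le_trans (min_cut_ge0 idle_distr) (min_cut_le_Ccs idle_distr). Qed.

Lemma GAP_ge0 : 0 <= GAP R N m.
Proof.
have e1 : 1 <= expR 1 :> R by rewrite -expR0 ler_expR.
rewrite /GAP !addr_ge0// mulr_ge0// log2_ge0// ler1n//.
by case: m => //=; rewrite expn_gt0.
Qed.

Section code.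
Variables (n M : nat) (c : Defs.code R N n M).
Hypotheses (n0 : (0 < n)%N) (M0 : (0 < M)%N) (adm : admissible m P h c).
Local Notation K := (noise_dim N n).
Local Notation Q := (tprob gam K).

Lemma adm_valid_run w z : run_states h c w z \in valid_seqs m n.
Proof.
have [[A1 [A2 A3]] _ _ _ _] := adm.
rewrite inE; apply/forallP => t; apply/forallP => i; rewrite !ffunE /run_st /node_st.
case: (eqVneq i (src N)) => [->|is_]; first exact: A1.
case: (eqVneq i (dst N)) => [->|id_]; first exact: A3.
by apply: A2; rewrite /is_relay is_ id_.
Qed.

Let mc : measurable_code c := admissible_measurable adm.

Lemma adm_power (i : node) (t : nat) : i != dst N -> (t < n)%N ->
  (\sum_(w < M) \int[Q]_z (cnorm2 (input_at h c w (noise_of z) t i))%:E <=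
   (M%:R * P)%:E)%E.
Proof.
have [_ _ _ _ A] := adm => id_ tn; have := A i t id_ tn.
rewrite (eq_bigr (fun w => \int[Q]_z (cnorm2 (input_at h c w (noise_of z) t i))%:E)%E).
  by move=> H; rewrite EFinM -lee_pdivrMl ?ltr0n.
move=> w _; rewrite (@Enoise_tprob _ _ _ (fun z => (cnorm2 (input_at h c w z t i))%:E))//.
- apply/measurable_EFinP; apply: measurableT_comp; first exact: measurable_cnorm2.
  exact: measurable_input_at.
- by move=> z; rewrite lee_fin cnorm2_ge0.
Qed.

Lemma perr_good (eps : R) : (Perr m h c <= eps%:E)%E ->
  M%:R * (1 - eps) <= \sum_(w < M) Pr Q (good h c w).
Proof.
rewrite /Perr (eq_bigr (fun w => (Pr Q (fun z => decoded h c w (noise_of z) != w))%:E)%E);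
    last first.
  move=> w _; rewrite -PrE; last exact: (mfib_comp (fun i => i != w) (mfib_decoded h w mc)).
  rewrite (@Enoise_tprob _ _ _ (fun z => ((decoded h c w z != w)%:R)%:E))//.
  - apply: (measurable_indicb (b := fun z => decoded h c w (noise_of z) != w)).
    exact: (mfib_comp (fun i => i != w) (mfib_decoded h w mc)).
rewrite sumEFin -EFinM lee_fin ler_pdivrMl ?ltr0n// => H.
have E w : Pr Q (good h c w) = 1 - Pr Q (fun z => decoded h c w (noise_of z) != w).
  apply/eqP; rewrite eq_sym subr_eq; apply/eqP/esym; apply: EFin_inj.
  have mb b : mfib (fun z : K.-tuple C => b (decoded h c w (noise_of z)) : bool).
    exact: (mfib_comp b (mfib_decoded h w mc)).
  rewrite EFinD -(PrE Q (mb (fun i => i == w))) -(PrE Q (mb (fun i => i != w))).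
  rewrite -ge0_intD//.
  - rewrite -[RHS](integral_prob_cst Q)//; apply: eq_integral => z _.
    by case: eqP => _; rewrite ?addr0 ?add0r.
  - exact: (mfib_measurable (fun a : bool => a%:R%R : R) (mb (fun i => i == w))).
  - exact: (mfib_measurable (fun a : bool => a%:R%R : R) (mb (fun i => i != w))).
under eq_bigr do rewrite E.
rewrite sumrB sumr_const card_ord mulrBr mulr1 lerD2l lerN2//.
Qed.

Definition run_state w (t : 'I_n) (z : K.-tuple C) : state N := run_states h c w z t.

Lemma mfib_run_state w t : mfib (run_state w t).
Proof.
rewrite /run_state; have := @mfib_ffun _ _ node _ _ (fun i => mfib_run_st h w mc t i).
rewrite (_ : (fun x => _) = fun z => run_states h c w z t)//.
by apply/funext => z; rewrite ffunE.
Qed.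

Definition lam_code (s : state N) : R := (n%:R * M%:R)^-1 *
  \sum_(w < M) \sum_(t < n) Pr Q (fun z => run_state w t z == s).

Let mstate w t s : mfib (fun z : K.-tuple C => run_state w t z == s).
Proof. exact: (mfib_comp (fun a => a == s) (mfib_run_state w t)). Qed.

Let nM0 : 0 < n%:R * M%:R :> R.
Proof. by rewrite mulr_gt0 ?ltr0n. Qed.

Lemma lam_code_distr : is_state_distr m lam_code.
Proof.
split=> [s|s sinv|].
- rewrite mulr_ge0 ?invr_ge0 ?(ltW nM0)//; apply: sumr_ge0 => w _; apply: sumr_ge0 => t _.
  exact: Pr_ge0.
- rewrite /lam_code big1 ?mulr0// => w _; rewrite big1// => t _.
  rewrite /Pr (eq_integral (fun=> 0%E)) ?integral0// => z _.
  case: eqP => // zs; move: sinv; rewrite -zs /run_state.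
  by have := adm_valid_run w z; rewrite inE => /forallP/(_ t) ->.
rewrite -mulr_sumr exchange_big/=.
rewrite (eq_bigr (fun w => n%:R)); last first.
  move=> w _; rewrite exchange_big/= (eq_bigr (fun=> 1)) ?sumr_const ?card_ord// => t _.
  rewrite -(@Pr_sum _ _ _ Q _ predT (fun s z => run_state w t z == s) xpredT)//.
  - by rewrite /Pr integral_prob_cst.
  - exact: mfib_cst.
  - move=> z; rewrite (bigD1 (run_state w t z))//= eqxx big1 ?addr0// => s.
    by rewrite eq_sym => /negbTE ->.
by rewrite sumr_const card_ord -[n%:R *+ M]mulr_natr mulVf// gt_eqF.
Qed.

Lemma sum_link_pr j i : \sum_(w < M) \sum_(t < n) link_pr h c w t j i =
  n%:R * M%:R * \sum_(s | valid_state m s && active_in s i j) lam_code s.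
Proof.
rewrite mulr_sumr.
under [RHS]eq_bigr do rewrite /lam_code mulrA mulfV ?gt_eqF// mul1r.
rewrite [RHS]exchange_big/=; apply: eq_bigr => w _.
rewrite [RHS]exchange_big/=; apply: eq_bigr => t _.
apply: (@Pr_sum _ _ _ Q _ (fun s => valid_state m s && active_in s i j)
  (fun s z => run_state w t z == s)) => //.
- exact: mfib_link_on.
move=> z; have vz : valid_state m (run_state w t z).
  by have := adm_valid_run w z; rewrite inE => /forallP/(_ t).
have lE : link_on h c w t j i z = active_in (run_state w t z) i j.
  by rewrite /link_on /active_in /run_state !ffunE.
rewrite lE; case E : (active_in (run_state w t z) i j).
  rewrite (bigD1 (run_state w t z)) ?unfold_in ?vz ?E//= eqxx big1 ?addr0// => s /andP[_].
  by rewrite eq_sym => /negbTE ->.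
rewrite big1// => s; rewrite unfold_in => /andP[_ sE]; case: eqP => // zs.
by rewrite zs sE in E.
Qed.

(** [lam_code] averages over messages, times and noise and does not depend on the cut. The bounds of
    all cuts therefore concern one and the same distribution, so they bound its [min_cut], hence
    [Ccs_iid]. *)
Lemma converse_code (eps : R) : (Perr m h c <= eps%:E)%E -> eps < 1 ->
  (1 - eps) * log2 M%:R <= (ln 2)^-1 + n%:R * (Ccs_iid m P h + GAP R N m).
Proof.
move=> perr eps1.
have l2 := ln2_gt0; have l20 : ln (2 : R) != 0 by rewrite gt_eqF.
have n0' : 0 < n%:R :> R by rewrite ltr0n.
have M0' : 0 < M%:R :> R by rewrite ltr0n.
pose S : R := #|[set s : state N | valid_state m s]%SET|%:R.
have VE : #|@valid_seqs N m n|%:R = S ^+ n :> R.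
  rewrite -natrX; congr (_%:R).
  rewrite -[n in RHS](card_ord n) -card_ffun_on; apply: eq_card => sq; rewrite !inE.
  by apply/forallP/ffun_onP => H t; have := H t; rewrite inE.
have S1 : 1 <= S.
  rewrite ler1n card_gt0; apply/set0Pn; exists idle; rewrite inE; exact: valid_idle.
have S0 : 0 < S by exact: lt_le_trans S1.
have lnS : ln S <= ln 2 * (2 * log2 N.+2%:R + N%:R * log2 (card_S1 N m)%:R).
  have cS1 : (0 < card_S1 N m)%N by case: (m) => //=; rewrite expn_gt0.
  have e (x : R) k : ln 2 * (k%:R * log2 x) = ln x *+ k.
    by rewrite mulrCA -ln_log2 mulr_natl.
  rewrite mulrDr !e -!lnXn ?ltr0n// -lnM ?posrE ?exprn_gt0 ?ltr0n//.
  rewrite ler_ln ?posrE ?mulr_gt0 ?exprn_gt0 ?ltr0n//.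
    by rewrite -!natrX -natrM ler_nat card_valid_state.
  by rewrite -(ltr0n R).
suff H : ((1 - eps) * log2 M%:R - (ln 2)^-1) / n%:R - GAP R N m <= Ccs_iid m P h.
  by move: H; rewrite lerBlDr ler_pdivrMr// lerBlDl [_ * n%:R]mulrC.
apply: le_trans (min_cut_le_Ccs lam_code_distr).
apply: min_cut_ge => Om cOm.
have := converse_cut P0 M0 mc adm_valid_run adm_power cOm.
rewrite VE lnXn//.
have lnM0 : 0 <= ln (M%:R : R) by apply: ln_ge0; rewrite ler1n.
move=> H; have := le_trans (ler_wpM2l lnM0 (perr_good perr)) H.
have -> : \sum_(w < M) \sum_(t < n) \sum_(j in ~: Om) \sum_(i in Om)
    link_pr h c w t j i * ln (gain P h j i) =
    M%:R * (n%:R * (ln 2 * cut_value m P h lam_code Om)).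
  rewrite /cut_value exchange_big/= !mulr_sumr.
  transitivity (\sum_(i in Om) \sum_(j in ~: Om) \sum_(w < M) \sum_(t < n)
     link_pr h c w t j i * ln (gain P h j i)).
    rewrite exchange_big/=.
    under eq_bigr do under eq_bigr do rewrite exchange_big/=.
    under eq_bigr do rewrite exchange_big/=.
    rewrite exchange_big/=; apply: eq_bigr => i _.
    under eq_bigr do rewrite exchange_big/=.
    rewrite exchange_big/=; apply: eq_bigr => j _.
    done.
  apply: eq_bigr => i _; rewrite !mulr_sumr; apply: eq_bigr => j _.
  transitivity ((\sum_(w < M) \sum_(t < n) link_pr h c w t j i) * ln (gain P h j i)).
    by rewrite mulr_suml; apply: eq_bigr => w _; rewrite mulr_suml.
  rewrite sum_link_pr (ln_log2 (gain P h j i)) /ell -/(gain P h j i); ring.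
rewrite -mulrDr mulrCA ler_pM2l// => {}H.
rewrite lerBlDr ler_pdivrMr// lerBlDl.
rewrite -(ler_pM2l l2) mulrCA -ln_log2 mulrDr mulfV//.
have -> : GAP R N m = N.+1%:R / ln 2 +
    (2 * log2 N.+2%:R + N%:R * log2 (card_S1 N m)%:R).
  by rewrite /GAP {1}/log2 expRK mul1r addrA.
move: H lnS; set G := 2 * log2 _ + _; set X := cut_value _ _ _ _ _ => H lnS.
have -> : ln 2 * ((X + (N.+1%:R / ln 2 + G)) * n%:R) =
    n%:R * (ln 2 * X) + n%:R * N.+1%:R + n%:R * (ln 2 * G) by field.
have : n%:R * ln S <= n%:R * (ln 2 * G) by rewrite ler_pM2l.
by move: H; rewrite mulrC -[ln S *+ n]mulr_natl; lra.
Qed.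

End code.

Lemma capacity_le : (capacity m P h <= (Ccs_iid m P h + GAP R N m)%:E)%E.
Proof.
apply: ge_ereal_sup => _ [r ar <-]; rewrite lee_fin leNgt; apply/negP.
set G := _ + _ => Gr.
have G0 : 0 <= G by rewrite addr_ge0 ?Ccs_ge0 ?GAP_ge0.
have r0 : 0 < r by exact: le_lt_trans Gr.
(* Makes [(1 - eps) * r] the midpoint of [G] and [r]. *)
pose eps := (r - G) / (2 * r).
have eps0 : 0 < eps by rewrite divr_gt0 ?subr_gt0 ?mulr_gt0.
have eps1 : eps < 1 by rewrite ltr_pdivrMr ?mulr_gt0//; lra.
have l2 := ln2_gt0.
(* From this length on, the excess [n * (r - G) / 2] is larger than the additive constant
   [(ln 2)^-1]. *)
pose n1 := (Num.truncn (2 / ln 2 / (r - G))).+1.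
have [n [M [c [[nn n0] M0 rM adm perr]]]] := ar eps eps0 n1.
have := converse_code n0 M0 adm perr eps1; rewrite -/G => H.
have : (1 - eps) * (n%:R * r) <= (ln 2)^-1 + n%:R * G.
  by apply: le_trans H; rewrite ler_pM2l// subr_gt0.
have -> : (1 - eps) * (n%:R * r) = n%:R * ((r + G) / 2).
  by rewrite /eps; field; rewrite gt_eqF.
have : 2 / ln 2 / (r - G) < n%:R.
  by apply: lt_le_trans (truncnS_gt _) _; rewrite ler_nat.
rewrite ltr_pdivrMr ?subr_gt0// -[2 / ln 2]/(2 * (ln 2)^-1).
by nra.
Qed.

End rates.
End converse.

(** * Coding for a single link *)

Section letter.
Context {R : realType}.
Local Notation C := (R * R)%type.
Variables (a b : R).
Hypotheses (b0 : 0 < b).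
Let sg : R := 1 + a ^+ 2.

Let sg1 : 1 <= sg. Proof. by rewrite lerDl sqr_ge0. Qed.
Let sg0 : 0 < sg. Proof. exact: lt_le_trans sg1. Qed.

(* A bounded peak power limits what the errors of earlier relays can cost in average
   power. *)
Definition clip (u : C) : C := if cnorm2 u <= b then u else 0.

(* Log-likelihood ratio of the output: [CN(a * clip u, 1)] against [CN(0, 1 + a^2)]. *)
Definition theta (u y : C) : R :=
  ln sg + cnorm2 y / sg - cnorm2 (cmul (- a, 0) (clip u) + y).

Lemma measurable_clip : measurable_fun setT clip.
Proof.
apply: measurable_fun_ifT => //.
by apply: measurable_fun_ler => //; exact: measurable_cnorm2.
Qed.

Lemma measurable_theta d (X : measurableType d) (u y : X -> C) :
  measurable_fun setT u -> measurable_fun setT y ->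
  measurable_fun setT (fun x => theta (u x) (y x)).
Proof.
move=> mu my; apply: measurable_funB.
  apply: measurable_funD => //; apply: measurable_funM => //.
  by apply: measurableT_comp => //; exact: measurable_cnorm2.
apply: measurableT_comp; first exact: measurable_cnorm2.
apply: measurable_cadd => //; apply: measurable_cmul.
by apply: measurableT_comp => //; exact: measurable_clip.
Qed.

Lemma cmul_cancel (x : R) (v z : C) : cmul (- x, 0) v + (cmul (x, 0) v + z) = z.
Proof.
by rewrite !cmul_realE; case: z v => z1 z2 [u1 u2]; congr pair => /=; ring.
Qed.

Lemma cnorm2_0 : cnorm2 (0 : C) = 0.
Proof. by rewrite /cnorm2/= expr0n/= addr0. Qed.

Lemma cnorm2_clip_le u : cnorm2 (clip u) <= b.
Proof. by rewrite /clip; case: ifP => // _; rewrite cnorm2_0 ltW. Qed.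

Lemma cnorm2_clip_le' u : cnorm2 (clip u) <= cnorm2 u.
Proof. by rewrite /clip; case: ifP => // _; rewrite cnorm2_0 cnorm2_ge0. Qed.

Lemma cnorm2_tail u : ~~ (cnorm2 u <= b) -> 1 <= b^-1 * cnorm2 u.
Proof. by rewrite -ltNge => /ltW ub; rewrite ler_pdivlMl// mulr1. Qed.

Lemma gam_norm2 : (\int[gam]_z (cnorm2 z)%:E <= (1 : R)%:E)%E.
Proof.
have := gam_norm_le (0 : C); rewrite cnorm2_0 addr0.
by under eq_integral do rewrite addr0.
Qed.

(** Without clipping the mean would be exactly 1, since averaging [CN(a * u, 1)] over [u] gives
    [CN(0, 1 + a^2)]. A clipped letter contributes at most [sg], and by Markov's inequality it has
    probability at most [b^-1]. *)
Lemma theta_wrong y :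
  (\int[gam]_u (expR (theta u y))%:E <= (1 + sg / b)%:E)%E.
Proof.
pose f u := sg * expR (cnorm2 y / sg) * expR (- 1 * cnorm2 (cmul (- a, 0) u + y)).
have mf0 : measurable_fun setT (fun u : C => expR (- 1 * cnorm2 (cmul (- a, 0) u + y))).
  apply: measurableT_comp => //; apply: measurable_funM => //.
  by apply: measurableT_comp; [exact: measurable_cnorm2|exact: measurable_caff].
have mf : measurable_fun setT f by exact: measurable_funM.
apply: (@le_trans _ _ (\int[gam]_u (f u + sg / b * cnorm2 u)%:E)%E).
  apply: ge0_int_le.
  - by apply: measurableT_comp => //; exact: measurable_theta.
  - apply: measurable_funD => //; apply: measurable_funM => //.
    exact: measurable_cnorm2.
  - by move=> u; exact: expR_ge0.
  move=> u; rewrite /theta /clip; case: ifPn => [ub|ub].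
    rewrite /f !expRD lnK ?posrE// mulN1r -[leLHS]addr0 lerD//.
    by rewrite mulr_ge0 ?cnorm2_ge0// divr_ge0 ?ltW.
  apply: (@le_trans _ _ sg).
    rewrite -[leRHS](lnK (x := sg))// ler_expR cmul0r add0r -addrA gerDl.
    rewrite subr_le0 ler_pdivrMr// ler_peMr// cnorm2_ge0//.
  rewrite -[leLHS]add0r lerD//; first by rewrite !mulr_ge0 ?expR_ge0// ltW.
  rewrite -mulrA -[leLHS]mulr1 ler_pM2l//; exact: cnorm2_tail.
rewrite ge0_intD//; first last.
- by move=> u; rewrite mulr_ge0 ?cnorm2_ge0// divr_ge0 ?ltW.
- by move=> u; rewrite !mulr_ge0 ?expR_ge0// ltW.
- by apply: measurable_funM => //; exact: measurable_cnorm2.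
rewrite EFinD; apply: leeD.
  rewrite ge0_intZl//; last by rewrite mulr_ge0 ?expR_ge0// ltW.
  rewrite gam_expR; last by rewrite mul1r sqrrN.
  rewrite -EFinM lee_fin mul1r sqrrN -/sg.
  rewrite mulrACA mulfV ?gt_eqF// mul1r mulN1r mulNr -expRD subrr expR0//.
rewrite ge0_intZl//; last 3 first.
- exact: measurable_cnorm2.
- by move=> u; exact: cnorm2_ge0.
- by rewrite divr_ge0 ?ltW.
rewrite -[X in (_ <= X)%E]mule1; apply: lee_wpmul2l; first by rewrite lee_fin divr_ge0 ?ltW.
exact: gam_norm2.
Qed.

(** At its own output [theta] is [ln sg + |y|^2 / sg - |z|^2]. The inner integral over the letter
    and the outer one over the noise are both instances of [gam_expR]. Clipped letters are bounded
    by [b^-1 * |u|^2] times [expR (s * |z|^2)], whose mean over the noise is [(1 - s)^-1]. *)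
Lemma theta_right (s : R) : 0 < s -> s < 1 ->
  (\int[gam]_z \int[gam]_u
     (expR (- s * theta u (cmul (a, 0) (clip u) + z)))%:E <=
   (expR (- s * ln sg) * ((1 - s ^+ 2)^-1 + (b * (1 - s))^-1))%:E)%E.
Proof.
move=> s0 s1.
pose t := s / sg.
have t0 : 0 < t by rewrite divr_gt0.
have ta : 0 < 1 + t * a ^+ 2 by rewrite ltr_wpDr// mulr_ge0 ?sqr_ge0// ltW.
have s1' : 0 < 1 - s by rewrite subr_gt0.
have s2' : 0 < 1 - s ^+ 2 by rewrite subr_gt0 expr_lt1// ltW.
have m1 (z : C) : measurable_fun setT (fun u : C => expR (- t * cnorm2 (cmul (a, 0) u + z))).
  apply: measurableT_comp => //; apply: measurable_funM => //.
  by apply: measurableT_comp; [exact: measurable_cnorm2|exact: measurable_caff].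
have ms (w : R) : measurable_fun setT (fun z : C => expR (w * cnorm2 z)).
  apply: measurableT_comp => //; apply: measurable_funM => //.
  exact: measurable_cnorm2.
have inner (z : C) : (\int[gam]_u (expR (- s * theta u (cmul (a, 0) (clip u) + z)))%:E <=
   (expR (- s * ln sg) * ((1 + t * a ^+ 2)^-1 *
      expR ((s - t / (1 + t * a ^+ 2)) * cnorm2 z) + b^-1 * expR (s * cnorm2 z)))%:E)%E.
  pose k := expR (- s * ln sg) * expR (s * cnorm2 z).
  have k0 : 0 <= k by rewrite mulr_ge0 ?expR_ge0.
  apply: (@le_trans _ _ (\int[gam]_u (k * (expR (- t * cnorm2 (cmul (a, 0) u + z)) +
     b^-1 * cnorm2 u))%:E)%E).
    apply: ge0_int_le.
    - apply: measurableT_comp => //; apply: measurable_funM => //.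
      apply: measurable_theta => //; apply: measurable_cadd => //.
      by apply: measurable_cmul; exact: measurable_clip.
    - apply: measurable_funM => //; apply: measurable_funD => //.
      by apply: measurable_funM => //; exact: measurable_cnorm2.
    - by move=> u; exact: expR_ge0.
    move=> u.
    have -> : expR (- s * theta u (cmul (a, 0) (clip u) + z)) =
        k * expR (- t * cnorm2 (cmul (a, 0) (clip u) + z)).
      rewrite /k /theta -!expRD; congr expR.
      have -> : cmul (- a, 0) (clip u) + (cmul (a, 0) (clip u) + z) = z.
        exact: cmul_cancel.
      by rewrite /t; field; rewrite gt_eqF.
    rewrite ler_wpM2l// /clip; case: ifPn => ub.
      by rewrite lerDl mulr_ge0 ?cnorm2_ge0// invr_ge0 ltW.
    apply: (@le_trans _ _ 1).
      by rewrite -[leRHS]expR0 ler_expR mulNr oppr_le0 mulr_ge0 ?cnorm2_ge0// ltW.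
    by rewrite -[leLHS]add0r lerD ?expR_ge0//; exact: cnorm2_tail.
  rewrite ge0_intZl//; first last.
  - by move=> u; rewrite addr_ge0 ?expR_ge0// mulr_ge0 ?cnorm2_ge0// invr_ge0 ltW.
  - apply: measurable_funD => //.
    by apply: measurable_funM => //; exact: measurable_cnorm2.
  rewrite ge0_intD//; first last.
  - by move=> u; rewrite mulr_ge0 ?cnorm2_ge0// invr_ge0 ltW.
  - by apply: measurable_funM => //; exact: measurable_cnorm2.
  rewrite gam_expR// ge0_intZl//; last 3 first.
  - exact: measurable_cnorm2.
  - by move=> u; exact: cnorm2_ge0.
  - by rewrite invr_ge0 ltW.
  apply: (@le_trans _ _ (k%:E * (((1 + t * a ^+ 2)^-1 *
      expR (- t * cnorm2 z / (1 + t * a ^+ 2)))%:E + b^-1%:E * 1%:E))%E).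
    apply: lee_wpmul2l; first by rewrite lee_fin.
    apply: leeD => //; apply: lee_wpmul2l; first by rewrite lee_fin invr_ge0 ltW.
    exact: gam_norm2.
  rewrite -EFinM lee_fin /k mulr1 le_eqVlt; apply/orP; left; apply/eqP.
  rewrite -[LHS]mulrA; congr (_ * _); rewrite [LHS]mulrDr; congr (_ + _); last exact: mulrC.
  by rewrite mulrCA -expRD; congr (_ * expR _); field; rewrite gt_eqF.
pose t' := t / (1 + t * a ^+ 2) - s.
(* The two integrations produce the factors [1 + t * a ^+ 2] and [1 + t']; their product differs
   from 1 only to second order in [s]. *)
have t'E : (1 + t * a ^+ 2) * (1 + t' * 1 ^+ 2) = 1 - s ^+ 2 * (a ^+ 2 / sg).
  rewrite /t' /t /sg; field.
  by rewrite -/sg !gt_eqF// ltr_wpDr// mulr_ge0 ?sqr_ge0// ltW.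
have as1 : 1 - s ^+ 2 <= 1 - s ^+ 2 * (a ^+ 2 / sg).
  by rewrite lerD2l lerN2 ler_piMr ?sqr_ge0// ler_pdivrMr// mul1r /sg; lra.
have D' : 0 < 1 + t' * 1 ^+ 2.
  by rewrite -(pmulr_rgt0 _ ta) t'E; exact: lt_le_trans s2' as1.
have D'' : 0 < 1 + - s * 1 ^+ 2 by rewrite expr1n mulr1.
pose K1 := expR (- s * ln sg).
have K10 : 0 <= K1 by exact: expR_ge0.
apply: (@le_trans _ _ (\int[gam]_z (K1 * ((1 + t * a ^+ 2)^-1 *
      expR ((- t') * cnorm2 (cmul (1, 0) z + 0)) +
      b^-1 * expR (- (- s) * cnorm2 (cmul (1, 0) z + 0))))%:E)%E).
  apply: ge0_le_integral => //.
  - by move=> z _; apply: integral_ge0 => u _; rewrite lee_fin expR_ge0.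
  - apply: (measurable_fun_fubini_tonelli_F (m2 := gam)
      (fun p : C * C => (expR (- s * theta p.2 (cmul (a, 0) (clip p.2) + p.1)))%:E)).
      apply/measurable_EFinP; apply: measurableT_comp => //; apply: measurable_funM => //.
      apply: measurable_theta => //; apply: measurable_cadd => //.
      by apply: measurable_cmul; apply: measurableT_comp => //; exact: measurable_clip.
    by move=> p; rewrite lee_fin expR_ge0.
  - apply/measurable_EFinP; apply: measurable_funM => //; apply: measurable_funD;
      apply: measurable_funM => //; under eq_fun do rewrite cmul1 addr0; exact: ms.
  - move=> z _; apply: le_trans (inner z) _.
    by rewrite lee_fin cmul1 addr0 opprB opprK.
have mm (w : R) : measurable_fun setT (fun z : C => expR (- w * cnorm2 (cmul (1, 0) z + 0))).
  by under eq_fun do rewrite cmul1 addr0; exact: ms.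
have ita : 0 <= (1 + t * a ^+ 2)^-1 by rewrite invr_ge0 ltW.
have ib : 0 <= b^-1 by rewrite invr_ge0 ltW.
rewrite ge0_intZl//; first last.
- by move=> z; rewrite addr_ge0// mulr_ge0// expR_ge0.
- by apply: measurable_funD; exact: measurable_funM.
rewrite ge0_intD//; first last.
- by move=> z; rewrite mulr_ge0// expR_ge0.
- by move=> z; rewrite mulr_ge0// expR_ge0.
- exact: measurable_funM.
- exact: measurable_funM.
rewrite !ge0_intZl//.
rewrite !gam_expR// cnorm2_0 !mulr0 !mul0r expR0 !mulr1.
rewrite -EFinM lee_fin; apply: ler_wpM2l => //; apply: lerD.
  have := as1; rewrite -t'E expr1n mulr1 -invfM => H.
  rewrite lef_pV2 ?posrE// ?mulr_gt0//; last by move: D'; rewrite expr1n mulr1.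
by rewrite expr1n mulr1 -invfM.
Qed.

End letter.

Lemma prode_le_const (R : realType) K (f : 'I_K -> \bar R) (q : R) :
  (forall t, 0 <= f t)%E -> (forall t, f t <= q%:E)%E ->
  (\prod_(t < K) f t <= (q ^+ K)%:E)%E.
Proof.
elim: K f => [|K IH] f f0 fq; first by rewrite big_ord0 expr0.
rewrite big_ord_recl exprS EFinM; apply: lee_pmul => //; first exact: prode_ge0.
exact: IH.
Qed.

(** * Random codebooks *)

Section codebook.
Context {R : realType}.
Local Notation C := (R * R)%type.
Variables (L M : nat) (a b s tau v u : R).
Hypotheses (b0 : 0 < b) (s0 : 0 < s) (s1 : s < 1) (v0 : 0 < v) (v1 : v < 1).
Local Notation W := (L.-tuple C).
Local Notation Q := (tprob (@gam R) L).
Local Notation QQ := (tprob Q M).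
Let sg : R := 1 + a ^+ 2.

Definition rcv (xi z : W) (t : 'I_L) : C := cmul (a, 0) (clip b (tnth xi t)) + tnth z t.

Definition margin (xi : W) (y : 'I_L -> C) : R :=
  \sum_(t < L) (theta a b (tnth xi t) (y t) - tau).

(** [qmiss], [qconf] and [qpow] are the bases of three exponential bounds: the sent codeword fails
    the threshold, another codeword passes it, and the average power of the codebook at a given time
    exceeds [u]. The first two are raised to the block length, the last to the number of
    codewords. *)
Definition qmiss : R :=
  expR (s * tau) * (expR (- s * ln sg) * ((1 - s ^+ 2)^-1 + (b * (1 - s))^-1)).
Definition qconf : R := expR (- tau) * (1 + sg / b).
Definition qpow : R := expR (- (v * u)) * (1 - v)^-1.

Let sg1 : 1 <= sg. Proof. by rewrite lerDl sqr_ge0. Qed.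

Let mtnth d (X : measurableType d) (f : X -> W) t :
  measurable_fun setT f -> measurable_fun setT (fun x => tnth (f x) t).
Proof. exact: measurable_tnth_comp. Qed.

Lemma measurable_rcv d (X : measurableType d) (f g : X -> W) t :
  measurable_fun setT f -> measurable_fun setT g ->
  measurable_fun setT (fun x => rcv (f x) (g x) t).
Proof.
move=> mf mg; apply: measurable_cadd; last exact: mtnth.
apply: measurable_cmul; apply: measurableT_comp; first exact: measurable_clip.
exact: mtnth.
Qed.

Lemma measurable_margin d (X : measurableType d) (f : X -> W) (y : X -> 'I_L -> C) :
  measurable_fun setT f -> (forall t, measurable_fun setT (y ^~ t)) ->
  measurable_fun setT (fun x => margin (f x) (y x)).
Proof.
move=> mf my; apply: measurable_sum => t; apply: measurable_funB => //.
by apply: measurable_theta => //; exact: mtnth.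
Qed.

Lemma int_fst (f : C -> R) (t : 'I_L) : measurable_fun setT f -> (forall x, 0 <= f x) ->
  (\int[Q]_z (f (tnth z t))%:E = \int[gam]_x (f x)%:E)%E.
Proof.
move=> mf f0.
rewrite (tprob_resample gam t (F := fun z => (f (tnth z t))%:E)).
- under eq_integral do under eq_integral do rewrite tnth_tset eqxx.
  by rewrite integral_prob_cst//; apply: integral_ge0 => x _; rewrite lee_fin.
- by apply/measurable_EFinP; apply: measurableT_comp => //; exact: measurable_tnth.
- by move=> z; rewrite lee_fin.
Qed.

Lemma int_prod (f : 'I_L -> C -> R) : (forall t, measurable_fun setT (f t)) ->
  (forall t x, 0 <= f t x) ->
  (\int[Q]_z (\prod_(t < L) f t (tnth z t))%:E = \prod_(t < L) \int[gam]_x (f t x)%:E)%E.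
Proof.
move=> mf f0; under eq_integral do rewrite -prodEFin.
rewrite (@tprob_prod _ _ _ gam L (fun t x => (f t x)%:E))//.
by move=> t; apply/measurable_EFinP.
Qed.

Lemma miss_bound : (\int[Q]_xi \int[Q]_z (expR (- s * margin xi (rcv xi z)))%:E <=
  (qmiss ^+ L)%:E)%E.
Proof.
pose g (x z : C) := expR (s * tau) * expR (- s * theta a b x (cmul (a, 0) (clip b x) + z)).
have mg d (X : measurableType d) (f1 f2 : X -> C) : measurable_fun setT f1 ->
    measurable_fun setT f2 -> measurable_fun setT (fun x => g (f1 x) (f2 x)).
  move=> m1 m2; apply: measurable_funM => //; apply: measurableT_comp => //.
  apply: measurable_funM => //; apply: measurable_theta => //.
  apply: measurable_cadd => //; apply: measurable_cmul.
  by apply: measurableT_comp => //; exact: measurable_clip.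
have g0 x z : 0 <= g x z by rewrite mulr_ge0 ?expR_ge0.
have E xi z : expR (- s * margin xi (rcv xi z)) =
    \prod_(t < L) g (tnth xi t) (tnth z t).
  rewrite /margin mulr_sumr expR_sum; apply: eq_bigr => t _.
  by rewrite /g -expRD; congr expR; rewrite /rcv; ring.
under eq_integral do under eq_integral do rewrite E.
have mG : measurable_fun setT (fun p : W * W =>
    (\prod_(t < L) g (tnth p.1 t) (tnth p.2 t))%:E).
  by apply/measurable_EFinP; apply: measurable_prod => t _; apply: mg; exact: mtnth.
rewrite (fubini_tonelli (m1 := Q) (m2 := Q) (fun p : W * W =>
    (\prod_(t < L) g (tnth p.1 t) (tnth p.2 t))%:E)) //=; last first.
  by move=> p; rewrite lee_fin prodr_ge0.
pose G z := fine (\int[gam]_x (g x z)%:E).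
have mGam : measurable_fun setT (fun z => \int[gam]_x (g x z)%:E)%E.
  apply: (measurable_fun_fubini_tonelli_G (m1 := gam) (fun p : C * C => (g p.1 p.2)%:E)).
    by apply/measurable_EFinP; apply: mg.
  by move=> p; rewrite lee_fin.
rewrite (eq_integral (fun z : W => \prod_(t < L) \int[gam]_x (g x (tnth z t))%:E)%E);
    last first.
  move=> z _; apply: (int_prod (f := fun t x => g x (tnth z t))) => // t.
  by apply: mg => //; exact: measurable_cst.
rewrite (@tprob_prod _ _ _ gam L (fun t z => \int[gam]_x (g x z)%:E)%E)//; last first.
  by move=> t z; apply: integral_ge0 => x _; rewrite lee_fin.
apply: prode_le_const.
- move=> t; apply: integral_ge0 => z _; apply: integral_ge0 => x _; rewrite lee_fin//.
- move=> t; apply: (@le_trans _ _ ((expR (s * tau))%:E * \int[gam]_z \int[gam]_x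
    (expR (- s * theta a b x (cmul (a, 0) (clip b x) + z)))%:E)%E).
    rewrite le_eqVlt; apply/orP; left; apply/eqP.
    rewrite -ge0_integralZl//; last 2 first.
    - apply: (measurable_fun_fubini_tonelli_G (m1 := gam) (fun p : C * C =>
        (expR (- s * theta a b p.1 (cmul (a, 0) (clip b p.1) + p.2)))%:E)).
        apply/measurable_EFinP; apply: measurableT_comp => //; apply: measurable_funM => //.
        apply: measurable_theta => //; apply: measurable_cadd => //; apply: measurable_cmul.
        by apply: measurableT_comp => //; exact: measurable_clip.
      by move=> p; rewrite /= lee_fin expR_ge0.
    - by move=> z _; apply: integral_ge0 => x _; rewrite lee_fin expR_ge0.
    apply: eq_integral => z _; rewrite -ge0_intZl ?expR_ge0//.
    apply: measurableT_comp => //; apply: measurable_funM => //.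
    apply: measurable_theta => //; apply: measurable_cadd => //; apply: measurable_cmul.
    exact: measurable_clip.
  rewrite /qmiss EFinM; apply: lee_wpmul2l; first by rewrite lee_fin expR_ge0.
  exact: theta_right.
Qed.

Lemma conf_bound (y : 'I_L -> C) : (\int[Q]_xi (expR (margin xi y))%:E <= (qconf ^+ L)%:E)%E.
Proof.
pose g (t : 'I_L) (x : C) := expR (- tau) * expR (theta a b x (y t)).
have mg t : measurable_fun setT (g t).
  apply: measurable_funM => //; apply: measurableT_comp => //.
  exact: measurable_theta.
have g0 t x : 0 <= g t x by rewrite mulr_ge0 ?expR_ge0.
have E xi : expR (margin xi y) = \prod_(t < L) g t (tnth xi t).
  rewrite /margin expR_sum; apply: eq_bigr => t _.
  by rewrite /g -expRD addrC.
under eq_integral do rewrite E.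
rewrite int_prod//; apply: prode_le_const.
- by move=> t; apply: integral_ge0 => x _; rewrite lee_fin.
- move=> t; rewrite ge0_intZl ?expR_ge0//; last first.
    apply: measurableT_comp => //; exact: measurable_theta.
  rewrite /qconf EFinM; apply: lee_wpmul2l; first by rewrite lee_fin expR_ge0.
  exact: theta_wrong.
Qed.

Definition excess (t : 'I_L) (xi : W) : R := v * (cnorm2 (clip b (tnth xi t)) - u).

Lemma measurable_excess t : measurable_fun setT (excess t).
Proof.
apply: measurable_funM => //; apply: measurable_funB => //.
apply: measurableT_comp; first exact: measurable_cnorm2.
by apply: measurableT_comp; [exact: measurable_clip|exact: measurable_tnth].
Qed.

Lemma pow_bound t : (\int[Q]_xi (expR (excess t xi))%:E <= qpow%:E)%E.
Proof.
pose f (x : C) := expR (- (v * u)) * expR (v * cnorm2 x).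
have mf : measurable_fun setT f.
  apply: measurable_funM => //; apply: measurableT_comp => //.
  by apply: measurable_funM => //; exact: measurable_cnorm2.
apply: (@le_trans _ _ (\int[Q]_xi (f (tnth xi t))%:E)%E).
  apply: ge0_int_le.
  - by apply: measurableT_comp => //; exact: measurable_excess.
  - by apply: measurableT_comp => //; exact: measurable_tnth.
  - by move=> xi; exact: expR_ge0.
  - move=> xi; rewrite /f -expRD ler_expR /excess mulrBr addrC lerD2l ler_pM2l//.
    exact: cnorm2_clip_le'.
rewrite int_fst//; last by move=> x; rewrite mulr_ge0 ?expR_ge0.
rewrite ge0_intZl ?expR_ge0//; last first.
  apply: measurableT_comp => //; apply: measurable_funM => //; exact: measurable_cnorm2.
have D0 : 0 < 1 + - v * 1 ^+ 2 by rewrite expr1n mulr1 subr_gt0.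
have := gam_expR (0 : C) D0; under eq_integral do rewrite cmul1 addr0 opprK.
by rewrite cnorm2_0 mulr0 mul0r expR0 mulr1 expr1n mulr1 => ->; rewrite -EFinM.
Qed.

(** Bounds the sum of the error probabilities: a margin [x <= 0] of the sent codeword has
    [1 <= expR (- s * x)], a positive margin of another one has [1 <= expR x]. As a sum of integrals
    of exponentials it can be averaged over codebooks by Tonelli. *)
Definition risk (X : M.-tuple W) : \bar R :=
  (\sum_(i < M) \int[Q]_z (expR (- s * margin (tnth X i) (rcv (tnth X i) z)))%:E +
   \sum_(i < M) \sum_(j < M | j != i)
     \int[Q]_z (expR (margin (tnth X j) (rcv (tnth X i) z)))%:E)%E.

(** At least 1 as soon as the average power at some time exceeds [u]. All [L] times must be good at
    once, so each is given an exponential moment over the [M] independent codewords. *)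
Definition power_penalty (X : M.-tuple W) : R :=
  \sum_(t < L) expR (\sum_(i < M) excess t (tnth X i)).

Let mX i : measurable_fun setT (fun p : M.-tuple W * W => tnth p.1 i).
Proof. by apply: measurable_tnth_comp. Qed.

Let mmiss i : measurable_fun setT (fun p : M.-tuple W * W =>
  (expR (- s * margin (tnth p.1 i) (rcv (tnth p.1 i) p.2)))%:E).
Proof.
apply/measurable_EFinP; apply: measurableT_comp => //; apply: measurable_funM => //.
by apply: measurable_margin => // t; exact: measurable_rcv.
Qed.

Let mconf i j : measurable_fun setT (fun p : M.-tuple W * W =>
  (expR (margin (tnth p.1 j) (rcv (tnth p.1 i) p.2)))%:E).
Proof.
apply/measurable_EFinP; apply: measurableT_comp => //.
by apply: measurable_margin => // t; exact: measurable_rcv.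
Qed.

Lemma measurable_risk : measurable_fun setT risk.
Proof.
apply: emeasurable_funD; apply: emeasurable_sum => i.
  apply: (measurable_fun_fubini_tonelli_F (m2 := Q) (fun p : M.-tuple W * W =>
    (expR (- s * margin (tnth p.1 i) (rcv (tnth p.1 i) p.2)))%:E));
    first exact: mmiss.
  by move=> p; rewrite /= lee_fin expR_ge0.
under eq_fun do rewrite big_mkcond/=.
apply: emeasurable_sum => j; case: (j != i); last exact: measurable_cst.
apply: (measurable_fun_fubini_tonelli_F (m2 := Q) (fun p : M.-tuple W * W =>
  (expR (margin (tnth p.1 j) (rcv (tnth p.1 i) p.2)))%:E));
    first exact: mconf.
by move=> p; rewrite /= lee_fin expR_ge0.
Qed.

Lemma risk_ge0 X : (0 <= risk X)%E.
Proof.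
apply: adde_ge0; apply: sume_ge0 => i _.
  by apply: integral_ge0 => z _; rewrite lee_fin expR_ge0.
by apply: sume_ge0 => j _; apply: integral_ge0 => z _; rewrite lee_fin expR_ge0.
Qed.

Lemma risk_mean : (\int[QQ]_X risk X <= (M%:R * (qmiss ^+ L + M%:R * qconf ^+ L))%:E)%E.
Proof.
have mR1 i : measurable_fun setT (fun X : M.-tuple W =>
    \int[Q]_z (expR (- s * margin (tnth X i) (rcv (tnth X i) z)))%:E)%E.
  apply: (measurable_fun_fubini_tonelli_F (m2 := Q) (fun p : M.-tuple W * W =>
    (expR (- s * margin (tnth p.1 i) (rcv (tnth p.1 i) p.2)))%:E));
    first exact: mmiss.
  by move=> p; rewrite /= lee_fin expR_ge0.
have mR2 i j : measurable_fun setT (fun X : M.-tuple W =>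
    \int[Q]_z (expR (margin (tnth X j) (rcv (tnth X i) z)))%:E)%E.
  apply: (measurable_fun_fubini_tonelli_F (m2 := Q) (fun p : M.-tuple W * W =>
    (expR (margin (tnth p.1 j) (rcv (tnth p.1 i) p.2)))%:E));
    first exact: mconf.
  by move=> p; rewrite /= lee_fin expR_ge0.
have R10 i (X : M.-tuple W) : (0 <= \int[Q]_z
    (expR (- s * margin (tnth X i) (rcv (tnth X i) z)))%:E)%E.
  by apply: integral_ge0 => z _; rewrite lee_fin expR_ge0.
have R20 i j (X : M.-tuple W) : (0 <= \int[Q]_z
    (expR (margin (tnth X j) (rcv (tnth X i) z)))%:E)%E.
  by apply: integral_ge0 => z _; rewrite lee_fin expR_ge0.
have mR2s i : measurable_fun setT (fun X : M.-tuple W => \sum_(j < M | j != i)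
    \int[Q]_z (expR (margin (tnth X j) (rcv (tnth X i) z)))%:E)%E.
  under eq_fun do rewrite big_mkcond/=.
  by apply: emeasurable_sum => j; case: (j != i); last exact: measurable_cst.
rewrite ge0_integralD//; last 4 first.
- by move=> X _; apply: sume_ge0.
- by apply: emeasurable_sum.
- by move=> X _; apply: sume_ge0 => i _; apply: sume_ge0.
- by apply: emeasurable_sum.
rewrite !ge0_integral_sum//; last by move=> i X _; apply: sume_ge0.
rewrite mulrDr EFinD; apply: leeD.
  rewrite mulr_natl -[X in _ *+ X](card_ord M) -sumr_const -sumEFin.
  apply: lee_sum => i _.
  rewrite (tprob_resample Q i (F := fun X : M.-tuple W => \int[Q]_z
    (expR (- s * margin (tnth X i) (rcv (tnth X i) z)))%:E)%E)//.
  under eq_integral do under eq_integral do rewrite tnth_tset eqxx.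
  rewrite integral_prob_cst; first exact: miss_bound.
  by apply: integral_ge0 => x _; apply: integral_ge0 => z _; rewrite lee_fin expR_ge0.
rewrite mulr_natl -[X in _ *+ X](card_ord M) -sumr_const -sumEFin.
apply: lee_sum => i _.
rewrite (eq_integral (fun X : M.-tuple W => \sum_(j < M) (if j != i then
    \int[Q]_z (expR (margin (tnth X j) (rcv (tnth X i) z)))%:E else 0))%E); last first.
  by move=> X _; rewrite big_mkcond.
rewrite ge0_integral_sum//; last 2 first.
- by move=> j; case: (j != i) => //; exact: measurable_cst.
- by move=> j X _; case: ifP.
rewrite mulr_natl -[X in _ *+ X](card_ord M) -sumr_const -sumEFin.
apply: lee_sum => j _; case: (eqVneq j i) => [_|ji] /=.
  rewrite integral0 lee_fin exprn_ge0//.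
  by rewrite mulr_ge0 ?expR_ge0// addr_ge0// divr_ge0// ltW// (lt_le_trans ltr01 sg1).
rewrite (fubini_tonelli (m1 := QQ) (m2 := Q) (fun p : M.-tuple W * W =>
  (expR (margin (tnth p.1 j) (rcv (tnth p.1 i) p.2)))%:E))//=.
rewrite -[leRHS](integral_prob_cst Q); last first.
  rewrite lee_fin exprn_ge0// mulr_ge0 ?expR_ge0// addr_ge0// divr_ge0// ltW//.
  exact: (lt_le_trans ltr01 sg1).
apply: ge0_le_integral => //.
- by move=> z _; apply: integral_ge0 => X _; rewrite lee_fin expR_ge0.
- apply: (measurable_fun_fubini_tonelli_G (m1 := QQ) (fun p : M.-tuple W * W =>
    (expR (margin (tnth p.1 j) (rcv (tnth p.1 i) p.2)))%:E));
    first exact: mconf.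
  by move=> p; rewrite /= lee_fin expR_ge0.
move=> z _.
have mz : measurable_fun setT (fun X : M.-tuple W =>
    (expR (margin (tnth X j) (rcv (tnth X i) z)))%:E).
  apply/measurable_EFinP; apply: measurableT_comp => //.
  apply: measurable_margin; first exact: measurable_tnth.
  by move=> t; apply: measurable_rcv; [exact: measurable_tnth|exact: measurable_cst].
(* Codeword [j] is independent of the output of codeword [i], so it is resampled with that output
   held fixed. *)
rewrite (tprob_resample Q j mz); last by move=> X; rewrite lee_fin expR_ge0.
rewrite -[leRHS](integral_prob_cst QQ); last first.
  rewrite lee_fin exprn_ge0// mulr_ge0 ?expR_ge0// addr_ge0// divr_ge0// ltW//.
  exact: (lt_le_trans ltr01 sg1).
apply: ge0_le_integral => //.
- by move=> X _; apply: integral_ge0 => x _; rewrite lee_fin expR_ge0.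
- by apply: (@measurable_int_tset _ _ _ Q _ j _ mz) => X; rewrite lee_fin expR_ge0.
move=> X _; under eq_integral do rewrite !tnth_tset eqxx eq_sym (negbTE ji).
exact: conf_bound.
Qed.

Lemma power_mean : (\int[QQ]_X (power_penalty X)%:E <= (L%:R * qpow ^+ M)%:E)%E.
Proof.
have me t i : measurable_fun setT (fun X : M.-tuple W => excess t (tnth X i)).
  by apply: measurableT_comp; [exact: measurable_excess|exact: measurable_tnth].
rewrite ge0_int_sum; last 2 first.
- move=> t _; apply: measurableT_comp => //; exact: measurable_sum.
- by move=> t X _; exact: expR_ge0.
rewrite mulr_natl -[X in _ *+ X](card_ord L) -sumr_const -sumEFin.
apply: lee_sum => t _.
under eq_integral do rewrite expR_sum -prodEFin.
rewrite (@tprob_prod _ _ _ Q M (fun i xi => (expR (excess t xi))%:E)); last 2 first.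
- move=> i; apply/measurable_EFinP; apply: measurableT_comp => //.
  exact: measurable_excess.
- by move=> i x; rewrite lee_fin expR_ge0.
apply: prode_le_const => i; last exact: pow_bound.
by apply: integral_ge0 => x _; rewrite lee_fin expR_ge0.
Qed.

End codebook.

Section existence.
Context {R : realType}.
Local Notation C := (R * R)%type.
Variables (L M : nat) (a b s tau v u eps : R).
Hypotheses (b0 : 0 < b) (s0 : 0 < s) (s1 : s < 1) (v0 : 0 < v) (v1 : v < 1).
Hypotheses (M0 : (0 < M)%N) (eps0 : 0 < eps).
Local Notation W := (L.-tuple C).
Local Notation Q := (tprob (@gam R) L).
Local Notation QQ := (tprob Q M).

(** The first moment method for two requirements at once: normalised risk plus power penalty has
    mean below 1, whereas it would be at least 1 everywhere if each codebook failed one of them. *)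
Lemma exists_codebook :
  (qmiss a b s tau ^+ L + M%:R * qconf a b tau ^+ L) / eps + L%:R * qpow v u ^+ M < 1 ->
  exists2 X : M.-tuple W, (risk a b s tau X <= (M%:R * eps)%:E)%E &
    forall t, \sum_(i < M) cnorm2 (clip b (tnth (tnth X i) t)) <= M%:R * u.
Proof.
move=> small.
have Me : 0 < M%:R * eps by rewrite mulr_gt0// ltr0n.
suff [X [rX pX]] : exists X : M.-tuple W, (risk a b s tau X <= (M%:R * eps)%:E)%E /\
    power_penalty b v u X < 1.
  exists X => // t; rewrite leNgt; apply/negP => H; move: pX; apply/negP.
  rewrite -leNgt /power_penalty (bigD1 t)//=.
  apply: (@le_trans _ _ (expR (\sum_(i < M) excess b v u t (tnth X i)))).
    rewrite -expR0 ler_expR -mulr_sumr mulr_ge0 ?ltW// sumrB sumr_const card_ord.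
    by rewrite -mulr_natl subr_gt0.
  by rewrite lerDl; apply: sumr_ge0 => i _; exact: expR_ge0.
apply: contrapT => /forallNP H.
have mp : measurable_fun setT (power_penalty b v u : M.-tuple W -> R).
  apply: measurable_sum => t; apply: measurableT_comp => //; apply: measurable_sum => i.
  by apply: measurableT_comp; [exact: measurable_excess|exact: measurable_tnth].
have p0 (X : M.-tuple W) : 0 <= power_penalty b v u X.
  by apply: sumr_ge0 => t _; exact: expR_ge0.
have : (1 <= \int[QQ]_X (((M%:R * eps)^-1)%:E * risk a b s tau X +
    (power_penalty b v u X)%:E))%E.
  rewrite -[leLHS](integral_prob_cst QQ)//; apply: ge0_le_integral => //.
  - apply: emeasurable_funD; last exact/measurable_EFinP.
    by apply: emeasurable_funM => //; exact: measurable_risk.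
  move=> X _; case: (leP 1 (power_penalty b v u X)) => [p1|p1].
    rewrite -[leLHS]add0e; apply: leeD; last by rewrite lee_fin.
    by apply: mule_ge0; [rewrite lee_fin invr_ge0 ltW|exact: risk_ge0].
  rewrite -[leLHS]adde0; apply: leeD; last by rewrite lee_fin.
  have : ((M%:R * eps)%:E < risk a b s tau X)%E.
    by rewrite ltNge; apply/negP => rX; apply: (H X).
  by move=> /ltW rX; rewrite lee_pdivlMl ?mule1.
rewrite ge0_integralD//; last 4 first.
- by move=> X _; apply: mule_ge0; [rewrite lee_fin invr_ge0 ltW|exact: risk_ge0].
- by apply: emeasurable_funM => //; exact: measurable_risk.
- by move=> X _; rewrite lee_fin.
- exact/measurable_EFinP.
rewrite ge0_integralZl//; last 3 first.
- exact: measurable_risk.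
- by move=> X _; exact: risk_ge0.
- by rewrite lee_fin invr_ge0 ltW.
move=> H1.
have H2 : (((M%:R * eps)^-1)%:E * \int[QQ]_X risk a b s tau X +
   \int[QQ]_X (power_penalty b v u X)%:E <= ((M%:R * eps)^-1)%:E *
  (M%:R * (qmiss a b s tau ^+ L + M%:R * qconf a b tau ^+ L))%:E +
  (L%:R * qpow v u ^+ M)%:E)%E.
  apply: leeD; last exact: power_mean.
  apply: lee_wpmul2l; first by rewrite lee_fin invr_ge0 ltW.
  exact: risk_mean.
move: (le_trans H1 H2); rewrite -EFinM -EFinD lee_fin leNgt => /negP; apply.
have M0' : M%:R != 0 :> R by rewrite pnatr_eq0 -lt0n.
by rewrite invfM mulrACA mulVf// mul1r mulrC.
Qed.

Variable X : M.-tuple W.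

Definition threshold_decoder (i0 : 'I_M) (y : W) : 'I_M :=
  if [pick i | 0 < margin a b tau (tnth X i) (tnth y)] is Some i then i else i0.

Lemma mfib_threshold_decoder i0 : mfib (threshold_decoder i0).
Proof.
have mb i : mfib (fun y : W => 0 < margin a b tau (tnth X i) (tnth y)).
  apply: mfib_bool; apply: measurable_fun_ltr => //.
  apply: (measurable_margin a b tau (f := fun=> tnth X i) (y := fun y : W => tnth y)).
    exact: measurable_cst.
  by move=> t; exact: measurable_tnth.
have := mfib_comp (fun f : {ffun 'I_M -> bool} =>
  if [pick i | f i] is Some i then i else i0) (mfib_ffun mb).
rewrite (_ : (fun x => _) = threshold_decoder i0)//.
apply/funext => y; rewrite /threshold_decoder.
by rewrite (eq_pick (ffunE _)).
Qed.

Definition codeword_out (i : 'I_M) (z : W) : W :=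
  [tuple rcv a b (tnth X i) z t | t < L].

Lemma measurable_codeword_out i : measurable_fun setT (codeword_out i).
Proof.
apply/measurable_fun_tnthP => t.
rewrite (_ : _ \o _ = fun z => rcv a b (tnth X i) z t); last first.
  by apply/funext => z /=; rewrite tnth_mktuple.
exact: measurable_rcv.
Qed.

Lemma decoder_error i0 : (\sum_(i < M)
    (Pr Q (fun z => threshold_decoder i0 (codeword_out i z) != i))%:E <=
  risk a b s tau X)%E.
Proof.
have mD i : mfib (fun z => threshold_decoder i0 (codeword_out i z) != i).
  exact: (@mfib_meas_comp _ _ _ _ _ (codeword_out i)
    (fun y => threshold_decoder i0 y != i) (measurable_codeword_out i)
    (mfib_comp (fun j => j != i) (mfib_threshold_decoder i0))).
rewrite /risk -big_split/=; apply: lee_sum => i _; rewrite -PrE//.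
have mm j : measurable_fun setT (fun z => margin a b tau (tnth X j) (rcv a b (tnth X i) z)).
  apply: measurable_margin => // t; exact: measurable_rcv.
have m1 : measurable_fun setT (fun z =>
    expR (- s * margin a b tau (tnth X i) (rcv a b (tnth X i) z))).
  by apply: measurableT_comp => //; exact: measurable_funM.
have m2 : measurable_fun setT (fun z => \sum_(j < M | j != i)
    expR (margin a b tau (tnth X j) (rcv a b (tnth X i) z))).
  by apply: measurable_sum_cond => j _; exact: measurableT_comp.
rewrite -ge0_int_sum; last 2 first.
- by move=> j _; exact: measurableT_comp.
- by move=> j z _; exact: expR_ge0.
rewrite -ge0_intD//; last by move=> z; apply: sumr_ge0 => j _; exact: expR_ge0.
apply: ge0_int_le => //.
- exact: (mfib_measurable (fun a : bool => a%:R : R) (mD i)).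
- exact: measurable_funD.
move=> z; rewrite /threshold_decoder.
have yE : tnth (codeword_out i z) = rcv a b (tnth X i) z.
  by apply/funext => t; rewrite tnth_mktuple.
rewrite yE; set y := rcv _ _ _ _.
have S0 : 0 <= \sum_(j < M | j != i) expR (margin a b tau (tnth X j) y).
  by apply: sumr_ge0 => j _; exact: expR_ge0.
case: pickP => [j /= jy|none].
  case: eqVneq => [_|ji] /=; first by rewrite addr_ge0 ?expR_ge0.
  rewrite -[leLHS]add0r lerD ?expR_ge0//.
  rewrite (bigD1 j)//= -[leLHS]addr0 lerD//.
    by rewrite -expR0 ler_expR ltW.
  by apply: sumr_ge0 => k _; exact: expR_ge0.
rewrite -[leLHS]addr0 lerD//.
apply: (@le_trans _ _ 1); first by rewrite lern1; case: (_ != _).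
rewrite -expR0 ler_expR mulNr oppr_ge0 pmulr_rle0//.
by rewrite leNgt; apply/negbT; exact: none.
Qed.

End existence.

Section coding_theorem.
Context {R : realType}.
Local Notation C := (R * R)%type.

(** With [l = 1 - q], the bounds [q <= expR (- l)] and [(x / 2) ^+ 2 <= expR x] give
    [L * q ^+ L <= 4 / (l ^+ 2 * L)]. *)
Lemma geometric_small (q c : R) : 0 <= q -> q < 1 -> 0 < c ->
  exists L0 : nat, forall L, (L0 <= L)%N -> L%:R * q ^+ L < c.
Proof.
move=> q0 q1 c0; pose l := 1 - q.
have l0 : 0 < l by rewrite subr_gt0.
have ql : q <= expR (- l) by have := expR_ge1Dx (- l); rewrite /l; lra.
exists (Num.truncn (4 / (l ^+ 2 * c))).+1 => L LL.
have Lbig : 4 / (l ^+ 2 * c) < L%:R.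
  by apply: lt_le_trans (truncnS_gt _) _; rewrite ler_nat.
have L0 : 0 < L%:R :> R.
  by apply: lt_trans Lbig; rewrite divr_gt0// mulr_gt0// exprn_gt0.
have qL : q ^+ L <= expR (- (l * L%:R)).
  by rewrite -mulNr mulrC expRM_natl; apply: lerXn2r => //; rewrite nnegrE expR_ge0.
have E : (l * L%:R / 2) ^+ 2 <= expR (l * L%:R).
  have xx : l * L%:R = l * L%:R / 2 + l * L%:R / 2 by field.
  rewrite {2}xx expRD expr2.
  have x0 : 0 <= l * L%:R / 2 by rewrite divr_ge0// mulr_ge0// ltW.
  by apply: ler_pM => //; have := expR_ge1Dx (l * L%:R / 2); lra.
have K0 : 0 < l * L%:R / 2 by rewrite divr_gt0// mulr_gt0.
apply: (@le_lt_trans _ _ (L%:R * ((l * L%:R / 2) ^+ 2)^-1)).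
  rewrite ler_pM2l//; apply: le_trans qL _; rewrite expRN.
  by rewrite lef_pV2 ?posrE ?exprn_gt0 ?expR_gt0.
have -> : L%:R * ((l * L%:R / 2) ^+ 2)^-1 = 4 / (l ^+ 2 * L%:R).
  by field; rewrite !gt_eqF.
rewrite ltr_pdivrMr ?mulr_gt0 ?exprn_gt0//.
move: Lbig; rewrite ltr_pdivrMr ?mulr_gt0 ?exprn_gt0//.
by rewrite (_ : c * (l ^+ 2 * L%:R) = L%:R * (l ^+ 2 * c)) //; ring.
Qed.

(** As in the constraint on network codes, the average power is taken over the codewords at each
    fixed time. The peak [B] limits the power of a codeword that is sent by mistake. *)
Definition link_code (h : C) (L M : nat) (B Pd eps : R)
    (X : 'I_M -> 'I_L -> C) (D : L.-tuple C -> 'I_M) : Prop :=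
  [/\ mfib D, forall i t, cnorm2 (X i t) <= B,
      forall t, \sum_(i < M) cnorm2 (X i t) <= M%:R * Pd &
      \sum_(i < M) Pr (tprob gam L)
        (fun z => D [tuple cmul h (X i t) + tnth z t | t < L] != i) <= M%:R * eps].

Lemma cmulA (x y z : C) : cmul x (cmul y z) = cmul (cmul x y) z.
Proof. by case: x y z => x1 x2 [y1 y2] [z1 z2]; congr pair => /=; ring. Qed.

(** [B] and [Pd] come before [eps], so that [eps] can later be made small compared with the cost [B]
    of an error. The condition [L <= M] lets the power bound, exponential in the number of
    codewords, beat the union over the [L] times. *)
Theorem coding_theorem (h : C) (P r0 : R) :
  0 <= P -> 0 <= r0 -> r0 < ln (1 + P * cnorm2 h) ->
  exists B Pd : R, [/\ 0 <= B, Pd < P & forall eps : R, 0 < eps ->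
    exists L0 : nat, forall L M : nat, (L0 <= L)%N -> (L <= M)%N ->
      M%:R <= expR (L%:R * r0) ->
      exists X D, @link_code h L M B Pd eps X D].
Proof.
move=> P0 r00 r0A.
have e1 : 1 <= expR r0 by rewrite -expR0 ler_expR.
have eA : expR r0 < 1 + P * cnorm2 h.
  by rewrite -ltr_ln ?posrE ?expR_gt0 ?expRK// ltr_wpDr// mulr_ge0// cnorm2_ge0.
have PH : 0 < P * cnorm2 h by lra.
have H0 : 0 < cnorm2 h.
  rewrite lt_neqAle cnorm2_ge0 andbT; apply: contraTneq PH => <-.
  by rewrite mulr0 ltxx.
have P_gt0 : 0 < P by move: PH; rewrite pmulr_lgt0.
(* Halfway between the power that rate [r0] requires and [P], which leaves room in both rate and
   power. *)
pose P' := ((expR r0 - 1) / cnorm2 h + P) / 2.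
have P'H : P' * cnorm2 h = (expR r0 - 1 + P * cnorm2 h) / 2.
  by rewrite /P'; field; rewrite gt_eqF.
have P'P : P' < P by rewrite -(ltr_pM2r H0) P'H; lra.
have P'0 : 0 < P'.
  by rewrite /P' divr_gt0// ltr_wpDl// divr_ge0 ?(ltW H0)//; lra.
pose g := Num.sqrt (cnorm2 h); pose rt := Num.sqrt P'; pose a := rt * g.
have g0 : 0 < g by rewrite sqrtr_gt0.
have g2 : g ^+ 2 = cnorm2 h by rewrite sqr_sqrtr// ltW.
have rt2 : rt ^+ 2 = P' by rewrite sqr_sqrtr// ltW.
have a2 : a ^+ 2 = P' * cnorm2 h by rewrite exprMn rt2 g2.
pose sg := 1 + a ^+ 2.
have sg0 : 0 < sg by rewrite ltr_pwDl// sqr_ge0.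
have r0sg : r0 < ln sg.
  by rewrite -[ltLHS]expRK ltr_ln ?posrE ?expR_gt0// /sg a2 P'H; lra.
pose De := (ln sg - r0) / 2; pose tau := r0 + De.
have De0 : 0 < De by rewrite divr_gt0// subr_gt0.
(* The gain [s * De] in the exponent is linear in [s], the loss from [1 - s ^+ 2] is quadratic;
   these bounds on [s] let the gain win, so that [ka < 1]. *)
pose s := Num.min (1 / 2) (De / 2).
have s0 : 0 < s by rewrite lt_min; apply/andP; split; lra.
have s_le : s <= 1 / 2 by rewrite ge_min lexx.
have sD : s <= De / 2 by rewrite ge_min lexx orbT.
have s1 : s < 1 by lra.
have s2 : 0 < 1 - s ^+ 2 by rewrite subr_gt0 expr_lt1// ltW.
pose ka := expR (- (s * De)) / (1 - s ^+ 2).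
have ka1 : ka < 1.
  rewrite ltr_pdivrMr// mul1r expRN -[ltRHS]invrK ltf_pV2 ?posrE ?expR_gt0 ?invr_gt0//.
  have H1 := expR_ge1Dx (s * De); apply: lt_le_trans H1.
  rewrite -[ltLHS]div1r ltr_pdivrMr//.
  have s2De : s ^+ 2 * De <= De / 4.
    have -> : De / 4 = (1 / 4) * De by field.
    by rewrite ler_pM2r//; nra.
  have : s * (s + s ^+ 2 * De) < s * De by rewrite ltr_pM2l//; lra.
  have -> : (1 + s * De) * (1 - s ^+ 2) = 1 + (s * De - s * (s + s ^+ 2 * De)) by ring.
  lra.
have eD : 0 < expR De - 1 by rewrite subr_gt0 -expR0 ltr_expR.
(* So large that clipping adds less than [1 - ka] to the base of misses and that
   [sg / b < expR De - 1] in the base of confusions. *)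
pose b := 2 / (1 - ka) + sg / (expR De - 1) + 1.
have bA : 0 < 2 / (1 - ka) by rewrite divr_gt0// subr_gt0.
have bB : 0 < sg / (expR De - 1) by rewrite divr_gt0.
have b0 : 0 < b by rewrite /b; lra.
(* [u > 1] is the tolerated ratio of the codebook's power to [P'], and [P' * u = P2 < P]. The choice
   of [v] gives [v * u = (u - 1) / 2] and [(1 + v * u) * (1 - v) > 1], whence [qpow v u < 1]. *)
pose P2 := (P + P') / 2; pose u := P2 / P'; pose v := (u - 1) / (2 * u).
have u1 : 1 < u by rewrite ltr_pdivlMr// mul1r /P2; lra.
have v0 : 0 < v by rewrite divr_gt0 ?subr_gt0// mulr_gt0//; lra.
have u0 : 0 < u by exact: lt_trans u1.
have v1 : v < 1 by rewrite /v ltr_pdivrMr; lra.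
have vu : v * u = (u - 1) / 2 by rewrite /v; field; rewrite gt_eqF//; lra.
have q10 : 0 <= qmiss a b s tau.
  have i1 : 0 <= (1 - s ^+ 2)^-1 by rewrite invr_ge0 ltW.
  have i2 : 0 <= (b * (1 - s))^-1 by rewrite invr_ge0 mulr_ge0//; lra.
  by rewrite /qmiss !mulr_ge0 ?expR_ge0// addr_ge0.
have q11 : qmiss a b s tau < 1.
  rewrite /qmiss mulrA -expRD -/sg.
  have -> : s * tau + - s * ln sg = - (s * De) by rewrite /tau /De; field.
  rewrite mulrDr.
  have : expR (- (s * De)) * (b * (1 - s))^-1 < 1 - ka.
    apply: (@le_lt_trans _ _ (b * (1 - s))^-1).
      rewrite ler_piMl ?invr_ge0//.
        by rewrite mulr_ge0//; lra.
      by rewrite -expR0 ler_expR oppr_le0 mulr_ge0// ltW.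
    rewrite -[ltRHS]invrK ltf_pV2 ?posrE ?invr_gt0 ?mulr_gt0 ?subr_gt0//.
    apply: (@lt_le_trans _ _ (b * (1 / 2))); last by rewrite ler_pM2l//; lra.
    have : 2 / (1 - ka) < b by rewrite /b; lra.
    by rewrite -[(1 - ka)^-1]mul1r; lra.
  by rewrite -/ka; lra.
have q20 : 0 <= qconf a b tau.
  by rewrite /qconf mulr_ge0 ?expR_ge0// addr_ge0// divr_ge0 ?ltW.
(* The number of competing codewords, at most [expR (L * r0)], is absorbed into the base. *)
pose q2 := expR r0 * qconf a b tau.
have q200 : 0 <= q2 by rewrite mulr_ge0 ?expR_ge0.
have q21 : q2 < 1.
  rewrite /q2 /qconf mulrA -expRD -/sg.
  have -> : r0 + - tau = - De by rewrite /tau; lra.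
  rewrite expRN mulrC ltr_pdivrMr ?expR_gt0// mul1r.
  have : sg / b < expR De - 1.
    rewrite ltr_pdivrMr// mulrC -ltr_pdivrMr//.
    by rewrite /b; lra.
  lra.
have q30 : 0 <= qpow v u.
  by rewrite /qpow mulr_ge0 ?expR_ge0// invr_ge0 subr_ge0 ltW.
have q31 : qpow v u < 1.
  rewrite /qpow ltr_pdivrMr ?subr_gt0// mul1r expRN -[ltRHS]invrK.
  rewrite ltf_pV2 ?posrE ?expR_gt0 ?invr_gt0 ?subr_gt0//.
  apply: lt_le_trans (expR_ge1Dx _).
  rewrite -[ltLHS]div1r ltr_pdivrMr ?subr_gt0//.
  have -> : (1 + v * u) * (1 - v) = 1 + (v * u - v - (v * u) * v) by ring.
  rewrite ltrDl vu; have : v < 1 / 2 * (u - 1).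
    rewrite /v ltr_pdivrMr; last by lra.
    by nra.
  have : (u - 1) / 2 * v + v < (u - 1) / 2.
    have -> : (u - 1) / 2 * v + v = v * (u + 1) / 2 by field.
    have : v * (u + 1) < u - 1.
      rewrite /v mulrAC ltr_pdivrMr; last by lra.
      by rewrite ltr_pM2l; lra.
    lra.
  lra.
(* Multiplying letters by [w] gives them power [P'] and turns the gain [h] into the real number
   [a]. *)
pose w : C := (rt * h.1 / g, - (rt * h.2 / g)).
have hw : cmul h w = (a, 0).
  rewrite /cmul /w /=; congr pair; last by field; rewrite gt_eqF.
  transitivity (rt * (h.1 ^+ 2 + h.2 ^+ 2) / g); first by field; rewrite gt_eqF.
  by rewrite -/(cnorm2 h) -g2 /a; field; rewrite gt_eqF.
have wn : cnorm2 w = P'.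
  rewrite /cnorm2 /w/= sqrrN.
  transitivity (rt ^+ 2 * (h.1 ^+ 2 + h.2 ^+ 2) / g ^+ 2).
    by field; rewrite gt_eqF.
  by rewrite -/(cnorm2 h) -g2 mulfK ?rt2// expf_neq0// gt_eqF.
exists (P' * b), P2; split; first by rewrite mulr_ge0 ?ltW.
  by rewrite /P2; lra.
move=> eps eps0.
pose q := Num.max (qmiss a b s tau) (Num.max q2 (qpow v u)).
have q0 : 0 <= q by rewrite le_max q10.
have q1 : q < 1 by rewrite !gt_max q11 q21 q31.
have c0 : 0 < (2 / eps + 1)^-1 by rewrite invr_gt0 addr_gt0// divr_gt0.
have [L0 HL0] := geometric_small q0 q1 c0.
exists L0.+1 => L M LL LM MR.
have L_gt0 : (0 < L)%N by exact: leq_trans LL.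
have M0 : (0 < M)%N by exact: leq_trans LM.
have Lq := HL0 L (ltnW LL).
have qL0 : 0 <= q ^+ L by exact: exprn_ge0.
have E1 : qmiss a b s tau ^+ L <= q ^+ L.
  by apply: lerXn2r; rewrite ?nnegrE// le_max lexx.
have E2 : M%:R * qconf a b tau ^+ L <= q ^+ L.
  apply: (@le_trans _ _ (q2 ^+ L)); last first.
    by apply: lerXn2r; rewrite ?nnegrE// !le_max lexx orbT.
  rewrite /q2 [in leRHS](exprMn _ (expR r0)) ler_wpM2r ?exprn_ge0//.
  by rewrite -expRM_natl.
have E3 : qpow v u ^+ M <= q ^+ L.
  apply: (@le_trans _ _ (qpow v u ^+ L)).
    by apply: ler_wiXn2l => //; exact: ltW.
  by apply: lerXn2r; rewrite ?nnegrE// !le_max lexx !orbT.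
have small : (qmiss a b s tau ^+ L + M%:R * qconf a b tau ^+ L) / eps +
    L%:R * qpow v u ^+ M < 1.
  apply: (@le_lt_trans _ _ (L%:R * q ^+ L * (2 / eps + 1))); last first.
    by rewrite -ltr_pdivlMr ?div1r// addr_gt0// divr_gt0.
  rewrite mulrDr mulr1 lerD//; last by rewrite ler_wpM2l.
  apply: (@le_trans _ _ (q ^+ L * (2 / eps))).
    rewrite mulrA ler_pM2r ?invr_gt0//; lra.
  apply: ler_wpM2r; first by rewrite divr_ge0// ltW.
  by rewrite ler_peMl// ler1n.
have [X rX pX] := exists_codebook b0 s0 s1 v0 v1 M0 eps0 small.
exists (fun i t => cmul w (clip b (tnth (tnth X i) t))),
  (threshold_decoder a b tau X (Ordinal M0)).
have outE i z : [tuple cmul h (cmul w (clip b (tnth (tnth X i) t))) + tnth z t | t < L] =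
    codeword_out a b X i z.
  by apply/eq_from_tnth => t; rewrite !tnth_mktuple cmulA hw.
split.
- exact: mfib_threshold_decoder.
- by move=> i t; rewrite cnorm2_cmul wn ler_pM2l// cnorm2_clip_le.
- move=> t; under eq_bigr do rewrite cnorm2_cmul wn.
  rewrite -mulr_sumr (_ : M%:R * P2 = P' * (M%:R * u)) ?ler_pM2l//.
  by rewrite /u; field; rewrite gt_eqF.
- under eq_bigr do under eq_fun do rewrite outE.
  rewrite -lee_fin -sumEFin; apply: le_trans rX.
  exact: decoder_error.
Qed.

End coding_theorem.

(** * Edge-disjoint paths *)

Lemma card_set_int (T : finType) (A : {set T}) (Q : pred T) :
  #|[set e in A | Q e]%SET|%:Z = \sum_(e in A) (Q e)%:Z.
Proof.
rewrite -sum1_card (big_morph Posz PoszD (erefl _)).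
rewrite (eq_bigl (fun e => (e \in A) && Q e)); last by move=> e; rewrite inE.
by rewrite big_mkcondr/=; apply: eq_bigr => e _; case: (Q e).
Qed.

Section flows.
Variables (E V : finType) (tl hd : E -> V).
Implicit Types U : {set E}.

Definition divergence U (v : V) : int :=
  \sum_(e in U) ((tl e == v)%:Z - (hd e == v)%:Z).

Definition residual U (x y : V) : bool :=
  [exists e, ((e \notin U) && (tl e == x) && (hd e == y)) ||
             ((e \in U) && (tl e == y) && (hd e == x))].

(** The second conclusion serves the induction: the first edge of the path touches [x], which the
    rest of the path avoids, so after pushing along the rest it still has its original status and
    can be flipped. *)
Lemma push_path U x p : path (residual U) x p -> uniq (x :: p) ->
  exists2 U' : {set E},
    (forall v, divergence U' v = divergence U v + (x == v)%:Z - (last x p == v)%:Z) &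
    (forall e, (tl e \notin x :: p) || (hd e \notin x :: p) -> (e \in U') = (e \in U)).
Proof.
elim: p x => [|y q IH] x /=; first by move=> _ _; exists U => // v; rewrite addrK.
case/andP=> rxy pq /andP[xq uq].
have [U1 d1 e1] := IH y pq uq.
have frame e : (tl e \notin x :: y :: q) || (hd e \notin x :: y :: q) ->
    (e \in U1) = (e \in U).
  move=> H; apply: e1; move: H; rewrite !in_cons !negb_or.
  by case/orP=> /and3P[_ a b]; rewrite a b ?orbT.
case/existsP: rxy => e /orP[/andP[/andP[eU /eqP te] /eqP he]|/andP[/andP[eU /eqP te] /eqP he]].
- have eU1 : e \notin U1 by rewrite e1 ?eU// te xq.
  exists (e |: U1)%SET => [v|f H].
    rewrite /divergence big_setU1//= -/(divergence U1 v) d1 te he; ring.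
  rewrite finset.in_setU1 frame//; case: eqP => // fe; move: H.
  by rewrite fe te he !in_cons !eqxx !orbT.
- have eU1 : e \in U1 by rewrite e1 ?eU// he xq orbT.
  exists (U1 :\ e)%SET => [v|f H].
    have := d1 v; rewrite {1}/divergence (big_setD1 e)//= -/(divergence (U1 :\ e)%SET v) te he.
    move=> H; rewrite -[LHS](addKr ((y == v)%:Z - (x == v)%:Z)) H; ring.
  rewrite finset.in_setD1 frame//; case: eqP => //= fe; move: H.
  by rewrite fe te he !in_cons !eqxx !orbT.
Qed.

Variables s t : V.
Hypothesis st : s != t.

Definition is_flow U k := forall v,
  divergence U v = (k * (s == v))%N%:Z - (k * (t == v))%N%:Z.

Lemma sum_divergence U (Om : {set V}) :
  \sum_(v in Om) divergence U v =
  #|[set e in U | (tl e \in Om) && (hd e \notin Om)]%SET|%:Z -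
  #|[set e in U | (hd e \in Om) && (tl e \notin Om)]%SET|%:Z.
Proof.
rewrite exchange_big/=.
have ind (f : E -> V) e : \sum_(v in Om) (f e == v)%:Z = (f e \in Om)%:Z.
  case: (boolP (f e \in Om)) => H.
    by rewrite (bigD1 (f e))//= eqxx big1 ?addr0// => v /andP[_]; rewrite eq_sym => /negbTE ->.
  by rewrite big1// => v vOm; case: eqP => // fv; rewrite fv vOm in H.
under eq_bigr do rewrite sumrB !ind.
rewrite !card_set_int -sumrB; apply: eq_bigr => e _.
by case: (_ \in Om); case: (_ \in Om).
Qed.

(** Augmenting paths: if [t] can be reached in the residual graph, one more unit is pushed.
    Otherwise the reachable set is a cut whose outgoing edges are all in [U] and whose incoming
    edges are all outside, so its capacity is only [k]. *)
Lemma max_flow k :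
  (forall Om : {set V}, s \in Om -> t \notin Om ->
     (k <= #|[set e | (tl e \in Om) && (hd e \notin Om)]%SET|)%N) ->
  exists U, is_flow U k.
Proof.
elim: k => [|k IH] cut.
  exists finset.set0 => v; rewrite /divergence big_set0 !mul0n; ring.
have [|U Uf] := IH; first by move=> Om sOm tOm; apply: ltnW; exact: cut.
case: (boolP (connect (residual U) s t)) => [/connectP[p0 pp0 tE]|nconn].
  move: tE; case/shortenP: pp0 => p pp up _ tE.
  have [U' d' _] := push_path pp up.
  exists U' => v; rewrite d' -tE Uf !mulSn !PoszD.
  by case: (s == v); case: (t == v); rewrite ?muln0 ?muln1; ring.
pose Om := [set v | connect (residual U) s v]%SET.
have sOm : s \in Om by rewrite inE connect0.
have tOm : t \notin Om by rewrite inE.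
have := cut Om sOm tOm.
have : \sum_(v in Om) divergence U v = k%:Z.
  under eq_bigr do rewrite Uf.
  rewrite (bigD1 s)//= eqxx muln1 eq_sym (negbTE st) muln0 subr0 big1 ?addr0// => v /andP[vOm].
  rewrite eq_sym => /negbTE ->; case: eqP => [tv|]; last by rewrite !muln0.
  by move: tOm; rewrite tv vOm.
rewrite sum_divergence.
have -> : [set e in U | (tl e \in Om) && (hd e \notin Om)]%SET =
    [set e | (tl e \in Om) && (hd e \notin Om)]%SET.
  apply/finset.setP => e; rewrite !inE; case: (boolP (e \in U)) => //= eU.
  apply/esym/negbTE; rewrite negb_and negbK -implybE; apply/implyP => c.
  apply: connect_trans c (connect1 _); apply/existsP; exists e.
  by rewrite eU !eqxx.
have -> : [set e in U | (hd e \in Om) && (tl e \notin Om)]%SET = finset.set0.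
  apply/finset.setP => e; rewrite !inE; case: (boolP (e \in U)) => //= eU.
  apply/negbTE; rewrite negb_and negbK -implybE; apply/implyP => c.
  apply: connect_trans c (connect1 _); apply/existsP; exists e.
  by rewrite eU !eqxx.
by rewrite cards0 subr0 => -[->]; rewrite ltnn.
Qed.

Section decomposition.
Variables (U : {set E}) (k : nat).
Hypothesis Uf : is_flow U k.
Hypothesis no_in_s : forall e, hd e != s.

Let inU v := [set e in U | hd e == v]%SET.
Let outU v := [set e in U | tl e == v]%SET.

Lemma divergence_card v : divergence U v = #|outU v|%:Z - #|inU v|%:Z.
Proof.
by rewrite !card_set_int -sumrB.
Qed.

Lemma card_out_s : #|outU s| = k.
Proof.
have := Uf s; rewrite divergence_card eqxx eq_sym (negbTE st) muln1 muln0 subr0.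
have -> : inU s = finset.set0 by apply/finset.setP => e; rewrite !inE (negbTE (no_in_s e)) andbF.
by rewrite cards0 subr0 => -[].
Qed.

Lemma card_in_out v : v != s -> v != t -> #|inU v| = #|outU v|.
Proof.
move=> vs vt; have := Uf v; rewrite divergence_card eq_sym (negbTE vs) eq_sym (negbTE vt).
rewrite !muln0 subrr => /eqP; rewrite subr_eq0 => /eqP[].
by move=> ->.
Qed.

(* Pairs the flow edges entering a vertex with those leaving it. *)
Definition next (e : E) : E :=
  nth e (enum (outU (hd e))) (index e (enum (inU (hd e)))).

Let live e := (e \in U) && (hd e != t).

Let nextP e : live e -> next e \in outU (hd e).
Proof.
case/andP=> eU ht; rewrite -mem_enum; apply: mem_nth.
rewrite -cardE -card_in_out// cardE index_mem mem_enum !inE eU eqxx//.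
Qed.

Let nextU e : live e -> next e \in U.
Proof. by move/nextP; rewrite inE => /andP[]. Qed.

Let tl_next e : live e -> tl (next e) = hd e.
Proof. by move/nextP; rewrite inE => /andP[_ /eqP]. Qed.

Let next_inj e f : live e -> live f -> next e = next f -> e = f.
Proof.
move=> le lf ef; have he : hd e = hd f by rewrite -tl_next// ef tl_next.
have [/andP[eU et] /andP[fU ft]] := (le, lf).
have ei : e \in enum (inU (hd e)) by rewrite mem_enum inE eU eqxx.
have fi : f \in enum (inU (hd e)) by rewrite mem_enum inE fU he eqxx.
have sz : size (enum (outU (hd e))) = size (enum (inU (hd e))).
  by rewrite -!cardE card_in_out.
have : index e (enum (inU (hd e))) = index f (enum (inU (hd e))).
  apply/eqP; rewrite -(nth_uniq e _ _ (enum_uniq (mem (outU (hd e))))) ?sz ?index_mem//.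
  move: ef; rewrite /next -he => ->; apply/eqP; apply: set_nth_default.
  by rewrite sz index_mem.
by move=> ie; rewrite -[e](nth_index e ei) ie nth_index.
Qed.

Let step e d := iter d next e.
Let start := outU s.

Let step_U e d : e \in start -> (forall i, (i < d)%N -> live (step e i)) -> step e d \in U.
Proof.
case: d => [|d] es H; first by move: es; rewrite inE => /andP[].
by apply: nextU; exact: H.
Qed.

Let step_tl e d : e \in start -> (forall i, (i < d.+1)%N -> live (step e i)) ->
  tl (step e d.+1) = hd (step e d).
Proof. by move=> es H; apply: tl_next; exact: H. Qed.

(** [next] is injective on live edges, so trajectories that meet can be traced back together. They
    reach their starts at the same step, because a starting edge leaves [s] and no edge enters
    [s]. *)
Let step_cancel e f a c : e \in start -> f \in start ->
  (forall i, (i < a)%N -> live (step e i)) -> (forall i, (i < c)%N -> live (step f i)) ->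
  step e a = step f c -> a = c /\ e = f.
Proof.
elim: a c => [|a IH] [|c] es fs Ha Hc //.
- move=> ef; have := step_tl fs Hc; rewrite -ef /step /=.
  move: es; rewrite inE => /andP[_ /eqP ->] sE.
  by have := no_in_s (step f c); rewrite -sE eqxx.
- move=> ef; have := step_tl es Ha; rewrite ef /step /=.
  move: fs; rewrite inE => /andP[_ /eqP ->] sE.
  by have := no_in_s (step e a); rewrite -sE eqxx.
move=> /= /next_inj H; have [] := IH c es fs.
- by move=> i ia; apply: Ha; exact: ltnW.
- by move=> i ia; apply: Hc; exact: ltnW.
- by apply: H; [exact: Ha|exact: Hc].
by move=> -> ->.
Qed.

(** A trajectory that stayed live for [#|E|] steps would repeat an edge, against [step_cancel]. *)
Let stops e : e \in start -> exists d, (d < #|E|)%N && ~~ live (step e d).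
Proof.
move=> es; have [/existsP[d ld]|] := boolP [exists d : 'I_#|E|, ~~ live (step e d)].
  by exists d; rewrite ltn_ord.
rewrite negb_exists => /forallP all_live.
have lv i : (i < #|E|)%N -> live (step e i).
  by move=> iE; have := all_live (Ordinal iE); rewrite negbK.
have : ~~ injectiveb (fun d : 'I_#|E|.+1 => step e d).
  by apply/negP => /injectiveP /leq_card; rewrite card_ord ltnn.
case/injectivePn => a [b ab eab].
have [] := step_cancel es es _ _ eab.
- by move=> i ia; apply: lv; apply: leq_trans ia _; rewrite -ltnS.
- by move=> i ia; apply: lv; apply: leq_trans ia _; rewrite -ltnS.
by move=> ab'; move: ab; rewrite (val_inj ab') eqxx.
Qed.

Lemma flow_paths : exists (path : 'I_k -> nat -> E) (len : 'I_k -> nat),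
  [/\ forall p, tl (path p 0%N) = s,
      forall p d, (d < len p)%N -> hd (path p d) = tl (path p d.+1),
      forall p, hd (path p (len p)) = t,
      forall p, (len p < #|E|)%N &
      forall p q d d', (d <= len p)%N -> (d' <= len q)%N ->
        path p d = path q d' -> p = q /\ d = d'].
Proof.
pose e0 (p : 'I_k) := enum_val (cast_ord (esym card_out_s) p).
have e0s p : e0 p \in start by exact: enum_valP.
have minP p := ex_minnP (stops (e0s p)).
pose len p := ex_minn (stops (e0s p)).
have lenE p : (len p < #|E|)%N /\ ~~ live (step (e0 p) (len p)).
  by rewrite /len; case: (minP p) => d /andP[].
have lv p i : (i < len p)%N -> live (step (e0 p) i).
  rewrite /len; case: (minP p) => d /andP[dE _] dmin id.
  apply: contraTT id => nl; rewrite -leqNgt.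
  have [Ei|iE] := leqP #|E| i; first by apply: leq_trans Ei; exact: ltnW.
  by apply: dmin; rewrite nl iE.
exists (fun p => step (e0 p)), len; split.
- by move=> p; move: (e0s p); rewrite inE => /andP[_ /eqP].
- move=> p d dl; rewrite step_tl// => i id; apply: lv.
  by apply: leq_trans dl; rewrite ltnS in id.
- move=> p; have [_] := lenE p; rewrite /live negb_and negbK.
  by rewrite step_U//= => [/eqP|i]; last exact: lv.
- by move=> p; have [] := lenE p.
move=> p q d d' dl d'l /step_cancel[]//.
- by move=> i id; apply: lv; apply: leq_trans dl.
- by move=> i id; apply: lv; apply: leq_trans d'l.
by move=> -> /enum_val_inj /cast_ord_inj.
Qed.

End decomposition.

Theorem disjoint_paths k :
  (forall e, hd e != s) ->
  (forall Om : {set V}, s \in Om -> t \notin Om ->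
     (k <= #|[set e | (tl e \in Om) && (hd e \notin Om)]%SET|)%N) ->
  exists (path : 'I_k -> nat -> E) (len : 'I_k -> nat),
  [/\ forall p, tl (path p 0%N) = s,
      forall p d, (d < len p)%N -> hd (path p d) = tl (path p d.+1),
      forall p, hd (path p (len p)) = t,
      forall p, (len p < #|E|)%N &
      forall p q d d', (d <= len p)%N -> (d' <= len q)%N ->
        path p d = path q d' -> p = q /\ d = d'].
Proof.
by move=> hs /max_flow[U Uf]; exact: flow_paths Uf hs.
Qed.

End flows.

(** * Scheduled decode-and-forward *)

Lemma nth_hist {R : realType} (N : nat) (h : node N -> node N -> R * R) n M
    (c : Defs.code R N n M) w z t j t' : (t' < t)%N ->
  nth 0 (hist h c w z t j) t' = recv h c w z (hist h c w z t') j.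
Proof.
elim: t => // t IH; rewrite ltnS leq_eqVlt => /orP[/eqP ->|tt] /=.
  by rewrite nth_rcons size_tuple ltnn eqxx.
by rewrite nth_rcons size_tuple tt IH.
Qed.

Section schedule.
Context {R : realType} {N : nat}.
Local Notation C := (R * R)%type.
Local Notation node := (node N).
Variables (m : mode) (P : R) (h : node -> node -> C) (n M Q : nat).
Hypothesis P0 : 0 <= P.
Local Notation K := (noise_dim N n).

Variable sched : nat -> state N.
Hypothesis sched_valid : forall t, valid_state m (sched t).

Variables (J : finType) (tx rx : J -> node) (beg len : J -> nat) (pred : J -> J).

Definition on_air j t := (beg j <= t < beg j + len j)%N.

Hypothesis end_le : forall j, (beg j + len j <= n)%N.
Hypothesis on_air_active : forall j t, on_air j t -> active_in (sched t) (tx j) (rx j).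
Hypothesis on_air_inj : forall j j' t, on_air j t -> on_air j' t -> tx j = tx j' -> j = j'.

Variables (msg : 'I_M -> J -> 'I_Q) (fin : {ffun J -> 'I_Q} -> 'I_M).
Hypothesis predP : forall j, tx j != src N ->
  [/\ rx (pred j) = tx j, (beg (pred j) + len (pred j) <= beg j)%N &
      forall w, msg w (pred j) = msg w j].
Hypothesis finP : forall w (F : {ffun J -> 'I_Q}), (forall j, rx j = dst N -> F j = msg w j) -> fin F = w.
Hypothesis msg_uniform : forall j (g : 'I_Q -> R),
  Q%:R * \sum_(w < M) g (msg w j) = M%:R * \sum_(q < Q) g q.

Variables (X : forall j, 'I_Q -> 'I_(len j) -> C) (D : forall j, (len j).-tuple C -> 'I_Q).
Arguments X : clear implicits.
Variables (B Pd : J -> R) (eps : R).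
Hypothesis codes : forall j, link_code (h (rx j) (tx j)) (B j) (Pd j) eps (X j) (@D j).

Definition symbol j q t : C :=
  if insub (t - beg j)%N is Some u then X j q u else 0.

Definition job_at i t := [pick j | (tx j == i) && on_air j t].

(** By [predP] and [end_le] a window is complete before its decoding is used, so the default 0 does
    not enter. *)
Definition window j t (y : t.-tuple C) : (len j).-tuple C :=
  [tuple nth 0 y (beg j + u)%N | u < len j].

Definition sched_code : Defs.code R N n M := Code
  (fun _ t => sched t (src N))
  (fun w t => oapp (fun j => symbol j (msg w j) t) 0 (job_at (src N) t))
  (fun i t _ => sched t i)
  (fun i t y => oapp (fun j => symbol j (D (window (pred j) y)) t) 0 (job_at i t))
  (fun t _ => (sched t (dst N)).2)
  (fun y => fin [ffun j => D (window j y)]).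

Local Notation c := sched_code.

Lemma job_atE j t : on_air j t -> job_at (tx j) t = Some j.
Proof.
move=> jt; rewrite /job_at; case: pickP => [j' /andP[/eqP tj j't]|/(_ j)].
  by congr Some; exact: on_air_inj j't jt tj.
by rewrite eqxx jt.
Qed.

Lemma sched_dst t : (sched t (dst N)).1 = None.
Proof.
have /forallP/(_ (dst N)) := sched_valid t.
rewrite /valid_local => /and5P[_ _ _ _ /and3P[_ H _]]; apply/eqP; exact: (implyP H).
Qed.

Lemma sched_node_st w t (H : node -> t.-tuple C) i : node_st c w H i = sched t i.
Proof.
rewrite /node_st; case: eqP => [->//|_]; case: eqP => [->|//].
by rewrite [RHS]surjective_pairing sched_dst.
Qed.

Lemma on_air_tx j t : on_air j t -> tx j != dst N.
Proof.
move=> /on_air_active; apply: contraTneq => ->.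
by rewrite /active_in /active sched_dst.
Qed.

Lemma on_air_neq j t : on_air j t -> tx j != rx j.
Proof.
move=> /on_air_active; apply: contraTneq => ->; rewrite /active_in /active negb_and.
have /forallP/(_ (rx j)) := sched_valid t.
by rewrite /valid_local => /andP[->].
Qed.

Lemma sched_recv w z t (H : node -> t.-tuple C) j : on_air j t ->
  recv h c w z H (rx j) = z t (rx j) + cmul (h (rx j) (tx j)) (node_x c w H (tx j)).
Proof.
move=> jt; rewrite /recv; congr (_ + _).
have act := on_air_active jt.
rewrite (bigD1 (tx j)) ?(on_air_neq jt) ?(on_air_tx jt)//= !sched_node_st [active _ _ _ _]act.
rewrite big1 ?addr0// => i /andP[_ itx]; rewrite !sched_node_st /active.
move: act; rewrite /active_in /active => /andP[_ /eqP ->].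
by case: eqP => //= _; case: eqP => // -[ji]; rewrite ji eqxx in itx.
Qed.

(* The output seen by [rx j] when [tx j] sends the codeword of [msg w j]. *)
Definition ideal w z j : (len j).-tuple C :=
  [tuple cmul (h (rx j) (tx j)) (X j (msg w j) u) + z (beg j + u)%N (rx j) | u < len j].

(** Refers to the ideal output, so its law involves only the noise of the job's own window, whatever
    happened to other jobs. When all these events hold, the actual run coincides with the ideal
    one. *)
Definition decodes w z j := D (ideal w z j) == msg w j.

Lemma on_air_window j (u : 'I_(len j)) : on_air j (beg j + u).
Proof. by rewrite /on_air leq_addr ltn_add2l ltn_ord. Qed.

Lemma symbol_window j q (u : 'I_(len j)) : symbol j q (beg j + u) = X j q u.
Proof. by rewrite /symbol addKn valK. Qed.

Lemma sched_window w z j t : (beg j + len j <= t)%N ->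
  (forall t', (t' < t)%N -> on_air j t' ->
     input_at h c w z t' (tx j) = symbol j (msg w j) t') ->
  window j (hist h c w z t (rx j)) = ideal w z j.
Proof.
move=> jt xE; apply: eq_from_tnth => u; rewrite !tnth_mktuple.
have ut : (beg j + u < t)%N by apply: leq_trans jt; rewrite ltn_add2l ltn_ord.
have jw := on_air_window u.
by rewrite nth_hist// sched_recv// addrC [node_x _ _ _ _]xE// symbol_window.
Qed.

(** Induction on time: a relay on air has the whole window of the preceding job behind it, in which
    the right codeword was sent by the induction hypothesis. *)
Lemma sched_input w z : (forall j, decodes w z j) ->
  forall t j, on_air j t -> input_at h c w z t (tx j) = symbol j (msg w j) t.
Proof.
move=> gd; elim/ltn_ind => t IH j jt; rewrite /input_at /node_x.
have [js|js] := eqVneq (tx j) (src N).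
  by rewrite /= -js job_atE.
rewrite (negbTE (on_air_tx jt)) /= job_atE//=.
have [pr pe pm] := predP js.
rewrite -pr sched_window ?(eqP (gd _)) ?pm//.
  by apply: leq_trans pe _; case/andP: jt.
  by move=> t' t't ot; rewrite -pm IH.
Qed.

Lemma sched_decoded w z : (forall j, decodes w z j) -> decoded h c w z = w.
Proof.
move=> gd; apply: finP => j rj; rewrite ffunE -rj sched_window ?(eqP (gd j))//.
by move=> t _; exact: sched_input.
Qed.

Lemma measurable_window d (Y : measurableType d) j t (f : Y -> t.-tuple C) :
  measurable_fun setT f -> measurable_fun setT (fun y => window j (f y)).
Proof.
move=> mf; apply/measurable_fun_tnthP => u.
have [ut|tu] := ltnP (beg j + u)%N t.
  rewrite (_ : _ \o _ = fun y => tnth (f y) (Ordinal ut)); last first.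
    by apply/funext => y; rewrite /= tnth_mktuple (tnth_nth 0).
  exact: measurable_tnth_comp.
rewrite (_ : _ \o _ = cst 0)//; apply/funext => y.
by rewrite /= tnth_mktuple nth_default// size_tuple.
Qed.

Lemma mfib_window j t : mfib (fun y : t.-tuple C => D (window j y)).
Proof.
have [mD _ _ _] := codes j.
apply: (mfib_meas_comp (f := fun y : t.-tuple C => window j y)) mD.
by apply: measurable_window; exact: measurable_id.
Qed.

Lemma measurable_sched_code : measurable_code c.
Proof.
split.
- by move=> i t _; exact: mfib_cst.
- move=> i t _ /=; case: (job_at i t) => [j|] /=; last exact: measurable_cst.
  exact: (mfib_measurable (fun q => symbol j q t) (mfib_window (pred j) (t := t))).
- by move=> t; exact: mfib_cst.
- apply: (mfib_comp (f := fun y : n.-tuple C => [ffun j => D (window j y)]) fin).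
  by apply: (mfib_ffun (f := fun (y : n.-tuple C) j => D (window j y))) => j; exact: mfib_window.
Qed.


Hypothesis M0 : (0 < M)%N.

Definition link_err j q : R := Pr (tprob gam (len j)) (fun y =>
  @D j [tuple cmul (h (rx j) (tx j)) (X j q t) + tnth y t | t < len j] != q).

Let mfib_link j q : mfib (fun y : (len j).-tuple C =>
  @D j [tuple cmul (h (rx j) (tx j)) (X j q t) + tnth y t | t < len j] != q).
Proof.
have [mD _ _ _] := codes j.
apply: (mfib_comp (f := fun y : (len j).-tuple C =>
  @D j [tuple cmul (h (rx j) (tx j)) (X j q t) + tnth y t | t < len j]) (fun q' => q' != q)).
apply: (mfib_meas_comp (f := fun y : (len j).-tuple C =>
  [tuple cmul (h (rx j) (tx j)) (X j q t) + tnth y t | t < len j])) mD.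
apply/measurable_fun_tnthP => u.
rewrite (_ : _ \o _ = fun y : (len j).-tuple C => cmul (h (rx j) (tx j)) (X j q u) + tnth y u).
  by apply: measurable_cadd; [exact: measurable_cst|exact: measurable_tnth].
by apply/funext => y; rewrite /= tnth_mktuple.
Qed.

Lemma window_time j (u : 'I_(len j)) : (beg j + u < n)%N.
Proof. by apply: leq_trans (end_le j); rewrite ltn_add2l ltn_ord. Qed.

Definition noise_window j (u : 'I_(len j)) : 'I_K :=
  enum_rank (Ordinal (window_time u), rx j).

Lemma noise_window_inj j : injective (@noise_window j).
Proof. by move=> u v /enum_rank_inj[/addnI/val_inj]. Qed.

Lemma windowed_decodes w j (z : K.-tuple C) : decodes w (noise_of z) j =
  (@D j [tuple cmul (h (rx j) (tx j)) (X j (msg w j) t) +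
      tnth (tproj (@noise_window j) z) t | t < len j] == msg w j).
Proof.
rewrite /decodes; congr (D _ == _); apply: eq_from_tnth => u; rewrite !tnth_mktuple.
by rewrite -(noise_ofE z (Ordinal (window_time u))).
Qed.

Lemma mfib_not_decodes w j : mfib (fun z : K.-tuple C => ~~ decodes w (noise_of z) j).
Proof.
under eq_fun do rewrite windowed_decodes.
exact: (mfib_meas_comp (measurable_tproj _) (mfib_link (msg w j))).
Qed.

(** The noise coordinates of a window are distinct, so their joint law is [tprob gam (len j)] and
    the single-link error probability applies. *)
Lemma Pr_not_decodes w j :
  Pr (tprob gam K) (fun z => ~~ decodes w (noise_of z) j) = link_err j (msg w j).
Proof.
rewrite /Pr /link_err; congr fine.
under eq_integral do rewrite windowed_decodes.
rewrite (tprob_marginal gam (F := fun y => ((@D j [tuple cmul (h (rx j) (tx j)) (X j (msg w j) t)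
  + tnth y t | t < len j] != msg w j)%:R)%:E))//; first exact: noise_window_inj.
by apply: measurable_indicb; exact: mfib_link.
Qed.

(** A uniform message has a uniform part in each job, so averages over a codebook carry over to
    averages over network messages. *)
Lemma msg_average j (g : 'I_Q -> R) (a : R) : \sum_(q < Q) g q <= Q%:R * a ->
  \sum_(w < M) g (msg w j) <= M%:R * a.
Proof.
have Q0 : (0 < Q)%N by exact: leq_ltn_trans (leq0n _) (ltn_ord (msg (Ordinal M0) j)).
move=> ga; rewrite -(ler_pM2l (_ : 0 < Q%:R)) ?ltr0n// msg_uniform mulrCA.
by rewrite ler_wpM2l.
Qed.

Lemma sum_link_err j : \sum_(w < M) link_err j (msg w j) <= M%:R * eps.
Proof. by apply: (@msg_average j (link_err j)); have [_ _ _] := codes j. Qed.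

Lemma int_le_not_decodes w (a b : R) (f : K.-tuple C -> R) : 0 <= a -> 0 <= b ->
  measurable_fun setT f -> (forall z, 0 <= f z) ->
  (forall z, f z <= a + b * \sum_j (~~ decodes w (noise_of z) j)%:R) ->
  (\int[tprob gam K]_z (f z)%:E <= (a + b * \sum_j link_err j (msg w j))%:E)%E.
Proof.
move=> a0 b0 mf f0 fle; have mg j : measurable_fun setT
    (fun z : K.-tuple C => (~~ decodes w (noise_of z) j)%:R : R).
  exact: (mfib_measurable (fun b : bool => b%:R : R) (@mfib_not_decodes w j)).
have mS := measurable_sum (index_enum J) mg.
have S0 z : 0 <= \sum_j (~~ decodes w (noise_of z) j)%:R :> R by apply: sumr_ge0.
have mbS := measurable_funM (measurable_cst b) mS.
apply: le_trans (ge0_int_le _ mf (measurable_funD (measurable_cst a) mbS) f0 fle) _.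
rewrite ge0_intD//; last by move=> z; rewrite mulr_ge0.
rewrite [X in (X + _)%E](integral_prob_cst (tprob gam K) (c := a%:E)) ?lee_fin// EFinD leeD2l// ge0_intZl// EFinM lee_wpmul2l//.
rewrite (ge0_int_sum _ (A := xpredT)) // -sumEFin; apply: lee_sum => j _.
by rewrite PrE ?Pr_not_decodes//; exact: mfib_not_decodes.
Qed.

Lemma not_all_decode w z : ~ (forall j, decodes w z j) -> 1 <= \sum_j (~~ decodes w z j)%:R :> R.
Proof.
move=> /existsNP[j /negP bj]; rewrite (bigD1 j)//= bj lerDl.
by apply: sumr_ge0.
Qed.

Lemma sched_Perr : (Perr m h c <= (#|J|%:R * eps)%:E)%E.
Proof.
have mc := measurable_sched_code.
rewrite /Perr; apply: (@le_trans _ _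
    ((M%:R)^-1%:E * \sum_(w < M) (\sum_j link_err j (msg w j))%:E)%E).
  apply: lee_wpmul2l; first by rewrite lee_fin invr_ge0.
  apply: lee_sum => w _.
  rewrite (@Enoise_tprob _ _ _ (fun z => ((decoded h c w z != w)%:R)%:E))//; last first.
    apply: (measurable_indicb (b := fun z => decoded h c w (noise_of z) != w)).
    exact: (mfib_comp (fun i => i != w) (mfib_decoded h w mc)).
  rewrite -[X in (_ <= X%:E)%E]mul1r -[X in (_ <= X%:E)%E]add0r.
  apply: (int_le_not_decodes (f := fun z => (decoded h c w (noise_of z) != w)%:R)) => //.
    exact: (mfib_measurable (fun i => (i != w)%:R : R) (mfib_decoded h w mc)).
  move=> z; have [gd|/not_all_decode] := pselect (forall j, decodes w (noise_of z) j).
    by rewrite sched_decoded// eqxx add0r mul1r sumr_ge0.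
  by rewrite add0r mul1r; apply: le_trans; case: (_ != _).
rewrite sumEFin -EFinM lee_fin ler_pdivrMl ?ltr0n// exchange_big/=.
rewrite mulrCA -[#|J|]sum1_card natr_sum mulr_suml.
by apply: ler_sum => j _; rewrite mul1r sum_link_err.
Qed.

Hypothesis B0 : forall j, 0 <= B j.
Hypothesis powerP : forall j, Pd j + B j * (#|J|%:R * eps) <= P.

Lemma symbol_le j q t : cnorm2 (symbol j q t) <= B j.
Proof.
have [_ XB _ _] := codes j.
rewrite /symbol; case: insub => [u|]; first exact: XB.
by rewrite cnorm2_0.
Qed.

(** If all jobs decode, the input is a letter of the right codeword, of average power [Pd j];
    otherwise its power is at most [B j], on an event of average probability at most
    [#|J| * eps]. *)
Lemma sched_power k t : k != dst N ->
  ((M%:R)^-1%:E * \sum_(w < M)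
     Enoise n (fun z => (cnorm2 (input_at h c w z t k))%:E) <= P%:E)%E.
Proof.
move=> kd; have mc := measurable_sched_code.
have E w : Enoise n (fun z => (cnorm2 (input_at h c w z t k))%:E) =
    (\int[tprob gam K]_z (cnorm2 (input_at h c w (noise_of z) t k))%:E)%E.
  apply: (@Enoise_tprob _ _ _ (fun z => (cnorm2 (input_at h c w z t k))%:E)).
    apply/measurable_EFinP; apply: measurableT_comp; first exact: measurable_cnorm2.
    exact: measurable_input_at.
  by move=> z; rewrite lee_fin cnorm2_ge0.
under eq_bigr do rewrite E.
case jE : (job_at k t) => [j|]; last first.
  rewrite big1 ?mule0 ?lee_fin// => w _.
  rewrite -[RHS](integral0 (tprob gam K) setT); apply: eq_integral => z _.
  rewrite /input_at /node_x (negbTE kd) /=.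
  by case: eqP => [ks|_]; rewrite -?ks jE /= cnorm2_0.
have [jt jk] : on_air j t /\ tx j = k.
  by move: jE; rewrite /job_at; case: pickP => // j' /andP[/eqP tj jt'] [<-].
have xle w z : cnorm2 (input_at h c w z t k) <= B j.
  rewrite /input_at /node_x (negbTE kd) /=.
  by case: eqP => [ks|_]; rewrite -?ks jE /= symbol_le.
have [_ _ Xp _] := codes j.
have le1 w : (\int[tprob gam K]_z (cnorm2 (input_at h c w (noise_of z) t k))%:E <=
   (cnorm2 (symbol j (msg w j) t) + B j * \sum_j' link_err j' (msg w j'))%:E)%E.
  apply: (int_le_not_decodes (f := fun z => cnorm2 (input_at h c w (noise_of z) t k))) => //.
  - exact: cnorm2_ge0.
  - apply: measurableT_comp; first exact: measurable_cnorm2.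
    exact: measurable_input_at.
  - by move=> z; exact: cnorm2_ge0.
  move=> z; have [gd|/not_all_decode b1] := pselect (forall j', decodes w (noise_of z) j').
    by rewrite -jk sched_input// lerDl mulr_ge0// sumr_ge0.
  apply: le_trans (xle w (noise_of z)) _; apply: ler_wpDl; first exact: cnorm2_ge0.
  by rewrite ler_peMr.
apply: (@le_trans _ _ ((M%:R)^-1%:E * \sum_(w < M)
   (cnorm2 (symbol j (msg w j) t) + B j * \sum_j' link_err j' (msg w j'))%:E)%E).
  by apply: lee_wpmul2l; [rewrite lee_fin invr_ge0|apply: lee_sum => w _].
rewrite sumEFin -EFinM lee_fin ler_pdivrMl ?ltr0n// big_split/= -mulr_sumr.
have s1 : \sum_(w < M) cnorm2 (symbol j (msg w j) t) <= M%:R * Pd j.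
  apply: (@msg_average j (fun q => cnorm2 (symbol j q t))).
  have tj : (t - beg j < len j)%N by move: jt; rewrite /on_air; lia.
  by rewrite /symbol (insubT (fun u => (u < len j)%N) tj); exact: Xp.
have s2 : \sum_(w < M) \sum_j' link_err j' (msg w j') <= M%:R * (#|J|%:R * eps).
  rewrite exchange_big/= mulrCA -[#|J|]sum1_card natr_sum mulr_suml.
  by apply: ler_sum => j' _; rewrite mul1r sum_link_err.
apply: le_trans (lerD s1 (ler_wpM2l (B0 j) s2)) _.
by rewrite mulrCA -mulrDr ler_wpM2l.
Qed.

Lemma sched_admissible : admissible m P h c.
Proof.
have mc := measurable_sched_code.
have vl t i : valid_local m i (sched t i) by have /forallP := sched_valid t.
case: (mc) => m1 m2 m3 m4; split.
- split; first by move=> w t; exact: vl.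
  split; first by move=> i t y _; exact: vl.
  by move=> t y /=; rewrite -(sched_dst t) -surjective_pairing; exact: vl.
- by move=> i t ri; split; [exact: m1|exact: m2].
- exact: m3.
- exact: m4.
- by move=> k t kd _; exact: sched_power.
Qed.

Lemma schedule_code :
  exists c : Defs.code R N n M, admissible m P h c /\ (Perr m h c <= (#|J|%:R * eps)%:E)%E.
Proof. by exists c; split; [exact: sched_admissible|exact: sched_Perr]. Qed.

End schedule.

(** A coordinate of a uniform function is uniform: the summand is a product over all coordinates,
    trivial except at [x], and the sum factorises. *)
Lemma sum_ffun_coord {R : realType} (A I : finType) (x : A) (g : I -> R) :
  #|I|%:R * \sum_(f : {ffun A -> I}) g (f x) = #|{ffun A -> I}|%:R * \sum_i g i.
Proof.
pose G y i := if y == x then g i else 1.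
have -> : \sum_(f : {ffun A -> I}) g (f x) = \sum_(f : {ffun A -> I}) \prod_y G y (f y).
  apply: eq_bigr => f _; rewrite (bigD1 x)//= /G eqxx big1 ?mulr1//.
  by move=> y /negbTE ->.
have -> : \sum_(f : {ffun A -> I}) \prod_y G y (f y) = \prod_y \sum_i G y i.
  by rewrite (bigA_distr_bigA G).
rewrite (bigD1 x)//= {1}/G eqxx.
have -> : \prod_(y | y != x) \sum_i G y i = \prod_(y | y != x) #|I|%:R.
  by apply: eq_bigr => y /negbTE yx; rewrite /G yx sumr_const.
rewrite prodr_const card_ffun natrX mulrCA -exprS mulrC; congr (_ ^+ _ * _).
by rewrite (cardC1 x) prednK//; apply/card_gt0P; exists x.
Qed.

Lemma card_sub_set (T : finType) (A p : pred T) (sT : subFinType A) :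
  #|[set e : sT | p (val e)]%SET| = #|[set x | A x && p x]%SET|.
Proof.
rewrite -(card_imset _ val_inj); apply: eq_card => x; rewrite inE.
apply/imsetP/andP => [[e ep ->]|[Ax px]].
  by move: ep; rewrite inE => ->; split => //; exact: valP.
by exists (Sub x Ax); rewrite ?inE SubK.
Qed.

Lemma active_src {N : nat} m (s : state N) i j :
  valid_state m s -> active_in s i j -> j != src N.
Proof.
move=> /forallP/(_ j); rewrite /valid_local => /and5P[_ _ _ _ /andP[H _]].
rewrite /active_in /active => /andP[_ sj]; apply/negP => js.
by move: (implyP H js) sj => /eqP ->.
Qed.

(** * Periodic schedules over edge-disjoint paths *)

Section scheme.
Context {R : realType} {N : nat}.
Local Notation C := (R * R)%type.
Local Notation node := (node N).
Variables (m : mode) (P : R) (h : node -> node -> C) (T0 : nat).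
Local Notation T := T0.+1.
Variables (sl : 'I_T -> state N) (mult : node -> node -> nat).
Hypotheses (P0 : 0 <= P) (sl_valid : forall k, valid_state m (sl k)).

Definition max_mult : nat := \max_(p : node * node) mult p.1 p.2.

(** An edge is a slot of the period, a link active in it, and the number of one of the [mult i j]
    equal blocks into which the slot is cut for that link. The uniform bound [max_mult] makes the
    edges a subtype of a product. *)
Definition is_edge (e : 'I_T * (node * node) * 'I_max_mult) :=
  active_in (sl e.1.1) e.1.2.1 e.1.2.2 && (e.2 < mult e.1.2.1 e.1.2.2)%N.

Definition edge := {e : 'I_T * (node * node) * 'I_max_mult | is_edge e}.
Definition edge_tl (e : edge) : node := (val e).1.2.1.
Definition edge_hd (e : edge) : node := (val e).1.2.2.

Lemma edge_hd_src e : edge_hd e != src N.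
Proof. by have /andP[/(active_src (sl_valid _))] := valP e. Qed.

Lemma card_edge_cut (Om : {set node}) :
  #|[set e | (edge_tl e \in Om) && (edge_hd e \notin Om)]%SET| =
  (\sum_(k < T) \sum_(i in Om) \sum_(j in ~: Om) active_in (sl k) i j * mult i j)%N.
Proof.
rewrite (card_sub_set (fun x : 'I_T * (node * node) * 'I_max_mult =>
  (x.1.2.1 \in Om) && (x.1.2.2 \notin Om))) -sum1_card.
under eq_bigl do rewrite inE.
rewrite big_mkcond/=.
rewrite -(pair_bigA _ (fun (a : 'I_T * (node * node)) (x : 'I_max_mult) =>
  if is_edge (a, x) && ((a.2.1 \in Om) && (a.2.2 \notin Om)) then 1 else 0)%N)/=.
rewrite -(pair_bigA _ (fun (k : 'I_T) (p : node * node) =>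
  \sum_(x < max_mult) if is_edge (k, p, x) && ((p.1 \in Om) && (p.2 \notin Om)) then 1 else 0)%N)/=.
apply: eq_bigr => k _.
rewrite -(pair_bigA _ (fun i j =>
  \sum_(x < max_mult) if is_edge (k, (i, j), x) && ((i \in Om) && (j \notin Om)) then 1 else 0)%N)/=.
rewrite [RHS]big_mkcond; apply: eq_bigr => i _.
case: (i \in Om) => /=; last first.
  by rewrite big1// => j _; rewrite big1// => x _; rewrite andbF.
rewrite [RHS]big_mkcond; apply: eq_bigr => j _; rewrite finset.in_setC.
case: (j \in Om) => /=; first by rewrite big1// => x _; rewrite andbF.
rewrite /is_edge/=; case: (active_in _ _ _) => /=; last by rewrite big1.
have mm : (mult i j <= max_mult)%N by exact: (leq_bigmax (i, j)).
rewrite mul1n -[RHS]card_ord -sum1_card (big_ord_widen _ (fun=> 1%N) mm) [RHS]big_mkcond/=.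
by apply: eq_bigr => x _; rewrite andbT.
Qed.

Variables (V F L Q : nat).
Hypothesis cutV : forall Om : {set node}, is_cut Om ->
  (V <= \sum_(k < T) \sum_(i in Om) \sum_(j in ~: Om) active_in (sl k) i j * mult i j)%N.
Variable b : node -> node -> nat.
Hypothesis bL : forall i j, (0 < mult i j)%N -> (mult i j * b i j)%N = L.
Hypothesis L0 : (0 < L)%N.
Hypothesis Q0 : (0 < Q)%N.
Variables (B Pd : node -> node -> R) (eps : R).
Hypothesis eps0 : 0 <= eps.
Hypothesis B0 : forall i j, 0 <= B i j.
Local Notation JN := (V * #|{: edge}| * F)%N.
Hypothesis codes : forall i j, (0 < mult i j)%N ->
  exists X D, @link_code R (h j i) (b i j) Q (B i j) (Pd i j) eps X D.
Hypothesis powerP : forall i j, (0 < mult i j)%N -> Pd i j + B i j * (JN%:R * eps) <= P.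
Local Notation msgs := {ffun 'I_V * 'I_F -> 'I_Q}.

Section paths.
Variables (path : 'I_V -> nat -> edge) (plen : 'I_V -> nat).
Hypotheses (path_src : forall p, edge_tl (path p 0%N) = src N)
  (path_step : forall p d, (d < plen p)%N -> edge_hd (path p d) = edge_tl (path p d.+1))
  (path_dst : forall p, edge_hd (path p (plen p)) = dst N)
  (plen_lt : forall p, (plen p < #|{: edge}|)%N)
  (path_inj : forall p q d d', (d <= plen p)%N -> (d' <= plen q)%N ->
        path p d = path q d' -> p = q /\ d = d').

Definition job := {x : 'I_V * 'I_#|{: edge}| * 'I_F | (x.1.2 <= plen x.1.1)%N}.
Implicit Type j : job.

Definition jpath j := (val j).1.1.
Definition jhop j : nat := (val j).1.2.
Definition jframe j := (val j).2.
Definition jedge j : edge := path (jpath j) (jhop j).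
Definition jslot j := (val (jedge j)).1.1.
Definition jidx j := (val (jedge j)).2.
Definition jtx j := edge_tl (jedge j).
Definition jrx j := edge_hd (jedge j).
Definition jlen j := b (jtx j) (jrx j).
(* Hop [d] of frame [f] takes place in period [f + d], after hop [d - 1] has been
   decoded. *)
Definition jbeg j := (((jframe j + jhop j) * T + jslot j) * L + jidx j * jlen j)%N.

(** At hop 0 this is a junk value; the transmitter is then the source, which reads its message
    instead. *)
Definition jpred j : job := insubd j
  (jpath j, Ordinal (leq_ltn_trans (leq_pred _) (ltn_ord (val j).1.2)), jframe j).

Definition jlast p f : job :=
  Sub (p, Ordinal (plen_lt p), f) (leqnn (plen p)).

Definition slot_state t : state N := sl (inord (t %/ L %% T)).

Definition jmsg (w : 'I_#|{: msgs}|) j : 'I_Q := (enum_val w : msgs) (jpath j, jframe j).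
Definition jfin (G : {ffun job -> 'I_Q}) : 'I_#|{: msgs}| :=
  enum_rank [ffun x => G (jlast x.1 x.2)].

Lemma jhop_le j : (jhop j <= plen (jpath j))%N.
Proof. exact: valP j. Qed.

Lemma jidx_lt j : (jidx j < mult (jtx j) (jrx j))%N.
Proof. by have /andP[] := valP (jedge j). Qed.

Lemma mult_gt0 j : (0 < mult (jtx j) (jrx j))%N.
Proof. exact: leq_ltn_trans (jidx_lt j). Qed.

Lemma jblock_le j : (jidx j * jlen j + jlen j <= L)%N.
Proof. by rewrite -mulSnr -(bL (mult_gt0 j)) leq_mul2r jidx_lt orbT. Qed.

Local Notation on_air := (on_air jbeg jlen).

(** Time is read in mixed radix: period, slot, block, position in the block. *)
Lemma on_air_slot j t : on_air j t ->
  (t %/ L)%N = ((jframe j + jhop j) * T + jslot j)%N /\ (t %% L %/ jlen j)%N = jidx j.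
Proof.
rewrite /on_air /jbeg; set S := (_ * T + _)%N => /andP[t1 t2].
have bl := jblock_le j.
have [r rE] : exists r, t = (S * L + (jidx j * jlen j + r))%N.
  by exists (t - (S * L + jidx j * jlen j))%N; rewrite addnA subnKC.
have rl : (r < jlen j)%N by move: t2; rewrite rE -!addnA !ltn_add2l.
have lL : (jidx j * jlen j + r < L)%N by apply: leq_trans bl; rewrite ltn_add2l.
have l0 : (0 < jlen j)%N by exact: leq_ltn_trans rl.
by rewrite rE divnMDl// divn_small// addn0 modnMDl modn_small// divnMDl// divn_small// addn0.
Qed.

Lemma jobs_end j : (jbeg j + jlen j <= (F + #|{: edge}|) * T * L)%N.
Proof.
rewrite /jbeg -addnA; apply: leq_trans (leq_add (leqnn _) (jblock_le j)) _.
rewrite -mulSnr leq_mul2r; apply/orP; right; rewrite -addnS.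
apply: leq_trans (leq_add (leqnn _) (ltn_ord (jslot j))) _.
rewrite -mulSnr leq_mul2r /=.
have := ltn_ord (jframe j); have := ltn_ord (val j).1.2; rewrite /jhop; lia.
Qed.

Lemma on_air_state j t : on_air j t -> slot_state t = sl (jslot j).
Proof.
move=> /on_air_slot[tE _]; rewrite /slot_state tE modnMDl modn_small ?inord_val//.
Qed.

Lemma jobs_active j t : on_air j t -> active_in (slot_state t) (jtx j) (jrx j).
Proof.
by move=> /on_air_state ->; have /andP[] := valP (jedge j).
Qed.

(** The transmit beam determines the receiver, and the time determines the slot, the block and the
    sum of frame and hop. This fixes the edge; by disjointness of the paths the edge fixes path and
    hop, and then the frame is fixed too. *)
Lemma jobs_inj j j' t : on_air j t -> on_air j' t -> jtx j = jtx j' -> j = j'.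
Proof.
move=> jt jt' txE.
have rxE : jrx j = jrx j'.
  have := jobs_active jt; have := jobs_active jt'.
  by rewrite /active_in /active -txE => /andP[/eqP -> _] /andP[/eqP[->] _].
have lE : jlen j = jlen j' by rewrite /jlen txE rxE.
have [sE iE] := on_air_slot jt; have [sE' iE'] := on_air_slot jt'.
have kE : jslot j = jslot j'.
  apply: val_inj; have := congr1 (modn^~ T) (esym sE); rewrite sE' !modnMDl.
  by rewrite !modn_small.
have ff : (jframe j + jhop j)%N = (jframe j' + jhop j')%N.
  move: sE; rewrite sE' kE => /addIn/eqP.
  by rewrite eqn_mul2r => /eqP.
have eE : jedge j = jedge j'.
  apply: val_inj; move: kE txE rxE; rewrite /jslot /jtx /jrx /edge_tl /edge_hd.
  have : (val (jedge j)).2 = (val (jedge j')).2.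
    by apply: val_inj; rewrite /= -[LHS]/(jidx j : nat) -iE lE iE'.
  by case: (val (jedge j)) => [[? [? ?]] ?]; case: (val (jedge j')) => [[? [? ?]] ?] /= -> -> -> ->.
have [pE dE] := path_inj (jhop_le j) (jhop_le j') eE.
apply: val_inj; move: pE dE ff; rewrite /jpath /jhop /jframe.
case: (val j) => [[? ?] ?]; case: (val j') => [[? ?] ?] /= -> /val_inj -> /addIn/val_inj ->//.
Qed.

Lemma jpredP j : jtx j != src N ->
  [/\ jrx (jpred j) = jtx j, (jbeg (jpred j) + jlen (jpred j) <= jbeg j)%N &
      forall w, jmsg w (jpred j) = jmsg w j].
Proof.
move=> js; have vE : val (jpred j) =
    (jpath j, Ordinal (leq_ltn_trans (leq_pred _) (ltn_ord (val j).1.2)), jframe j).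
  by rewrite insubdK// unfold_in /=; apply: leq_trans (leq_pred _) (jhop_le j).
have d0 : (0 < jhop j)%N.
  by rewrite lt0n; apply: contraNneq js => d0; rewrite /jtx /jedge d0 path_src.
have dE : jhop (jpred j) = (jhop j).-1 by rewrite /jhop vE.
have pE : jpath (jpred j) = jpath j by rewrite /jpath vE.
have fE : jframe (jpred j) = jframe j by rewrite /jframe vE.
split.
- rewrite /jrx /jtx /jedge dE pE path_step ?prednK//.
  exact: jhop_le.
- rewrite {1}/jbeg -addnA; apply: leq_trans (leq_add (leqnn _) (jblock_le _)) _.
  rewrite -mulSnr /jbeg fE dE; apply: leq_trans (leq_addr _ _); rewrite leq_mul2r.
  apply/orP; right; rewrite -addnS; apply: leq_trans (leq_addr _ _).
  apply: leq_trans (leq_add (leqnn _) (ltn_ord _)) _.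
  by rewrite -mulSnr -addnS prednK.
- by move=> w; rewrite /jmsg pE fE.
Qed.

Lemma jfinP w (G : {ffun job -> 'I_Q}) :
  (forall j, jrx j = dst N -> G j = jmsg w j) -> jfin G = w.
Proof.
move=> GE; rewrite /jfin -[RHS]enum_valK; congr enum_rank; apply/ffunP => -[p f].
by rewrite ffunE GE//= /jrx /jedge path_dst.
Qed.

Lemma jmsg_uniform j (g : 'I_Q -> R) :
  Q%:R * \sum_(w < #|{: msgs}|) g (jmsg w j) = #|{: msgs}|%:R * \sum_(q < Q) g q.
Proof.
have := @sum_ffun_coord R _ _ (jpath j, jframe j) g; rewrite card_ord => <-.
congr (_ * _); rewrite [RHS](reindex (fun w : 'I_#|{: msgs}| => enum_val w : msgs))//.
exact: onW_bij (enum_val_bij _).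
Qed.

Lemma paths_code : exists c : Defs.code R N ((F + #|{: edge}|) * T * L) #|{: msgs}|,
  admissible m P h c /\ (Perr m h c <= (JN%:R * eps)%:E)%E.
Proof.
have cj j := cid (codes (mult_gt0 j)).
have cd j := cid (projT2 (cj j)).
have Jle : (#|{: job}| <= JN)%N.
  by rewrite card_sub; apply: leq_trans (max_card _) _; rewrite !card_prod !card_ord.
have Jeps : #|{: job}|%:R * eps <= JN%:R * eps by rewrite ler_wpM2r// ler_nat.
have M0 : (0 < #|{: msgs}|)%N by rewrite card_ffun card_ord expn_gt0 Q0.
have [|c [adm perr]] := @schedule_code R N m P h _ _ Q P0 slot_state
  (fun t => sl_valid _) job jtx jrx jbeg jlen jpred jobs_end jobs_active jobs_inj
  jmsg jfin jpredP jfinP jmsg_uniform (fun j => projT1 (cj j)) (fun j => projT1 (cd j))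
  (fun j => B (jtx j) (jrx j)) (fun j => Pd (jtx j) (jrx j)) eps (fun j => projT2 (cd j)) M0
  (fun j => B0 _ _).
  move=> j; apply: le_trans (powerP (mult_gt0 j)); rewrite lerD2l.
  by apply: ler_wpM2l => //; exact: B0.
exists c; split => //; apply: le_trans perr _; rewrite lee_fin//.
Qed.

End paths.

Lemma scheme_code : exists c : Defs.code R N ((F + #|{: edge}|) * T * L) #|{: msgs}|,
  admissible m P h c /\ (Perr m h c <= (JN%:R * eps)%:E)%E.
Proof.
have sd : src N != dst N by [].
have [|path [plen [A1 A2 A3 A4 A5]]] := @disjoint_paths edge node edge_tl edge_hd _ _ sd V edge_hd_src.
  by move=> Om sOm tOm; rewrite card_edge_cut; apply: cutV; rewrite /is_cut sOm.
exact: paths_code A1 A2 A3 A4 A5.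
Qed.

End scheme.

Lemma fin_pos_lower {R : realType} (I : finType) (A : pred I) (f : I -> R) :
  (forall i, A i -> 0 < f i) -> exists2 e : R, 0 < e & forall i, A i -> e <= f i.
Proof.
move=> f0; exists (\big[Num.min/1]_(i | A i) f i).
  by apply: lt_bigmin.
by move=> i Ai; exact: bigmin_le_cond.
Qed.

(** Rates of links must lie strictly below capacity, so a positive integer is rounded down to its
    predecessor. *)
Lemma nat_strictly_below {R : realType} (x : R) : 0 <= x -> exists k : nat,
  [/\ x - 1 <= k%:R, k%:R <= x & (0 < k)%N -> k%:R < x].
Proof.
move=> x0; have /andP[lo hi] := truncn_itv x0.
have [lt|ge] := ltP (Num.truncn x)%:R x.
  exists (Num.truncn x); split=> //; rewrite lerBlDr natr1; exact: ltW.
have xE : x = (Num.truncn x)%:R by apply/eqP; rewrite eq_le lo ge.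
case kE : (Num.truncn x) xE => [|k] xE.
  by exists 0%N; rewrite xE; split=> //; rewrite lerBlDr lerDl.
by exists k; rewrite xE -natr1 addrK; split=> // [|_]; rewrite ?lerDl ?ltrDl.
Qed.

Lemma sqr_le_exp2 u : (4 <= u)%N -> (u * u <= 2 ^ u)%N.
Proof.
elim: u => // u IH; rewrite leq_eqVlt => /orP[/eqP <-//|]; rewrite ltnS => u4.
by have := IH u4; rewrite expnS; nia.
Qed.

(** * Choice of the parameters *)

Section parameters.
Context {R : realType} {N : nat}.
Local Notation C := (R * R)%type.
Local Notation node := (node N).
Variables (m : mode) (P : R) (h : node -> node -> C).
Hypothesis P0 : 0 <= P.
Variable lam : state N -> R.
Hypothesis distr : is_state_distr m lam.

(** State [s] gets the integer part of [T * lam s] slots, laid out through the disjoint union [A];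
    the slots left over are idle. *)
Lemma time_sharing (T : nat) : exists sl : 'I_T -> state N,
  (forall k, valid_state m (sl k)) /\
  forall s, T%:R * lam s - 1 <= #|[set k | sl k == s]%SET|%:R.
Proof.
have [l0 linv l1] := distr.
pose cnt s := Num.truncn (T%:R * lam s).
have cntP s : (cnt s)%:R <= T%:R * lam s < (cnt s).+1%:R.
  by apply: truncn_itv; rewrite mulr_ge0.
pose A := {s : state N & 'I_(cnt s)}.
have AT : (#|{: A}| <= T)%N.
  rewrite card_tagged sumnE big_map big_enum/= -(ler_nat R) natr_sum.
  apply: (@le_trans _ _ (\sum_s T%:R * lam s)); last by rewrite -mulr_sumr l1 mulr1.
  by apply: ler_sum => s _; rewrite card_ord; have /andP[] := cntP s.
pose sl (k : 'I_T) := if insub (k : nat) is Some a then tag (enum_val (a : 'I_#|{: A}|)) else idle.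
exists sl; split=> [k|s].
  rewrite /sl; case: insub => [a|]; last exact: valid_idle.
  case: (enum_val a) => s i /=; apply/negPn/negP => sinv.
  have i0 : (0 < cnt s)%N by exact: leq_ltn_trans (ltn_ord i).
  by have /andP[+ _] := cntP s; rewrite linv// mulr0 (ler_nat R _ 0) leqNgt i0.
pose f (i : 'I_(cnt s)) := widen_ord AT (enum_rank (Tagged (fun s => 'I_(cnt s)) i : A)).
have finj : injective f.
  by move=> i j /(congr1 val)/= /val_inj/enum_rank_inj/eqP; rewrite -tag_eqE /tag_eq eqxx tagged_asE => /eqP.
have : (cnt s <= #|[set k | sl k == s]%SET|)%N.
  rewrite -[X in (X <= _)%N]card_ord -(card_imset _ finj); apply/subset_leq_card/fintype.subsetP.
  by move=> k /imsetP[i _ ->]; rewrite inE /sl /= valK enum_rankK.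
rewrite -(ler_nat R) => /(le_trans _); apply.
by have /andP[_] := cntP s; rewrite -natr1 lerBlDr => /ltW.
Qed.

(** Rounding [lam] loses at most one slot per state, rounding the link capacities at most one edge
    per slot and link. The last two hypotheses make each loss at most [T * k * dl]. *)
Lemma cut_units (T k : nat) (sl : 'I_T -> state N) (mult : node -> node -> nat)
    (dl : R) (Om : {set node}) :
  (forall s, T%:R * lam s - 1 <= #|[set k | sl k == s]%SET|%:R) ->
  (forall i j, k%:R * ell P h j i - 1 <= (mult i j)%:R) ->
  (forall i j, (mult i j)%:R <= k%:R * ell P h j i) ->
  (N.+2 ^ 2)%:R <= k%:R * dl ->
  #|state N|%:R * (\sum_i \sum_j ell P h j i) <= T%:R * dl ->
  T%:R * k%:R * (cut_value m P h lam Om - 2 * dl) <=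
  (\sum_(t < T) \sum_(i in Om) \sum_(j in ~: Om) active_in (sl t) i j * mult i j)%N%:R.
Proof.
move=> slP mlo mhi kd Td; have [l0 linv l1] := distr.
pose S : R := #|state N|%:R.
pose A i j := \sum_(s | valid_state m s && active_in s i j) lam s.
have link i j : T%:R * k%:R * (A i j * ell P h j i) - T%:R - k%:R * S * ell P h j i <=
    (\sum_(t < T) active_in (sl t) i j * mult i j)%N%:R.
  rewrite -big_distrl/= natrM.
  have A1 : A i j <= 1 by exact: (distr_sum_le1 _ distr).
  have A0 : 0 <= A i j by apply: sumr_ge0.
  have cntE : (\sum_(t < T) active_in (sl t) i j)%N =
      (\sum_(s | active_in s i j) #|[set t | sl t == s]%SET|)%N.
    transitivity (\sum_(t < T) \sum_(s | active_in s i j) (sl t == s))%N.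
      apply: eq_bigr => t _; case E : (active_in (sl t) i j).
        rewrite (bigD1 (sl t))//= eqxx big1 ?addn0// => s /andP[_].
        by rewrite eq_sym => /negbTE ->.
      by rewrite big1// => s sE; case: eqP => // ts; rewrite ts sE in E.
    rewrite exchange_big; apply: eq_bigr => s _.
    by rewrite -sum1_card [RHS]big_mkcond; apply: eq_bigr => t _; rewrite inE; case: (_ == _).
  have cnt : T%:R * A i j - S <= (\sum_(t < T) active_in (sl t) i j)%N%:R.
    rewrite cntE natr_sum.
    apply: (@le_trans _ _ (\sum_(s | active_in s i j) (T%:R * lam s - 1))).
      rewrite sumrB; apply: lerB.
        have -> : A i j = \sum_(s | active_in s i j && valid_state m s) lam s.
          by apply: eq_bigl => s; rewrite andbC.
        rewrite -mulr_sumr ler_wpM2l// [leRHS](bigID (valid_state m))/= lerDl.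
        by apply: sumr_ge0.
      by rewrite sumr_const -/S ler_nat max_card.
    by apply: ler_sum => s _; exact: slP.
  have e0 : 0 <= ell P h j i by exact: ell_ge0.
  have S0 : 0 <= S by [].
  have m0 : 0 <= (mult i j)%:R :> R by [].
  have := ler_wpM2r m0 cnt; apply: le_trans.
  rewrite mulrBl.
  have := ler_wpM2l S0 (mhi i j).
  have TA : 0 <= T%:R * A i j by rewrite mulr_ge0.
  have := ler_wpM2l TA (mlo i j).
  have : T%:R * A i j <= T%:R by rewrite ler_piMr.
  lra.
have -> : (\sum_(t < T) \sum_(i in Om) \sum_(j in ~: Om) active_in (sl t) i j * mult i j)%N =
    (\sum_(i in Om) \sum_(j in ~: Om) \sum_(t < T) active_in (sl t) i j * mult i j)%N.
  by rewrite exchange_big; apply: eq_bigr => i _; rewrite exchange_big.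
rewrite natr_sum; under eq_bigr do rewrite natr_sum.
apply: (@le_trans _ _ (\sum_(i in Om) \sum_(j in ~: Om)
   (T%:R * k%:R * (A i j * ell P h j i) - (T%:R + k%:R * S * ell P h j i)))); last first.
  apply: ler_sum => i _; apply: ler_sum => j _; rewrite opprD addrA; exact: link.
under eq_bigr do rewrite sumrB.
rewrite sumrB.
have -> : \sum_(i in Om) \sum_(j in ~: Om) T%:R * k%:R * (A i j * ell P h j i) =
    T%:R * k%:R * cut_value m P h lam Om.
  by rewrite /cut_value !mulr_sumr; apply: eq_bigr => i _; rewrite mulr_sumr.
rewrite mulrBr lerD2l lerN2.
apply: (@le_trans _ _ (\sum_(i : node) \sum_(j : node) (T%:R + k%:R * S * ell P h j i))).
  have pos i j : 0 <= T%:R + k%:R * S * ell P h j i.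
    by rewrite addr_ge0// mulr_ge0 ?ell_ge0// mulr_ge0.
  rewrite [leRHS](bigID (mem Om))/=; apply: ler_wpDr.
    by apply: sumr_ge0 => i _; apply: sumr_ge0.
  apply: ler_sum => i _; rewrite [leRHS](bigID (mem (~: Om)))/=; apply: ler_wpDr => //.
  by apply: sumr_ge0.
under eq_bigr do rewrite big_split/= -mulr_sumr sumr_const card_ord.
rewrite big_split/= -mulr_sumr sumr_const card_ord.
have : T%:R * (N.+2 ^ 2)%:R <= T%:R * (k%:R * dl) by rewrite ler_wpM2l.
have := ler_wpM2l (ler0n R k) Td; rewrite -/S.
rewrite -mulrnA -[_ *+ (N.+2 * N.+2)]mulr_natr -mulnn; lra.
Qed.


(** A block of length [k * u / mult i j] carries [u] bits, that is [mult i j / k] bits per letter,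
    strictly below the capacity of the link. A maximum over the finitely many links gives a common
    [L0]. *)
Lemma link_params (k : nat) (mult : node -> node -> nat) : (0 < k)%N ->
  (forall i j, (0 < mult i j)%N -> (mult i j)%:R < k%:R * ell P h j i) ->
  exists B Pd : node -> node -> R,
  [/\ forall i j, 0 <= B i j, forall i j, (0 < mult i j)%N -> Pd i j < P &
  forall eps, 0 < eps -> exists L0 : nat, forall i j u, (0 < mult i j)%N ->
    forall L, (mult i j * L)%N = (k * u)%N -> (L0 <= L)%N -> (L <= 2 ^ u)%N ->
    exists X D, @link_code R (h j i) L (2 ^ u) (B i j) (Pd i j) eps X D].
Proof.
move=> k0 mlt; have l2 := @ln2_gt0 R; have k0' : 0 < k%:R :> R by rewrite ltr0n.
pose r0 i j : R := ln 2 * (mult i j)%:R / k%:R.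
have link (p : node * node) : exists BP : R * R, 0 <= BP.1 /\
  ((0 < mult p.1 p.2)%N -> BP.2 < P /\ forall eps, 0 < eps ->
    exists L0 : nat, forall L M : nat, (L0 <= L)%N -> (L <= M)%N ->
      M%:R <= expR (L%:R * r0 p.1 p.2) ->
      exists X D, @link_code R (h p.2 p.1) L M BP.1 BP.2 eps X D).
  have [p0|p0] := posnP (mult p.1 p.2).
    by exists (0, 0); split=> [|/=]; rewrite ?p0.
  have r00 : 0 <= r0 p.1 p.2 by rewrite divr_ge0// mulr_ge0// ltW.
  have r0lt : r0 p.1 p.2 < ln (1 + P * cnorm2 (h p.2 p.1)).
    rewrite ln_log2 -/(ell P h p.2 p.1) /r0 ltr_pdivrMr// -mulrA ltr_pM2l//.
    by rewrite mulrC mlt.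
  by have [B [Pd [B0 PdP H]]] := coding_theorem P0 r00 r0lt; exists (B, Pd).
have [BP BPP] := choice link.
exists (fun i j => (BP (i, j)).1), (fun i j => (BP (i, j)).2); split.
- by move=> i j; have [] := BPP (i, j).
- by move=> i j ij; have [_ /(_ ij)[]] := BPP (i, j).
move=> eps eps0.
have exL (p : node * node) : exists L0 : nat, (0 < mult p.1 p.2)%N ->
    forall L M : nat, (L0 <= L)%N -> (L <= M)%N -> M%:R <= expR (L%:R * r0 p.1 p.2) ->
      exists X D, @link_code R (h p.2 p.1) L M (BP p).1 (BP p).2 eps X D.
  have [p0|p0] := posnP (mult p.1 p.2); first by exists 0%N.
  have [_ /(_ p0)[_ /(_ _ eps0)[L0 H]]] := BPP p.
  by exists L0.
have [L0 L0P] := choice exL.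
exists (\max_p L0 p) => i j u ij L LE L0L Lu.
apply: (L0P (i, j) ij) => //; first by apply: leq_trans L0L; exact: leq_bigmax.
have -> : L%:R * r0 i j = ln 2 *+ u.
  have : (mult i j)%:R * L%:R = k%:R * u%:R :> R by rewrite -!natrM LE.
  rewrite /r0 -[ln 2 *+ u]mulr_natr => H.
  by rewrite mulrA mulrCA [L%:R * _]mulrC H -mulrA [k%:R * _]mulrC mulfK ?gt_eqF.
by rewrite -lnXn// lnK ?posrE ?exprn_gt0// natrX.
Qed.

Theorem cut_achievable (r : R) : r < min_cut m P h lam -> achievable m P h r.
Proof.
move=> rlt eps eps0 n0.
pose mc := min_cut m P h lam.
(* Two quarters are lost in [cut_units], one in rounding to the integer [V], one in the periods
   added at the end to complete the last frames. *)
pose dl := (mc - r) / 4.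
have dl0 : 0 < dl by rewrite divr_gt0// subr_gt0.
have large (x : R) : exists2 k, (0 < k)%N & x <= k%:R * dl.
  exists (Num.truncn (x / dl)).+1 => //.
  by rewrite -ler_pdivrMr//; apply: ltW; exact: truncnS_gt.
have [k k0 kP] := large ((N.+2 ^ 2)%:R).
have [T0 T00 TP] := large (#|state N|%:R * (\sum_i \sum_j ell P h j i)).
case: T0 => // T0 in T00 TP *.
have k1 : 1 <= k%:R * dl.
  by apply: le_trans kP; rewrite ler1n expn_gt0.
have e0 i j : 0 <= k%:R * ell P h j i by rewrite mulr_ge0// ell_ge0.
have [mult multP] := choice (fun p : node * node => nat_strictly_below (e0 p.1 p.2)).
have [sl [sl_valid slP]] := time_sharing T0.+1.
pose mlt i j := mult (i, j).
pose Tk : R := T0.+1%:R * k%:R.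
have Tk0 : 0 < Tk by rewrite mulr_gt0 ?ltr0n.
pose V := Num.truncn (Tk * (mc - 2 * dl)).
have cutV (Om : {set node}) : is_cut Om -> (V <= \sum_(t < T0.+1) \sum_(i in Om)
    \sum_(j in ~: Om) active_in (sl t) i j * mlt i j)%N.
  move=> cOm; rewrite /V; set S := (\sum_(t < _) _)%N.
  (* [r] may be so negative that this quantity is negative, and then [V = 0]. *)
  have [x0|x0] := leP 0 (Tk * (mc - 2 * dl)); last first.
    by rewrite (_ : Num.truncn _ = 0%N)//; apply/eqP; rewrite -leqn0 truncn_le_nat; apply: lt_trans x0 _.
  rewrite -(ler_nat R); apply: le_trans (_ : Tk * (mc - 2 * dl) <= _).
    by rewrite truncn_le.
  apply: (@le_trans _ _ (Tk * (cut_value m P h lam Om - 2 * dl))).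
    by rewrite ler_pM2l// lerB//; exact: min_cut_le.
  by apply: cut_units => // i j; have [] := multP (i, j).
have VP : Tk * (r + dl) <= V%:R.
  have : Tk * (mc - 2 * dl) < V.+1%:R by exact: truncnS_gt.
  rewrite -natr1.
  have : 1 <= Tk * dl by rewrite /Tk -mulrA; apply: mulr_ege1 => //; rewrite ler1n.
  have -> : mc = r + 4 * dl by rewrite /dl; field.
  by nra.
pose E := #|{: edge sl mlt}|.
(* [F] frames take [F + E] periods; this many frames make the overhead of [E] periods cost at most
   [dl] in rate. *)
have [F F0 FP] := large (E%:R * r).
have [B [Pd [B0 PdP codes]]] := link_params k0 (fun i j => let: And3 _ _ H := multP (i, j) in H).
pose J : R := (V * E * F)%N%:R.
have [x x0 xP] := @fin_pos_lower R _ (fun p : node * node => 0 < mlt p.1 p.2)%N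
  (fun p => (P - Pd p.1 p.2) / (B p.1 p.2 + 1)) (fun p p0 => ltac:(rewrite divr_gt0 ?subr_gt0 ?PdP ?ltr_wpDl ?B0//)).
(* [J] bounds the number of jobs. Neither it nor the power margin [x] depends on the block length,
   so the error probability per job can be fixed before the length is chosen. *)
pose e := Num.min x eps / (J + 1).
have J1 : 0 < J + 1 by rewrite ltr_wpDl.
have e00 : 0 < e by rewrite divr_gt0// lt_min x0.
have Je : J * e <= Num.min x eps.
  rewrite /e mulrCA ler_piMr ?le_min ?(ltW x0) ?(ltW eps0)//.
  by rewrite ler_pdivrMr// mul1r lerDl.
have [L0 L0P] := codes e e00.
(* A common multiple of the positive multiplicities, so that a slot of length [k * u] splits evenly
   for every link. *)
pose Dm := (\prod_(p : node * node) maxn (mlt p.1 p.2) 1)%N.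
have Dm0 : (0 < Dm)%N by apply: prodn_gt0 => p; rewrite leq_max orbT.
(* The bounds by [k] and 4 give [k * u <= u * u <= 2 ^ u], so no block is longer than the number of
   its codewords, as the coding theorem requires. *)
have [u0 [uL un uk u4]] : exists u0, [/\ L0 <= u0, n0 <= u0, k <= u0 & 4 <= u0]%N.
  by exists (maxn (maxn L0 n0) (maxn k 4)); split; rewrite !leq_max leqnn ?orbT.
pose u := (Dm * u0)%N.
have u0u : (u0 <= u)%N by rewrite /u leq_pmull.
pose b i j := (k * (Dm %/ mlt i j) * u0)%N.
have bL i j : (0 < mlt i j)%N -> (mlt i j * b i j)%N = (k * u)%N.
  move=> ij; have dv : (mlt i j %| Dm)%N.
    by rewrite /Dm (bigD1 (i, j))//= dvdn_mulr// (maxn_idPl ij).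
  rewrite /b /u -[in RHS](divnK dv) !mulnA [(mlt i j * k)%N]mulnC -(mulnA k).
  by rewrite [(mlt i j * _)%N]mulnC !mulnA.
have bu0 i j : (0 < mlt i j)%N -> (u0 <= b i j)%N.
  move=> ij; rewrite /b leq_pmull// muln_gt0 k0 divn_gt0// dvdn_leq//.
  by rewrite /Dm (bigD1 (i, j))//= dvdn_mulr// (maxn_idPl ij).
have bu i j : (0 < mlt i j)%N -> (b i j <= 2 ^ u)%N.
  move=> ij; apply: (@leq_trans (k * u)); first by rewrite -(bL i j)// leq_pmull.
  apply: leq_trans (sqr_le_exp2 _); last exact: leq_trans u0u.
  by rewrite leq_mul2r (leq_trans uk u0u) orbT.
have u_gt0 : (0 < u)%N by apply: leq_trans u0u; exact: leq_trans u4.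
have [] := @scheme_code R N m P h T0 sl mlt P0 sl_valid V F (k * u) (2 ^ u) cutV b bL _ _
  B Pd e (ltW e00) B0.
- by rewrite muln_gt0 k0.
- by rewrite expn_gt0.
- move=> i j ij; apply: L0P => //; [exact: bL| |exact: bu].
  exact: leq_trans uL (bu0 _ _ ij).
- move=> i j ij; rewrite -/J.
  have := xP (i, j) ij; rewrite /= ler_pdivlMr ?ltr_wpDl// => H.
  have : J * e <= x by apply: le_trans Je _; rewrite ge_min lexx.
  have := B0 i j; nra.
move=> c [adm perr]; do 3 eexists; split; last first.
- by apply: le_trans perr _; rewrite lee_fin; apply: le_trans Je _; rewrite ge_min lexx orbT.
- exact: adm.
- have -> : log2 (#|{: {ffun 'I_V * 'I_F -> 'I_(2 ^ u)}}|%:R : R) = (u * (V * F))%N%:R.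
    rewrite card_ffun card_prod !card_ord -expnM natrX /log2 lnXn//.
    by rewrite -[X in X / _]mulr_natl mulfK// gt_eqF// ln2_gt0.
  have -> : ((F + E) * T0.+1 * (k * u))%N%:R * r = u%:R * (Tk * (F%:R * r + E%:R * r)).
    by rewrite !natrM natrD /Tk; ring.
  rewrite natrM ler_wpM2l// natrM.
  have : F%:R * (Tk * (r + dl)) <= F%:R * V%:R by rewrite ler_wpM2l.
  have : Tk * (E%:R * r) <= Tk * (F%:R * dl) by rewrite ler_pM2l.
  lra.
- by rewrite card_ffun card_ord expn_gt0 expn_gt0.
- have n1 : (k * u <= (F + E) * T0.+1 * (k * u))%N by rewrite leq_pmull// muln_gt0 addn_gt0 F0.
  have uk' : (u <= k * u)%N by rewrite leq_pmull.
  split; last exact: leq_trans (leq_trans u_gt0 uk') n1.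
  by apply: leq_trans n1; apply: leq_trans uk'; exact: leq_trans u0u.
Qed.

End parameters.

Lemma capacity_ge {R : realType} {N : nat} (m : mode) (P : R)
    (h : node N -> node N -> R * R) : 0 <= P ->
  ((Ccs_iid m P h)%:E <= capacity m P h)%E.
Proof.
move=> P0; apply/lee_subgt0Pr => e e0.
have [_ [lam [distr ->]] lt] := sup_adherent e0 (has_sup_rates m h P0).
by apply: ereal_sup_ubound; exists (Ccs_iid m P h - e) => //; exact: (cut_achievable P0 distr).
Qed.

Theorem theorem1 (R : realType) (N : nat) (m : mode) (P : R)
    (h : 'I_N.+2 -> 'I_N.+2 -> R * R) :
  0 <= P ->
  ((Ccs_iid m P h)%:E <= capacity m P h)%E /\
  (capacity m P h <= (Ccs_iid m P h + GAP R N m)%:E)%E.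
Proof. by move=> P0; split; [exact: capacity_ge|exact: capacity_le]. Qed.
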